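(* Let $\mathcal Q$ be a unary query on $p$-labelled graphs. Then the following are equivalent. (1) $\mathcal Q$ is computable by a polynomial-weight bounded-depth family of GNNs with random initialisation and with rpl-approximable activation functions. (2) $\mathcal Q$ is in (non-uniform) $\mathsf{TC}^0$.
   Context: Graphs are finite, simple, undirected, with nonempty vertex set. A $p$-labelled graph is $(G,\mathbf b)$ with $\mathbf b:V(G)\to\{0,1\}^p$. A unary query $\mathcal Q$ assigns to each $(G,\mathbf b)$ a map $\mathcal Q(G,\mathbf b):V(G)\to\{0,1\}$, invariant under label-preserving isomorphisms. FNNs: $\mathfrak F=(V,E,(\mathfrak a_v),(w_e),(b_v))$ with finite dag skeleton, Lipschitz continuous activations, real weights and biases; sources are inputs, sinks outputs; a non-input node computes $\mathfrak a_v(b_v+\sum_{uv\in E}w_{uv}\cdot\text{value}(u))$. Depth: longest path length. Weight: $|V|+|E|+\max_e|w_e|+\max_v|b_v|+\max_v(\lambda(\mathfrak a_v)+\mathfrak a_v(0))$, $\lambda(\mathfrak a_v)$ the least integer Lipschitz constant. GNNs with global readout: a layer consists of $\mathrm{msg},\mathrm{comb}$ computed by FNNs and aggregation functions $\mathrm{agg},\mathrm{agg}'\in\{$sum, mean, max$\}$ (coordinatewise, $\mathbf 0$ on the empty multiset) and maps a signal $\mathcal x:V(G)\to\mathbb R^p$ to $\mathcal y(v)=\mathrm{comb}\big(\mathcal x(v),\mathrm{agg}\{\!\{\mathrm{msg}(\mathcal x(v),\mathcal x(w)):w\in N(v)\}\!\},\mathrm{agg}'\{\!\{\mathcal x(w):w\in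 V(G)\}\!\}\big)$; a GNN composes finitely many layers; $\tilde{\mathfrak N}(G,\mathcal x)$ is the output signal. Weight: sum of weights of all FNNs; depth: number of layers times maximum FNN depth. Random initialisation: a GNN with random initialisation of input dimension $p$, output dimension $1$ and randomness dimension $r$ is a GNN with global readout of input dimension $p+r$; on $(G,\mathbf b)$ it is run on the signal $v\mapsto \mathbf b(v)\mathbf r(v)$ (concatenation), where all $r|V(G)|$ entries of $\mathbf r$ are chosen independently uniformly from $[0,1]$; this gives a random output $\tilde{\mathfrak R}(G,\mathbf b)$. A family $(\mathfrak R^{(n)})_n$ computes $\mathcal Q$ if for all $(G,\mathbf b)$ of order $n$ and all $v$: $\Pr(\tilde{\mathfrak R}^{(n)}(G,\mathbf b)(v)\ge3/4)\ge3/4$ if $\mathcal Q(G,\mathbf b)(v)=1$, and $\Pr(\tilde{\mathfrak R}^{(n)}(G,\mathbf b)(v)\le1/4)\ge3/4$ if $\mathcal Q(G,\mathbf b)(v)=0$. Polynomial weight / bounded depth: weight of the $n$-th member bounded by a polynomial in $n$ / depth bounded by a constant. rpl-approximable: there is a polynomial $\pi'(X,Y)$ such that for all $n$ and $\epsilon>0$ every activation of the $n$-th member has an $\epsilon$-approximation ($|f(x)-g(x)|\le\epsilon|f(x)|+\epsilon$ for all $x$) by a piecewise linear function whose finitely many thresholds, slopes and constants (minimal representation) are dyadic rationals, of total bitsize at most $\pi'(\epsilon^{-1},n)$. $\mathsf{TC}^0$: for a linear order $\leqslant$ on $V(G)$ let $\langle i\rangle$ be its $(i+1)$-st element and $s(G,\mathbf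 b,\leqslant)$ a standard binary encoding of the ordered structure. $L_\leqslant(\mathcal Q)$ is the set of (binary-encoded) strings $s(G,\mathbf b,\leqslant)\#\mathrm{bin}(i)$ with $\mathcal Q(G,\mathbf b)(\langle i\rangle)=1$, over all $(G,\mathbf b)$ and linear orders. $\mathcal Q$ is in $\mathsf{TC}^0$ if $L_\leqslant(\mathcal Q)$ is decided by a family of Boolean circuits with negation, and, or and threshold gates, one per input length $n$, of bounded depth and size polynomial in $n$.
   Formalization: In the weight, a_v(0) is replaced by its absolute value |a_v(0)|, since with hugely negative a_v(0) the literal weight would admit families computing queries outside TC^0; the bitsize of a dyadic z/2^e is counted with e written in binary. *)

(* Defs.v *)
From HB Require Import structures.
From mathcomp Require Import all_boot all_order all_algebra all_fingroup.
From mathcomp Require Import all_classical all_reals all_analysis.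

Set Implicit Arguments.

Unset Printing Implicit Defensive.

Import Order.TTheory GRing.Theory Num.Theory.
Local Open Scope ring_scope.

Record lgraph (p n : nat) := LGraph {
  gadj : rel 'I_n;
  gadj_sym : symmetric gadj;
  gadj_irr : irreflexive gadj;
  glab : 'I_n -> 'I_p -> bool
}.

Definition query (p : nat) := forall n, lgraph p n -> 'I_n -> bool.

Definition lg_iso (p n : nat) (f : {perm 'I_n}) (G H : lgraph p n) :=
  (forall u v, gadj H (f u) (f v) = gadj G u v) /\
  (forall u, glab H (f u) = glab G u).

Definition is_query (p : nat) (Q : query p) :=
  forall n (G H : lgraph p n) (f : {perm 'I_n}),
    lg_iso f G H -> forall v, Q n H (f v) = Q n G v.

Definition dag_depth (N : nat) (E : rel 'I_N) : nat :=
  let d := iter N (fun d (v : 'I_N) => \max_(u | E u v) (d u).+1)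
                  (fun _ => 0%N) in
  \max_(v : 'I_N) d v.

Section Vectors.
Variable R : realType.
Definition vcat (m k : nat) (x : 'I_m -> R) (y : 'I_k -> R) : 'I_(m + k) -> R :=
  fun i => match fintype.split i with inl j => x j | inr j => y j end.
End Vectors.
Arguments vcat {R m k}.

Section FNN.
Variable R : realType.

Definition lipschitz_with (L : R) (f : R -> R) :=
  forall x y, `|f x - f y| <= L * `|x - y|.

Definition is_lipschitz (f : R -> R) := exists L : R, lipschitz_with L f.

Definition lipn (f : R -> R) : nat :=
  match pselect (exists L : nat, `[< lipschitz_with L%:R f >]) with
  | left h => ex_minn h
  | right _ => 0%N
  end.

Record fnn (m k : nat) := FNN {
  fn_N : nat;
  fn_E : rel 'I_fn_N;
  fn_w : 'I_fn_N -> 'I_fn_N -> R;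
  fn_b : 'I_fn_N -> R;
  fn_act : 'I_fn_N -> R -> R;
  fn_in : 'I_m -> 'I_fn_N;
  fn_out : 'I_k -> 'I_fn_N;
  fn_topo : forall u v, fn_E u v -> (u < v)%N;
  fn_in_inj : injective fn_in;
  fn_out_inj : injective fn_out;
  fn_src : forall v, (forall u, ~~ fn_E u v) <-> (exists i, fn_in i = v);
  fn_snk : forall v, (forall u, ~~ fn_E v u) <-> (exists j, fn_out j = v);
  fn_lip : forall v, (exists u, fn_E u v) -> is_lipschitz (fn_act v)
}.

Definition fn_is_src (m k : nat) (F : fnn m k) (v : 'I_(fn_N F)) : bool :=
  [forall u, ~~ fn_E F u v].

(* value of every node; correct after fn_N iterations because of the
   topological numbering *)
Definition fn_vals (m k : nat) (F : fnn m k) (x : 'I_m -> R) : 'I_(fn_N F) -> R :=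
  iter (fn_N F)
    (fun (val : 'I_(fn_N F) -> R) (v : 'I_(fn_N F)) =>
       match [pick i | fn_in F i == v] with
       | Some i => x i
       | None => fn_act F v (fn_b F v + \sum_(u | fn_E F u v) fn_w F u v * val u)
       end)
    (fun _ => 0).

Definition fn_eval (m k : nat) (F : fnn m k) (x : 'I_m -> R) : 'I_k -> R :=
  fun j => fn_vals F x (fn_out F j).

Definition fn_depth (m k : nat) (F : fnn m k) : nat := dag_depth (fn_E F).

Definition fn_nedges (m k : nat) (F : fnn m k) : nat :=
  #|[set e : 'I_(fn_N F) * 'I_(fn_N F) | fn_E F e.1 e.2]|.

(* weight: |V| + |E| + max_e |w_e| + max_v |b_v| + max_v (lambda(a_v) + |a_v(0)|),
   the maxima over the non-input nodes (which carry bias and activation). *)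
Definition fn_weight (m k : nat) (F : fnn m k) : R :=
  (fn_N F + fn_nedges F)%:R
  + \big[Num.max/0]_(e : 'I_(fn_N F) * 'I_(fn_N F) | fn_E F e.1 e.2) `|fn_w F e.1 e.2|
  + \big[Num.max/0]_(v | ~~ fn_is_src F v) `|fn_b F v|
  + \big[Num.max/0]_(v | ~~ fn_is_src F v) ((lipn (fn_act F v))%:R + `|fn_act F v 0|).

Definition fn_acts (m k : nat) (F : fnn m k) : seq (R -> R) :=
  [seq fn_act F v | v <- enum 'I_(fn_N F) & ~~ fn_is_src F v].

End FNN.
Arguments fn_eval {R m k}.
Arguments fn_depth {R m k}.
Arguments fn_weight {R m k}.
Arguments fn_acts {R m k}.

Inductive aggk := ASum | AMean | AMax.

Section GNN.
Variable R : realType.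

Definition aggregate (a : aggk) (q : nat) (s : seq ('I_q -> R)) : 'I_q -> R :=
  fun i =>
    match a with
    | ASum => \sum_(y <- s) y i
    | AMean => if s is [::] then 0 else (\sum_(y <- s) y i) / (size s)%:R
    | AMax => if s is y0 :: s' then \big[Num.max/y0 i]_(y <- s') y i else 0
    end.

Record layer (pi po : nat) := Layer {
  l_q : nat;
  l_msg : fnn R (pi + pi) l_q;
  l_comb : fnn R (pi + l_q + pi) po;
  l_agg : aggk;
  l_agg' : aggk
}.

Inductive gnn : nat -> nat -> Type :=
| GNil p : gnn p p
| GCons p q r : layer p q -> gnn q r -> gnn p r.

Definition layer_eval (pi po : nat) (L : layer pi po) (n : nat) (adj : rel 'I_n)
    (x : 'I_n -> 'I_pi -> R) : 'I_n -> 'I_po -> R :=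
  fun v =>
    fn_eval (l_comb L)
      (vcat (vcat (x v)
                  (aggregate (l_agg L)
                     [seq fn_eval (l_msg L) (vcat (x v) (x w)) | w <- enum 'I_n & adj v w]))
            (aggregate (l_agg' L) [seq x w | w <- enum 'I_n])).

Fixpoint gnn_eval (p r : nat) (N : gnn p r) (n : nat) (adj : rel 'I_n) :
    ('I_n -> 'I_p -> R) -> 'I_n -> 'I_r -> R :=
  match N in gnn p r return ('I_n -> 'I_p -> R) -> 'I_n -> 'I_r -> R with
  | GNil _ => fun x => x
  | GCons _ _ _ L N' => fun x => gnn_eval N' adj (layer_eval L adj x)
  end.

Fixpoint gnn_nlayers (p r : nat) (N : gnn p r) : nat :=
  match N with GNil _ => 0%N | GCons _ _ _ _ N' => (gnn_nlayers N').+1 end.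

Fixpoint gnn_maxdepth (p r : nat) (N : gnn p r) : nat :=
  match N with
  | GNil _ => 0%N
  | GCons _ _ _ L N' =>
      maxn (maxn (fn_depth (l_msg L)) (fn_depth (l_comb L))) (gnn_maxdepth N')
  end.

Definition gnn_depth (p r : nat) (N : gnn p r) : nat :=
  (gnn_nlayers N * gnn_maxdepth N)%N.

Fixpoint gnn_weight (p r : nat) (N : gnn p r) : R :=
  match N with
  | GNil _ => 0
  | GCons _ _ _ L N' => fn_weight (l_msg L) + fn_weight (l_comb L) + gnn_weight N'
  end.

Fixpoint gnn_acts (p r : nat) (N : gnn p r) : seq (R -> R) :=
  match N with
  | GNil _ => [::]
  | GCons _ _ _ L N' => fn_acts (l_msg L) ++ fn_acts (l_comb L) ++ gnn_acts N'
  end.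

End GNN.
Arguments gnn_eval {R p r} N {n}.
Arguments gnn_depth {R p r}.
Arguments gnn_weight {R p r}.
Arguments gnn_acts {R p r}.

(* Uniform probability on [0,1]^T (T finite), as iterated Lebesgue     *)
(* integrals over [0,1] of the indicator of the event                  *)
Section Prob.
Variable R : realType.
Variable T : finType.

Fixpoint iprob (s : seq T) (A : (T -> R) -> Prop) : \bar R :=
  match s with
  | [::] => (if `[< A (fun _ => 0) >] then 1 else 0)%:E
  | t :: s' =>
      (\int[@lebesgue_measure R]_(x in `[0%R, 1%R]%classic)
          iprob s' (fun g => A (fun u => if u == t then x else g u)))%E
  end.

Definition unif_prob (A : (T -> R) -> Prop) : \bar R := iprob (enum T) A.
End Prob.
Arguments unif_prob {R T}.

Section RandomInit.
Variable R : realType.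

Definition ri_out (p r n : nat) (N : gnn R (p + r) 1) (G : lgraph p n)
    (rho : 'I_n * 'I_r -> R) (v : 'I_n) : R :=
  gnn_eval N (gadj G)
    (fun w => vcat (fun j => ((glab G w j : nat)%:R : R)) (fun k => rho (w, k)))
    v ord0.

Definition ri_computes (p : nat) (rd : nat -> nat) (N : forall n, gnn R (p + rd n) 1)
    (Q : query p) :=
  forall n (G : lgraph p n) (v : 'I_n),
    (Q n G v ->
       ((3 / 4)%:E <= unif_prob (fun rho => (3 / 4 <= @ri_out p (rd n) n (N n) G rho v)%R))%E) /\
    (~~ Q n G v ->
       ((3 / 4)%:E <= unif_prob (fun rho => (@ri_out p (rd n) n (N n) G rho v <= 1 / 4)%R))%E).

Definition poly_weight (p : nat) (rd : nat -> nat) (N : forall n, gnn R (p + rd n) 1) :=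
  exists P : {poly R}, forall n, gnn_weight (N n) <= P.[n%:R].

Definition bounded_depth (p : nat) (rd : nat -> nat) (N : forall n, gnn R (p + rd n) 1) :=
  exists d : nat, forall n, (gnn_depth (N n) <= d)%N.

Definition dyadic := (int * nat)%type.
Definition dval (d : dyadic) : R := (d.1)%:~R / 2%:R ^+ d.2.
Definition dbits (d : dyadic) : nat :=
  ((trunc_log 2 `|d.1|%N).+1 + 1 + (trunc_log 2 d.2).+1)%N.

Record plin := PLin { pl_th : seq dyadic; pl_sl : seq dyadic; pl_co : seq dyadic }.

Definition plin_wf (g : plin) : Prop :=
  sorted (fun a b => dval a < dval b) (pl_th g) /\
  size (pl_sl g) = (size (pl_th g)).+1 /\ size (pl_co g) = (size (pl_th g)).+1.

Definition plin_eval (g : plin) (x : R) : R :=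
  let i := count (fun t => dval t <= x) (pl_th g) in
  dval (nth (0%Z, 0%N) (pl_sl g) i) * x + dval (nth (0%Z, 0%N) (pl_co g) i).

Definition plin_bits (g : plin) : nat :=
  (sumn (map dbits (pl_th g)) + sumn (map dbits (pl_sl g)) + sumn (map dbits (pl_co g)))%N.

Definition eps_approx (eps : R) (f g : R -> R) :=
  forall x, `|f x - g x| <= eps * `|f x| + eps.

Definition peval2 (P : {poly {poly R}}) (x y : R) : R := (P.[y%:P]).[x].

Definition rpl_approximable (p : nat) (rd : nat -> nat) (N : forall n, gnn R (p + rd n) 1) :=
  exists P : {poly {poly R}}, forall (n : nat) (eps : R), 0 < eps ->
    forall f, f \in gnn_acts (N n) ->
      exists g : plin, plin_wf g /\ eps_approx eps f (plin_eval g) /\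
        (plin_bits g)%:R <= peval2 P eps^-1 n%:R.

Definition gnn_ri_computable (p : nat) (Q : query p) :=
  exists (rd : nat -> nat) (N : forall n, gnn R (p + rd n) 1),
    @poly_weight p rd N /\ @bounded_depth p rd N /\ @rpl_approximable p rd N /\
    @ri_computes p rd N Q.

End RandomInit.

Inductive gkind := GIn of nat | GNot | GAnd | GOr | GThr of nat.

Record circuit (N : nat) := Circuit {
  c_size : nat;
  c_kind : 'I_c_size -> gkind;
  c_ch : 'I_c_size -> seq 'I_c_size;
  c_out : 'I_c_size;
  c_topo : forall g : 'I_c_size, all (fun h : 'I_c_size => (h < g)%N) (c_ch g);
  c_inp : forall (g : 'I_c_size) j, c_kind g = GIn j -> (j < N)%N /\ c_ch g = [::];
  c_not : forall g : 'I_c_size, c_kind g = GNot -> size (c_ch g) = 1%N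
}.

Definition c_eval (N : nat) (C : circuit N) (w : seq bool) : bool :=
  let val := iter (c_size C)
    (fun (f : 'I_(c_size C) -> bool) (g : 'I_(c_size C)) =>
       let ins := [seq f h | h <- c_ch C g] in
       match c_kind C g with
       | GIn j => nth false w j
       | GNot => ~~ nth false ins 0
       | GAnd => all id ins
       | GOr => has id ins
       | GThr k => (k <= count id ins)%N
       end) (fun _ => false) in
  val (c_out C).

Definition c_wsize (N : nat) (C : circuit N) : nat :=
  (c_size C + \sum_(g : 'I_(c_size C)) size (c_ch C g))%N.

Definition c_depth (N : nat) (C : circuit N) : nat :=
  dag_depth (fun h g : 'I_(c_size C) => h \in c_ch C g).

(* binary representation, most significant bit first; bin 0 = "0" *)
Fixpoint bin_aux (fuel i : nat) : seq bool :=
  match fuel with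
  | 0%N => [::]
  | fuel'.+1 => if i == 0%N then [::] else rcons (bin_aux fuel' i./2) (odd i)
  end.
Definition bin (i : nat) : seq bool := if i == 0%N then [:: false] else bin_aux i i.

(* binary encoding of the alphabet {0,1,#} *)
Definition enc_bit (b : bool) : seq bool := if b then [:: false; true] else [:: false; false].
Definition enc_hash : seq bool := [:: true; true].

(* s(G,b,<=) # bin(i), where the linear order is given by the
   enumeration sigma (<i> = sigma i): the adjacency matrix row by row
   followed by the labels vertex by vertex, in the order *)
Definition encode (p n : nat) (G : lgraph p n) (sigma : {perm 'I_n}) (i : 'I_n) : seq bool :=
  flatten [seq enc_bit (gadj G (sigma a) (sigma c)) | a <- enum 'I_n, c <- enum 'I_n]
  ++ flatten [seq enc_bit (glab G (sigma a) j) | a <- enum 'I_n, j <- enum 'I_p]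
  ++ enc_hash ++ flatten (map enc_bit (bin i)).

Definition L_le (p : nat) (Q : query p) (w : seq bool) : Prop :=
  exists n (G : lgraph p n) (sigma : {perm 'I_n}) (i : 'I_n),
    w = encode G sigma i /\ Q n G (sigma i).

Definition in_TC0 (p : nat) (Q : query p) : Prop :=
  exists C : forall N, circuit N,
    (exists P : {poly int}, forall N, ((c_wsize (C N))%:Z <= P.[N%:Z])%R) /\
    (exists d : nat, forall N, (c_depth (C N) <= d)%N) /\
    (forall w : seq bool, c_eval (C (size w)) w <-> L_le Q w).

(* Main.v *)
(** From networks to circuits: with bounded depth and polynomial weight, all values
    occurring in a run of the network are polynomially bounded, and they depend on
    each other through functions with polynomial Lipschitz constants.  Rounding every
    value to a grid of inverse polynomial mesh therefore changes the output by at most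
    1/8.  The rounded values are integers of polynomial size, which constant-depth
    threshold circuits handle in unary: sums are threshold gates and Lipschitz
    functions are table look-ups.  The random numbers are hard-wired: polynomially
    many samples can be chosen greedily such that, on every input of a given length,
    the majority of the runs answers correctly.

    From circuits to networks: every vertex hashes its random number to one of 16 n^2
    buckets.  With probability at least 3/4 no two vertices collide and no number lies
    close to a bucket boundary; then clamped linear functions compute the bucket
    indices exactly, global sums turn them into ranks, and two more layers make the
    ordered adjacency and label matrices available at every vertex.  A threshold gate
    is a clamped affine function of its Boolean inputs, so each further layer simulates
    one level of the circuits. *)

Require Import Defs.
From mathcomp Require Import all_boot all_order all_algebra all_fingroup.
From mathcomp Require Import all_classical all_reals all_analysis.
From mathcomp Require Import zify ring lra.

Set Implicit Arguments.
Unset Strict Implicit.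
Unset Printing Implicit Defensive.

Import Order.TTheory GRing.Theory Num.Theory.
Local Open Scope ring_scope.

(** * Polynomial bounds and iteration along a topological order *)

(** Bounded depth keeps every bound polynomial: each evaluation step multiplies magnitudes and
    errors by a polynomial factor, and constantly many such factors are still polynomial. In the
    first direction non-uniformity enters twice: the activations appear in a circuit only as tables
    of rounded values at grid points, and the random samples are fixed for each input length. A
    circuit must also reject words that encode nothing; it therefore decodes a graph from an
    arbitrary word and compares the code of that graph with the word. In the other direction the
    obstacle is continuity: a network cannot discretise a random number without a zone of
    intermediate values around each bucket boundary. Outside these zones all later states are
    exactly 0 or 1, so no error propagates and the randomness is the only source of failure. The
    order obtained is random, but the invariance of the query makes the answer independent of it.
    Since the length of the code word varies with the position of the vertex, every vertex runs one
    circuit per candidate position and selects the right output at the end. *)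

(** The base is at least 2 even for [n = 0], so powers are monotone in the exponent and absorb
    constants. *)
Definition polyb (f : nat -> nat) : Prop :=
  exists c : nat, forall n, (f n <= n.+2 ^ c)%N.

Lemma polyb_le (f g : nat -> nat) :
  (forall n, (f n <= g n)%N) -> polyb g -> polyb f.
Proof. by move=> fg [c gc]; exists c => n; exact: leq_trans (fg n) (gc n). Qed.

Lemma leq_expS2 (n a b : nat) : (a <= b)%N -> (n.+2 ^ a <= n.+2 ^ b)%N.
Proof. by move=> ab; rewrite leq_exp2l. Qed.

Lemma polyb_cst (k : nat) : polyb (fun=> k).
Proof.
exists k => n; apply: leq_trans (ltnW (ltn_expl k (isT : 1 < 2)%N)) _.
by case: k => // k; rewrite leq_exp2r.
Qed.

Lemma polyb_id : polyb id.
Proof. by exists 1%N => n; rewrite expn1; lia. Qed.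

Lemma polybM (f g : nat -> nat) :
  polyb f -> polyb g -> polyb (fun n => f n * g n)%N.
Proof.
by move=> [c fc] [e ge]; exists (c + e)%N => n; rewrite expnD leq_mul.
Qed.

Lemma polybD (f g : nat -> nat) :
  polyb f -> polyb g -> polyb (fun n => f n + g n)%N.
Proof.
move=> [c fc] [e ge]; exists (maxn c e).+1 => n; rewrite expnS.
have := leq_trans (fc n) (leq_expS2 n (leq_maxl c e)).
have := leq_trans (ge n) (leq_expS2 n (leq_maxr c e)).
by nia.
Qed.

Lemma polybX (f : nat -> nat) (k : nat) :
  polyb f -> polyb (fun n => f n ^ k)%N.
Proof.
move=> pf; elim: k => [|k IH]; first exact: (polyb_cst 1).
by apply: polyb_le (polybM pf IH) => n; rewrite expnS.
Qed.

Lemma polyb_horner (R : realType) (P : {poly R}) :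
  exists2 f, polyb f & forall n, P.[n%:R] <= (f n)%:R.
Proof.
elim/poly_ind: P => [|P c [f pf Pf]].
  by exists (fun=> 0%N); [exact: polyb_cst|move=> n; rewrite horner0].
exists (fun n => f n * n + (Num.truncn `|c|).+1)%N.
  by apply: polybD (polyb_cst _); apply: polybM => //; exact: polyb_id.
move=> n; rewrite hornerMXaddC natrD natrM lerD ?ler_wpM2r //.
by apply: le_trans (ler_norm _) _; apply/ltW; exact: truncnS_gt.
Qed.

Lemma polyb_natpoly (R : realType) (f : nat -> nat) :
  polyb f -> exists P : {poly R}, forall n, (f n)%:R <= P.[n%:R].
Proof.
move=> [c fc]; exists (('X + 2%:P) ^+ c) => n.
by rewrite horner_exp hornerD hornerX hornerC -natrD -natrX ler_nat addn2.
Qed.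

Lemma polyb_intpoly (f : nat -> nat) :
  polyb f -> exists P : {poly int}, forall n, (f n)%:Z <= P.[n%:Z].
Proof.
move=> [c fc]; exists (('X + 2%:P) ^+ c) => n.
rewrite horner_exp hornerD hornerX hornerC.
by have := fc n; rewrite -addn2 -lez_nat -[X in _ <= X]natz natrX natz PoszD.
Qed.

Lemma intpoly_polyb (P : {poly int}) :
  exists2 f, polyb f & forall n, P.[n%:Z] <= (f n)%:Z.
Proof.
elim/poly_ind: P => [|P c [f pf Pf]].
  by exists (fun=> 0%N); [exact: polyb_cst|move=> n; rewrite horner0].
exists (fun n => f n * n + `|c|)%N.
  by apply: polybD (polyb_cst _); apply: polybM => //; exact: polyb_id.
by move=> n; rewrite hornerMXaddC; have := Pf n; nia.
Qed.

Section TopologicalIteration.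
Variables (N : nat) (A : Type) (E : rel 'I_N).
Variable F : ('I_N -> A) -> 'I_N -> A.
Hypothesis Etopo : forall u v, E u v -> (u < v)%N.
Hypothesis Floc : forall f g v, (forall u, E u v -> f u = g u) -> F f v = F g v.

(** All predecessors of [v] have smaller numbers, so its value is settled after [v + 1] rounds,
    whatever the starting assignment. *)
Lemma iter_topo_stable (f g : 'I_N -> A) (k l : nat) (v : 'I_N) :
  (v < k)%N -> (v < l)%N -> iter k F f v = iter l F g v.
Proof.
elim: k l v => // k IH [//|l] v vk vl /=.
by apply: Floc => u /Etopo uv; apply: IH; lia.
Qed.

Lemma iter_topo_fix (f : 'I_N -> A) (v : 'I_N) :
  iter N F f v = F (iter N F f) v.
Proof.
by rewrite -[RHS]/(iter N.+1 F f v); apply: iter_topo_stable; have := ltn_ord v; lia.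
Qed.

Lemma iter_topo_unique (f g : 'I_N -> A) (v : 'I_N) :
  (forall u, g u = F g u) -> iter N F f v = g v.
Proof.
move=> gE; have: (v < N)%N by [].
have {}gE k u : iter k F g u = g u.
  by elim: k u => //= k IH u; rewrite [RHS]gE; apply: Floc.
by rewrite -(gE N v); move=> ?; exact: iter_topo_stable.
Qed.

(** The number of rounds is governed by the rank instead of the number of nodes; this is what lets
    constantly many layers evaluate a circuit. *)
Lemma iter_topo_rank (f g : 'I_N -> A) (rk : 'I_N -> nat) (k : nat) (v : 'I_N) :
  (forall u v, E u v -> (rk u < rk v)%N) -> (forall u, g u = F g u) ->
  (rk v < k)%N -> iter k F f v = g v.
Proof.
move=> Erk gE; elim: k v => // k IH v vk; rewrite gE /=.
by apply: Floc => u /Erk uv; apply: IH; lia.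
Qed.

End TopologicalIteration.

Section DagDepth.
Variables (N : nat) (E : rel 'I_N).

Definition node_depth : 'I_N -> nat :=
  iter N (fun d (v : 'I_N) => \max_(u | E u v) (d u).+1) (fun _ => 0%N).

Lemma node_depthE : dag_depth E = \max_v node_depth v.
Proof. by []. Qed.

Lemma node_depth_le v : (node_depth v <= dag_depth E)%N.
Proof. exact: (leq_bigmax v). Qed.

Lemma node_depth_lt (Etopo : forall u v, E u v -> (u < v)%N) u v :
  E u v -> (node_depth u < node_depth v)%N.
Proof.
move=> uv; rewrite [node_depth v](iter_topo_fix Etopo) -/node_depth.
  exact: (@leq_bigmax_cond _ (E^~ v) (fun u => (node_depth u).+1)).
by move=> f g w fg; apply: eq_bigr => z zw; rewrite fg.
Qed.

Lemma dag_depth_le (rk : 'I_N -> nat) (d : nat) :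
  (forall u v, E u v -> (rk u < rk v)%N) -> (forall v, (rk v <= d)%N) ->
  (dag_depth E <= d)%N.
Proof.
move=> Erk rkd; rewrite node_depthE; apply/bigmax_leqP => v _.
apply: leq_trans (rkd v).
suff H k u : (iter k (fun d (v : 'I_N) => \max_(u | E u v) (d u).+1)
  (fun=> 0%N) u <= rk u)%N by exact: H.
elim: k u => // k IH u /=; apply/bigmax_leqP => z zu.
by apply: leq_ltn_trans (IH z) _; exact: Erk.
Qed.

End DagDepth.

(** * Threshold formulas and circuits *)

Definition gate_val (k : gkind) (w ins : seq bool) : bool :=
  match k with
  | GIn j => nth false w j
  | GNot => ~~ nth false ins 0
  | GAnd => all id ins
  | GOr => has id ins
  | GThr k => (k <= count id ins)%N
  end.

(** Gates range over any finite type and are ordered by a rank, so that combining circuits is a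
    disjoint union without renumbering; the rank also bounds the depth. *)
Record fcirc (N : nat) := FCirc {
  fc_T : finType;
  fc_kind : fc_T -> gkind;
  fc_ch : fc_T -> seq fc_T;
  fc_rk : fc_T -> nat;
  fc_out : fc_T;
  fc_topo : forall g h, h \in fc_ch g -> (fc_rk h < fc_rk g)%N;
  fc_inp : forall g j, fc_kind g = GIn j -> (j < N)%N /\ fc_ch g = [::];
  fc_not : forall g, fc_kind g = GNot -> size (fc_ch g) = 1%N }.
Arguments fc_kind {N} _ _.
Arguments fc_ch {N} _ _.
Arguments fc_rk {N} _ _.

Definition fc_computes (N s d c : nat) (C : fcirc N) (F : N.-tuple bool -> bool) :=
  [/\ forall g, (fc_rk C g <= d)%N,
      forall g, (size (fc_ch C g) <= s)%N,
      (#|fc_T C| <= c)%N &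
      forall w : N.-tuple bool, exists2 val : fc_T C -> bool,
        val (fc_out C) = F w &
        forall g, val g = gate_val (fc_kind C g) w [seq val h | h <- fc_ch C g]].

Section Numbering.
Variables (T : finType) (rk : T -> nat).

(** Numbering the gates by increasing rank yields the condition [h < g] on children that [circuit]
    demands. *)
Definition rk_seq : seq T := sort (fun x y => (rk x <= rk y)%N) (enum T).

Lemma mem_rk_seq x : x \in rk_seq.
Proof. by rewrite mem_sort mem_enum. Qed.

Lemma size_rk_seq : size rk_seq = #|T|.
Proof. by rewrite size_sort -cardE. Qed.

Lemma index_rk_seq x : (index x rk_seq < #|T|)%N.
Proof. by rewrite -size_rk_seq index_mem mem_rk_seq. Qed.

Definition rk_num (x : T) : 'I_#|T| := Ordinal (index_rk_seq x).

(** The default [enum_val i] only provides some element of [T]; the index is always in range. *)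
Definition rk_unnum (i : 'I_#|T|) : T := nth (enum_val i) rk_seq i.

Lemma rk_numK : cancel rk_num rk_unnum.
Proof. by move=> x; rewrite /rk_unnum nth_index ?mem_rk_seq. Qed.

Lemma rk_unnumK : cancel rk_unnum rk_num.
Proof.
move=> i; apply: val_inj; rewrite /= index_uniq ?size_rk_seq //.
by rewrite sort_uniq enum_uniq.
Qed.

Lemma rk_num_lt x y : (rk x < rk y)%N -> (rk_num x < rk_num y)%N.
Proof.
move=> xy; rewrite ltnNge; apply/negP => /= yx.
have tr : transitive (fun x y => (rk x <= rk y)%N).
  by move=> a b c; exact: leq_trans.
have so : sorted (fun x y => (rk x <= rk y)%N) rk_seq.
  by apply: sort_sorted => a b; exact: leq_total.
have := sorted_leq_index tr (fun=> leqnn _) so _ _ (mem_rk_seq y) (mem_rk_seq x) yx.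
by rewrite leqNgt xy.
Qed.

End Numbering.

Section FcircToCircuit.
Variables (N : nat) (C : fcirc N).
Let T := fc_T C.
Let num := rk_num (fc_rk C).
Let unnum : 'I_#|T| -> T := rk_unnum (fc_rk C).

Let kind (i : 'I_#|T|) := fc_kind C (unnum i).
Let ch (i : 'I_#|T|) := [seq num h | h <- fc_ch C (unnum i)].

Lemma circuit_of_fcirc_topo (g : 'I_#|T|) : all (fun h : 'I_#|T| => (h < g)%N) (ch g).
Proof.
apply/allP => _ /mapP[h /fc_topo hg ->].
by rewrite -[g](rk_unnumK (fc_rk C)); exact: rk_num_lt.
Qed.

Lemma circuit_of_fcirc_inp (g : 'I_#|T|) j : kind g = GIn j -> (j < N)%N /\ ch g = [::].
Proof. by move=> /fc_inp[? e]; rewrite /ch e. Qed.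

Lemma circuit_of_fcirc_not (g : 'I_#|T|) : kind g = GNot -> size (ch g) = 1%N.
Proof. by move=> /fc_not e; rewrite size_map. Qed.

Definition circuit_of_fcirc : circuit N :=
  @Circuit N #|T| kind ch (num (fc_out C)) circuit_of_fcirc_topo circuit_of_fcirc_inp
    circuit_of_fcirc_not.

Lemma c_eval_circuit_of_fcirc (w : seq bool) (val : T -> bool) :
  (forall g, val g = gate_val (fc_kind C g) w [seq val h | h <- fc_ch C g]) ->
  c_eval circuit_of_fcirc w = val (fc_out C).
Proof.
move=> valE; rewrite /c_eval /=.
rewrite (@iter_topo_unique _ _ (fun h g => h \in ch g) _ _ _ _ (val \o unnum)) /=.
- by rewrite /unnum /num rk_numK.
- by move=> u v; move/allP: (circuit_of_fcirc_topo v); apply.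
- move=> f g v fg; rewrite /= -/(gate_val _ _ _) -/(gate_val (kind v) w [seq g h | h <- ch v]).
  congr gate_val; apply/eq_in_map => h hv; exact: fg.
- move=> u; rewrite valE -/(gate_val (kind u) w [seq _ h | h <- ch u]).
  congr gate_val; rewrite /ch -map_comp; apply: eq_map => h /=.
  by rewrite /unnum /num rk_numK.
Qed.

Lemma c_depth_circuit_of_fcirc (d : nat) :
  (forall g, (fc_rk C g <= d)%N) -> (c_depth circuit_of_fcirc <= d)%N.
Proof.
move=> rkd; apply: (@dag_depth_le _ _ (fun g => fc_rk C (unnum g))) => // u v /=.
by move=> /mapP[h /fc_topo hv ->]; rewrite /unnum /num rk_numK.
Qed.

Lemma c_wsize_circuit_of_fcirc (s : nat) :
  (forall g, (size (fc_ch C g) <= s)%N) ->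
  (c_wsize circuit_of_fcirc <= #|T| * s.+1)%N.
Proof.
move=> chs; rewrite /c_wsize /= mulnS leq_add2l -[X in (_ <= X * _)%N]card_ord.
rewrite -sum_nat_const; apply: leq_sum => i _; rewrite size_map; exact: chs.
Qed.

End FcircToCircuit.

(* Threshold formulas: since the depth is bounded, unfolding a circuit into a
   tree keeps the size polynomial, so subcircuits are never shared. *)
Inductive tc (N s : nat) : nat -> (N.-tuple bool -> bool) -> Prop :=
| tc_in d (j : 'I_N) : tc s d (fun w => tnth w j)
| tc_not d F : tc s d F -> tc s d.+1 (fun w => ~~ F w)
| tc_thr d k m (F : 'I_m -> N.-tuple bool -> bool) :
    (m <= s)%N -> (forall i, tc s d (F i)) ->
    tc s d.+1 (fun w => (k <= \sum_(i < m) F i w)%N).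

Section FcircThr.
Variables (N k m : nat) (C : 'I_m -> fcirc N).
Let T := option {i : 'I_m & fc_T (C i)}.

Let inj i (h : fc_T (C i)) : T := Some (Tagged (fun i => fc_T (C i)) h).
Let ch (g : T) : seq T :=
  match g with
  | None => [seq inj (fc_out (C i)) | i <- enum 'I_m]
  | Some (existT i h) => map (@inj i) (fc_ch (C i) h)
  end.
Let kind (g : T) : gkind :=
  match g with None => GThr k | Some (existT i h) => fc_kind (C i) h end.
Let rk (g : T) : nat :=
  match g with
  | None => (\max_i fc_rk (C i) (fc_out (C i))).+1
  | Some (existT i h) => fc_rk (C i) h
  end.

Lemma fcirc_thr_topo g h : h \in ch g -> (rk h < rk g)%N.
Proof.
case: g => [[i g]|] /mapP[/= j hj ->] /=; first exact: fc_topo.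
by rewrite ltnS; exact: (leq_bigmax j).
Qed.

Lemma fcirc_thr_inp g j : kind g = GIn j -> (j < N)%N /\ ch g = [::].
Proof. by case: g => [[i g]|] //= /fc_inp[? ->]. Qed.

Lemma fcirc_thr_not g : kind g = GNot -> size (ch g) = 1%N.
Proof. by case: g => [[i g]|] //= /fc_not; rewrite size_map. Qed.

Definition fcirc_thr : fcirc N :=
  FCirc None fcirc_thr_topo fcirc_thr_inp fcirc_thr_not.

Lemma fcirc_thr_computes s d c (F : 'I_m -> N.-tuple bool -> bool) :
  (m <= s)%N -> (forall i, fc_computes s d c (C i) (F i)) ->
  fc_computes s d.+1 (s * c).+1 fcirc_thr (fun w => (k <= \sum_(i < m) F i w)%N).
Proof.
move=> ms H; split.
- case=> [[i g]|] /=; first by apply/ltnW; rewrite ltnS; case: (H i).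
  by rewrite ltnS; apply/bigmax_leqP => i _; case: (H i).
- case=> [[i g]|] /=; rewrite size_map; first by case: (H i).
  by rewrite -cardE card_ord.
- rewrite card_option ltnS card_tagged sumnE big_map big_enum /=.
  apply: leq_trans (_ : m * c <= _)%N; last by rewrite leq_mul2r ms orbT.
  rewrite -[X in (_ <= X * _)%N]card_ord -sum_nat_const.
  by apply: leq_sum => i _; case: (H i).
- move=> w.
  have ex : forall i, exists val : fc_T (C i) -> bool,
      val (fc_out (C i)) = F i w /\
      forall g, val g = gate_val (fc_kind (C i) g) w [seq val h | h <- fc_ch (C i) g].
    by move=> i; case: (H i) => _ _ _ /(_ w)[val v1 v2]; exists val.
  pose val i := sval (cid (ex i)).
  have valP i : val i (fc_out (C i)) = F i w /\
      forall g, val i g = gate_val (fc_kind (C i) g) w [seq val i h | h <- fc_ch (C i) g].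
    exact: svalP (cid (ex i)).
  pose v (g : T) := match g with
    | None => (k <= \sum_(i < m) F i w)%N | Some (existT i h) => val i h end.
  exists v => // -[[i g]|] /=.
    have [_ ->] := valP i; congr gate_val; rewrite -map_comp; exact: eq_map.
  rewrite -map_comp; congr (_ <= _)%N.
  rewrite -sum1_count big_map -big_enum /= [RHS]big_mkcond /=.
  apply: eq_bigr => i _; have [-> _] := valP i; by case: (F i w).
Qed.

End FcircThr.

(** One more level turns size [c] into at most [s * c + 1 <= (s + 1) * c]. *)
Lemma fcirc_of_tc (N s d : nat) (F : N.-tuple bool -> bool) :
  (0 < s)%N -> tc s d F -> exists C : fcirc N, fc_computes s d (s.+1 ^ d) C F.
Proof.
move=> s0; elim=> {d F} [d j|d F _ [C HC]|d k m F ms _ IH].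
- exists (@FCirc N unit (fun=> GIn j) (fun=> [::]) (fun=> 0%N) tt
    (fun _ _ => ltac:(done)) (fun _ _ => ltac:(by case=> <-))
    (fun _ => ltac:(done))).
  split=> //=; first by rewrite card_unit expn_gt0.
  by move=> w; exists (fun=> tnth w j) => // _; rewrite (tnth_nth false).
- have topo : forall g h : option (fc_T C),
      h \in (if g is Some g then map Some (fc_ch C g) else [:: Some (fc_out C)]) ->
      ((if h is Some h then fc_rk C h else (fc_rk C (fc_out C)).+1) <
       (if g is Some g then fc_rk C g else (fc_rk C (fc_out C)).+1))%N.
    move=> [g|] h; first by case/mapP => j /fc_topo hj ->.
    by rewrite inE => /eqP ->.
  have inp : forall (g : option (fc_T C)) j,
      (if g is Some g then fc_kind C g else GNot) = GIn j -> (j < N)%N /\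
      (if g is Some g then map Some (fc_ch C g) else [:: Some (fc_out C)]) =
        [::] :> seq (option (fc_T C)).
    by move=> [g|] // j /fc_inp[? ->].
  have nt : forall (g : option (fc_T C)),
      (if g is Some g then fc_kind C g else GNot) = GNot ->
      size (if g is Some g then map Some (fc_ch C g) else [:: Some (fc_out C)]) = 1%N.
    by move=> [g|] // /fc_not; rewrite size_map.
  exists (@FCirc N (option (fc_T C)) _ _ _ None topo inp nt).
  case: HC => c1 c2 c3 c4; split=> [[g|]|[g|]||w] //=.
  + by apply/ltnW; rewrite ltnS.
  + by rewrite ltnS.
  + by rewrite size_map.
  + rewrite card_option expnS (leq_trans (_ : _ <= (s.+1 ^ d).+1)%N) ?ltnS//.
    by have := expn_gt0 s.+1 d; nia.
  + have [val v1 v2] := c4 w.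
    exists (fun g => if g is Some g then val g else ~~ F w) => // -[g|] /=.
      by rewrite v2 -map_comp.
    by rewrite v1.
- have ex : forall i, exists C : fcirc N, fc_computes s d (s.+1 ^ d) C (F i) by [].
  pose C i := sval (cid (ex i)).
  have CP i : fc_computes s d (s.+1 ^ d) (C i) (F i) := svalP (cid (ex i)).
  exists (fcirc_thr k C).
  have [c1 c2 c3 c4] := fcirc_thr_computes k ms CP; split=> //.
  by apply: leq_trans c3 _; have := expn_gt0 s.+1 d; rewrite expnS; nia.
Qed.

Lemma circuit_of_tc (N s d : nat) (F : N.-tuple bool -> bool) :
  (0 < s)%N -> tc s d F ->
  exists C : circuit N, [/\ (c_wsize C <= s.+1 ^ d.+1)%N, (c_depth C <= d)%N &
    forall w : N.-tuple bool, c_eval C w = F w].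
Proof.
move=> s0 /(fcirc_of_tc s0)[C [c1 c2 c3 c4]]; exists (circuit_of_fcirc C); split.
- by apply: leq_trans (c_wsize_circuit_of_fcirc c2) _; rewrite expnSr leq_mul2r c3 orbT.
- exact: c_depth_circuit_of_fcirc.
- by move=> w; have [val <- v2] := c4 w; rewrite (c_eval_circuit_of_fcirc v2).
Qed.

Section TcClosure.
Variables (N s : nat).
Local Notation W := (N.-tuple bool).

Lemma tc_ext d (F G : W -> bool) : F =1 G -> tc s d F -> tc s d G.
Proof. by move=> /funext ->. Qed.

Lemma tc_leq d e (F : W -> bool) : (d <= e)%N -> tc s d F -> tc s e F.
Proof.
move=> + h; elim: h e => {d F} [d j|d F _ IH|d k m F ms _ IH] [|e] // de;
  try exact: tc_in.
- exact/tc_not/IH.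
- by apply: tc_thr => // i; exact: IH.
Qed.

Lemma tc_cst d (b : bool) : tc s d.+1 (fun _ : W => b).
Proof.
(* Comparing the empty sum with 0 or 1 produces the two constants. *)
apply: (@tc_ext _ (fun w => ((~~ b : nat) <= \sum_(i < 0) (fun=> false) w)%N)).
  by move=> w; rewrite big_ord0; case: b.
by apply: (@tc_thr N s d (~~ b : nat) 0 (fun _ _ => false)) => // -[].
Qed.

Lemma tc_nth d (j : nat) : tc s d.+1 (fun w : W => nth false w j).
Proof.
have [jN|Nj] := ltnP j N.
  apply: tc_ext (tc_in s d.+1 (Ordinal jN)) => w; exact: tnth_nth.
by apply: tc_ext (tc_cst d false) => w; rewrite nth_default ?size_tuple.
Qed.

Lemma tc_count d k (I : finType) (F : I -> W -> bool) :
  (#|I| <= s)%N -> (forall i, tc s d (F i)) ->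
  tc s d.+1 (fun w => (k <= \sum_i F i w)%N).
Proof.
move=> Is HF; apply: tc_ext (tc_thr k Is (fun i => HF (enum_val i))) => w /=.
by congr (_ <= _)%N; rewrite -(big_enum_val (fun i => F i w : nat)); apply: eq_bigl.
Qed.

Lemma tc_exists d (I : finType) (F : I -> W -> bool) :
  (#|I| <= s)%N -> (forall i, tc s d (F i)) ->
  tc s d.+1 (fun w => [exists i, F i w]).
Proof.
move=> Is HF; apply: tc_ext (tc_count 1 Is HF) => w; rewrite lt0n sum_nat_eq0.
by rewrite negb_forall; apply: eq_existsb => i; case: (F i w).
Qed.

Lemma tc_forall d (I : finType) (F : I -> W -> bool) :
  (#|I| <= s)%N -> (forall i, tc s d (F i)) ->
  tc s d.+1 (fun w => [forall i, F i w]).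
Proof.
move=> Is HF; apply: tc_ext (tc_count #|I| Is HF) => w.
rewrite -sum1_card leqNgt -[RHS]negbK negb_forall; congr (~~ _).
apply/idP/existsP => [h|[i Fi]].
  apply/existsP; apply: contraTT h => /existsPn h; rewrite -leqNgt.
  by apply: leq_sum => i _; have := h i; rewrite negbK => ->.
rewrite (bigD1 i) //= [X in (_ < X)%N](bigD1 i) //= (negbTE Fi) add0n add1n ltnS.
by apply: leq_sum => j _; case: (F j w).
Qed.

Lemma tc_and d (F G : W -> bool) : (1 < s)%N ->
  tc s d F -> tc s d G -> tc s d.+1 (fun w => F w && G w).
Proof.
move=> s1 HF HG.
have := @tc_count d 2 bool (fun b => if b then F else G); rewrite card_bool => /(_ s1)h.
apply: tc_ext (h _); last by case.
by move=> w; rewrite big_bool /=; case: (F w); case: (G w).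
Qed.

Lemma tc_or d (F G : W -> bool) : (1 < s)%N ->
  tc s d F -> tc s d G -> tc s d.+1 (fun w => F w || G w).
Proof.
move=> s1 HF HG.
have := @tc_count d 1 bool (fun b => if b then F else G); rewrite card_bool => /(_ s1)h.
apply: tc_ext (h _); last by case.
by move=> w; rewrite big_bool /=; case: (F w); case: (G w).
Qed.

End TcClosure.

(** * Approximating real functions by threshold formulas *)

(* Polynomially bounded naturals are kept in unary, as the family of bits [k <= V]:
   a single threshold gate then adds polynomially many of them, and any function of
   one of them is a table look-up. *)
Section Unary.
Variables (N s : nat).
Local Notation W := (N.-tuple bool).

Definition num (d M : nat) (V : W -> nat) :=
  (forall w, (V w <= M)%N) /\ forall k, tc s d (fun w => (k <= V w)%N).

Lemma num_leq d e M (V : W -> nat) : (d <= e)%N -> num d M V -> num e M V.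
Proof. by move=> de [h1 h2]; split=> // k; exact: tc_leq de _. Qed.

Lemma num_cst d M k : (k <= M)%N -> num d.+1 M (fun=> k).
Proof. by move=> kM; split=> // l; exact: tc_cst. Qed.

Lemma tc_num_eq d M (V : W -> nat) a : (1 < s)%N ->
  num d M V -> tc s d.+2 (fun w => V w == a).
Proof.
move=> s1 [_ h].
apply: tc_ext (tc_and s1 (tc_leq (leqnSn d) (h a)) (tc_not (h a.+1))) => w.
by rewrite -leqNgt eqn_leq andbC.
Qed.

(** The bit [k <= g V] is a disjunction over the possible values [a] of [V]; whether [k <= g a] does
    not depend on the input and is hard-wired. *)
Lemma num_table d M1 M2 (g : nat -> nat) (V : W -> nat) : (1 < s)%N -> (M1 < s)%N ->
  (forall a, (g a <= M2)%N) -> num d M1 V -> num d.+3 M2 (fun w => g (V w)).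
Proof.
move=> s1 Ms gM HV; split=> // k.
have := @tc_exists N s d.+2 'I_M1.+1 (fun a w => (k <= g a)%N && (V w == a)).
rewrite card_ord => /(_ Ms) h; apply: tc_ext (h _) => [w|a].
  apply/existsP/idP => [[a /andP[ka /eqP ->]]//|kV].
  have VM : (V w < M1.+1)%N by rewrite ltnS; case: HV.
  by exists (Ordinal VM); rewrite kV /=.
case: (k <= g a)%N; last exact: tc_cst.
exact: tc_num_eq HV.
Qed.

(** The sum is the number of pairs [(i, j)] with [j < V i], that is, the number of true unary
    bits. *)
Lemma num_sum d M (I : finType) (V : I -> W -> nat) : (#|I| * M <= s)%N ->
  (forall i, num d M (V i)) -> num d.+1 (#|I| * M) (fun w => \sum_i V i w)%N.
Proof.
move=> Is HV; split=> [w|k].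
  by rewrite -sum_nat_const leq_sum // => i _; case: (HV i).
have := @tc_count N s d k (I * 'I_M)%type (fun a w => (a.2 < V a.1 w)%N).
rewrite card_prod card_ord => /(_ Is) h; apply: tc_ext (h _) => [w|a]; last first.
  by case: (HV a.1) => _; apply.
congr (_ <= _)%N; rewrite -(pair_bigA _ (fun i j => ((j : 'I_M) < V i w)%N : nat)) /=.
apply: eq_bigr => i _; have [/(_ w) VM _] := HV i.
rewrite -(big_mkord (fun=> true) (fun j => (j < V i w)%N : nat)).
rewrite (big_cat_nat (leq0n (V i w)) VM) /= [X in (_ + X)%N]big_nat_cond.
rewrite [X in (_ + X)%N]big1 ?addn0 => [|j]; last first.
  by rewrite andbT => /andP[Vj _]; rewrite ltnNge Vj.
rewrite big_nat_cond (eq_bigr (fun=> 1%N)) => [|j]; last by rewrite andbT => /andP[_ ->].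
by rewrite -big_nat_cond sum_nat_const_nat subn0 muln1.
Qed.

Lemma num_max d M (I : finType) (b : I -> W -> bool) (V : I -> W -> nat) :
  (1 < s)%N -> (#|I| <= s)%N ->
  (forall i, tc s d (b i)) -> (forall i, num d M (V i)) ->
  num d.+2 M (fun w => \max_(i | b i w) V i w)%N.
Proof.
move=> s1 Is Hb HV; split=> [w|[|k]].
- by apply/bigmax_leqP => i _; case: (HV i).
- exact: tc_cst.
- have h := @tc_exists N s d.+1 I (fun i w => b i w && (k < V i w)%N) Is.
  apply: tc_ext (h _) => [w|i]; last by apply: tc_and => //; case: (HV i).
  apply/existsP/idP => [[i /andP[bi kV]]|]; first exact: (leq_trans kV (leq_bigmax_cond i bi)).
  move=> h0; apply/existsP; apply: contraTT h0 => /existsPn h0.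
  rewrite -leqNgt; apply/bigmax_leqP => i bi; have := h0 i.
  by rewrite bi /= -leqNgt.
Qed.

End Unary.

Section Approximation.
Variables (R : realType) (N s C D : nat).
Hypothesis s1 : (1 < s)%N.
Hypothesis D0 : (0 < D)%N.
Local Notation W := (N.-tuple bool).
Local Notation M := (2 * C * D)%N.

(* Reals in [-C, C] are rounded to the grid of mesh 1/D; V encodes V/D - C. *)
Definition grid_val (V : nat) : R := V%:R / D%:R - C%:R.
Definition grid_enc (z : R) : nat := minn M (Num.truncn ((z + C%:R) * D%:R)).

(** Clipping is harmless: if [z] leaves the interval from [-C] to [C], the nearer endpoint lies
    between [z] and [y]. Inside the interval, truncation costs at most one mesh width. *)
Lemma grid_encP (z y eta : R) : `|y| <= C%:R -> `|z - y| <= eta ->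
  `|y - grid_val (grid_enc z)| <= eta + D%:R^-1.
Proof.
move=> yC zy; have DR : 0 < D%:R :> R by rewrite ltr0n.
have DV : 0 < D%:R^-1 :> R by rewrite invr_gt0.
rewrite /grid_val /grid_enc; set u := (z + C%:R) * D%:R.
have zE : z = u / D%:R - C%:R by rewrite /u mulfK ?gt_eqF //; ring.
move: yC zy; rewrite !ler_norml => /andP[y1 y2] /andP[z1 z2].
have [u0|u0] := ltP u 0.
  rewrite (truncn0Pn _ _) ?minn0 ?mul0r; last by rewrite -ltNge (lt_trans u0).
  have uD : u / D%:R < 0 by rewrite pmulr_llt0.
  have : z <= - C%:R by lra.
  by move=> ?; apply/andP; split; lra.
have /andP[t1 t2] := truncn_itv u0.
have [tM|Mt] := ltnP M (Num.truncn u).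
  have MD : (M%:R / D%:R : R) = 2 * C%:R by rewrite natrM mulfK ?gt_eqF// natrM.
  rewrite MD.
  have : C%:R <= z.
    rewrite zE; have : M%:R / D%:R <= u / D%:R.
      by rewrite ler_pM2r// (le_trans _ t1)// ler_nat ltnW.
    by rewrite MD; lra.
  by move=> ?; apply/andP; split; lra.
have : (Num.truncn u)%:R / D%:R <= u / D%:R by rewrite ler_pM2r.
have : u / D%:R <= (Num.truncn u)%:R / D%:R + D%:R^-1.
  by rewrite -[X in _ + X]mul1r -mulrDl ler_pM2r// natr1 ltW.
move=> ? ?; apply/andP; split; lra.
Qed.

Lemma grid_enc_le z : (grid_enc z <= M)%N.
Proof. exact: geq_minl. Qed.

Lemma grid_val_le V1 V2 : (V1 <= V2)%N -> grid_val V1 <= grid_val V2.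
Proof. by move=> V12; rewrite /grid_val lerD2r ler_wpM2r ?invr_ge0 ?ler_nat. Qed.

Definition appr (d : nat) (eta : R) (F : W -> R) :=
  exists2 V, num s d M V & forall w, `|F w - grid_val (V w)| <= eta.

Lemma appr_leq d e eta eps (F : W -> R) : (d <= e)%N -> eta <= eps ->
  appr d eta F -> appr e eps F.
Proof.
move=> de ee [V HV VF]; exists V; first exact: num_leq de HV.
by move=> w; apply: le_trans ee.
Qed.

Lemma appr_ext d eta (F G : W -> R) : F =1 G -> appr d eta F -> appr d eta G.
Proof. by move=> /funext ->. Qed.

Lemma appr_cst d (z : R) : `|z| <= C%:R -> appr d.+1 D%:R^-1 (fun=> z).
Proof.
move=> zC; exists (fun=> grid_enc z); first exact/num_cst/grid_enc_le.
move=> _; rewrite -[leRHS]add0r; apply: grid_encP => //.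
by rewrite subrr normr0.
Qed.

(** The table contains [f] at grid points only; the Lipschitz constant accounts for the error of the
    argument, and rounding the result adds [1/D]. *)
Lemma appr_lip d eta (L : R) (f : R -> R) (F : W -> R) : (M < s)%N ->
  @lipschitz_with R L f -> (forall w, `|f (F w)| <= C%:R) -> 0 <= L ->
  appr d eta F -> appr d.+3 (L * eta + D%:R^-1) (fun w => f (F w)).
Proof.
move=> Ms fL fC L0 [V HV VF]; exists (fun w => grid_enc (f (grid_val (V w)))).
  by apply: (num_table (g := fun a => grid_enc (f (grid_val a)))) HV => // a; exact: grid_enc_le.
move=> w; apply: grid_encP => //; apply: le_trans (fL _ _) _.
by rewrite ler_wpM2l// distrC.
Qed.

Lemma appr_sum d eta (I : finType) (F : I -> W -> R) : (#|I| * M < s)%N ->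
  (forall w, `|\sum_i F i w| <= C%:R) -> (forall i, appr d eta (F i)) ->
  appr d.+4 (#|I|%:R * eta + D%:R^-1) (fun w => \sum_i F i w).
Proof.
move=> Is FC HF.
have ex : forall i, exists V, num s d M V /\ forall w, `|F i w - grid_val (V w)| <= eta.
  by move=> i; have [V] := HF i; exists V.
have {ex} /boolp.choice[V HV] := ex.
(* Every code carries the offset [C], so a sum of codes carries [#|I| * C], which is removed before
   rounding again. *)
pose g a : nat := grid_enc (a%:R / D%:R - #|I|%:R * C%:R).
exists (fun w => g (\sum_i V i w)%N).
  have HS : num s d.+1 (#|I| * M) (fun w => \sum_i V i w)%N.
    by apply: num_sum (ltnW Is) _ => i; case: (HV i).
  by apply: (num_table (g := g) s1 Is _ HS) => a; exact: grid_enc_le.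
move=> w; apply: grid_encP => //.
rewrite distrC natr_sum mulr_suml.
have -> : #|I|%:R * C%:R = \sum_(i : I) (C%:R : R) by rewrite sumr_const mulr_natl.
rewrite -sumrB -sumrB mulr_natl -sumr_const.
apply: le_trans (ler_norm_sum _ _ _) _; apply: ler_sum => i _.
by case: (HV i).
Qed.

(** Decoding is monotone, so it commutes with maxima and the error does not grow. With guards that
    single out one value this is also the case distinction used below. *)
Lemma appr_max d eta (I : finType) (b : I -> W -> bool) (F : I -> W -> R) (G : W -> R) :
  (#|I| <= s)%N -> (forall i, tc s d (b i)) -> (forall i, appr d eta (F i)) ->
  (forall w, exists2 i, b i w & G w = F i w) ->
  (forall w i, b i w -> F i w <= G w) ->
  appr d.+2 eta G.
Proof.
move=> Is Hb HF G1 G2.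
have ex : forall i, exists V, num s d M V /\ forall w, `|F i w - grid_val (V w)| <= eta.
  by move=> i; have [V] := HF i; exists V.
have {ex} /boolp.choice[V HV] := ex.
exists (fun w => \max_(i | b i w) V i w)%N.
  by apply: num_max => // i; case: (HV i).
move=> w; have [i bi GF] := G1 w.
have [j bj E] : exists2 j, b j w & (\max_(i | b i w) V i w)%N = V j w.
  have := @bigop.eq_bigmax_cond _ [pred i | b i w] (fun i => V i w).
  case=> [|j bj ->]; first by apply/card_gt0P; exists i.
  by exists j.
have Vij := leq_bigmax_cond (P := fun i => b i w) (F := fun i => V i w) i bi.
rewrite E in Vij *; rewrite ler_norml; have [_ /(_ w)] := HV j; have [_ /(_ w)] := HV i.
rewrite !ler_norml => /andP[i1 i2] /andP[j1 j2]; have FG := G2 w j bj.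
have := grid_val_le Vij; rewrite -GF in i1 i2; move=> ?.
by apply/andP; split; lra.
Qed.

Lemma appr_bit d (b : W -> bool) (y z : R) : `|y| <= C%:R -> `|z| <= C%:R ->
  tc s d b -> appr d.+3 D%:R^-1 (fun w => if b w then y else z).
Proof.
move=> yC zC Hb.
apply: (@appr_max _ _ bool (fun i w => if i then b w else ~~ b w)
  (fun i w => if i then y else z)).
- by rewrite card_bool.
- by case; [exact: tc_leq (leqnSn d) _|exact: tc_not].
- by case; exact: appr_cst.
- by move=> w; case E: (b w); [exists true|exists false] => //; rewrite E.
- by move=> w [] /= E; rewrite ?E // (negbTE E).
Qed.

Lemma appr_mask d eta (b : W -> bool) (F : W -> R) : D%:R^-1 <= eta ->
  tc s d.+1 b -> appr d.+1 eta F ->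
  appr d.+4 eta (fun w => if b w then F w else 0).
Proof.
move=> De Hb HF.
apply: (@appr_max _ _ bool (fun i w => if i then b w else ~~ b w)
  (fun i w => if i then F w else 0)).
- by rewrite card_bool.
- by case; [exact: tc_leq (leqnSn _) _|exact: tc_not].
- case; first exact: appr_leq HF.
  by apply: (appr_leq (leqnn _) De); apply: appr_cst; rewrite normr0.
- by move=> w; case E: (b w); [exists true|exists false] => //; rewrite E.
- by move=> w [] /= E; rewrite ?E // (negbTE E).
Qed.

Section Aggregation.
Variables (n q d : nat) (eta B : R).
Variables (b : 'I_n -> W -> bool) (Y : 'I_n -> W -> 'I_q -> R).
Hypothesis ns : (n < s)%N.
Hypothesis Ms : (M < s)%N.
Hypothesis nMs : (n * M < s)%N.
Hypothesis De : D%:R^-1 <= eta.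
Hypothesis B0 : 0 <= B.
Hypothesis BC : n%:R * B <= C%:R.
Hypothesis tb : forall u, tc s d.+1 (b u).
Hypothesis aY : forall u i, appr d.+1 eta (fun w => Y u w i).
Hypothesis YB : forall u w i, `|Y u w i| <= B.

Local Notation aggregate := (@aggregate R).
Local Notation msgs w := [seq Y u w | u <- enum 'I_n & b u w].

Lemma agg_sumE w i : aggregate ASum (msgs w) i = \sum_u (if b u w then Y u w i else 0).
Proof. by rewrite /= big_map big_filter big_enum_cond big_mkcond. Qed.

Lemma agg_sum_le w i : `|aggregate ASum (msgs w) i| <= n%:R * B.
Proof.
rewrite agg_sumE; apply: le_trans (ler_norm_sum _ _ _) _.
rewrite -[X in X%:R * _]card_ord mulr_natl -sumr_const; apply: ler_sum => u _.
by case: ifP; rewrite ?normr0.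
Qed.

Lemma agg_meanE w i : aggregate AMean (msgs w) i =
  aggregate ASum (msgs w) i / (\sum_u b u w)%N%:R.
Proof.
rewrite /aggregate.
have -> : (\sum_u b u w)%N = size (msgs w).
  by rewrite size_map size_filter -sum1_count big_enum_cond /= [RHS]big_mkcond; apply: eq_bigr => u _; case: (b u w).
by case: (msgs w) => //; rewrite big_nil mul0r.
Qed.

Lemma agg_mean_le w i : `|aggregate AMean (msgs w) i| <= n%:R * B.
Proof.
rewrite agg_meanE; apply: le_trans (agg_sum_le w i); rewrite normrM.
case: (\sum_u _)%N => [|c]; first by rewrite invr0 normr0 mulr0.
by rewrite ler_piMr// normfV invf_le1 ?normr_gt0// normr_nat ler1n.
Qed.

Lemma agg_maxP w i :
  (aggregate AMax (msgs w) i = 0 /\ forall u, b u w = false) \/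
  ((exists2 u, b u w & aggregate AMax (msgs w) i = Y u w i) /\
   forall u, b u w -> Y u w i <= aggregate AMax (msgs w) i).
Proof.
have bE u : b u w = (u \in [seq u <- enum 'I_n | b u w]) by rewrite mem_filter mem_enum andbT.
case E : [seq u <- enum 'I_n | b u w] => [|u0 r]; rewrite E in bE *.
  by left; split=> // u; rewrite bE in_nil.
right; rewrite /= big_map; split.
  have : (\big[Num.max/Y u0 w i]_(u <- r) Y u w i) \in [seq Y u w i | u <- u0 :: r].
    rewrite big_seq; elim/big_ind: _ => [||u ur]; first by rewrite /= mem_head.
      by move=> x y xr yr; rewrite /Num.max; case: ifP.
    by rewrite map_f // inE ur orbT.
  by case/mapP => u ur ->; exists u => //; rewrite bE.
move=> u; rewrite bE inE => /orP[/eqP ->|ur].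
  elim: r {E bE} => [|v r IH]; first by rewrite big_nil.
  by rewrite big_cons le_max IH orbT.
elim: r ur {E bE} => // v r IH; rewrite inE big_cons le_max => /orP[/eqP ->|/IH ->].
  by rewrite lexx.
by rewrite orbT.
Qed.

Lemma agg_max_le w i : `|aggregate AMax (msgs w) i| <= n%:R * B.
Proof.
have [[-> _]|[[u _ ->] _]] := agg_maxP w i; first by rewrite normr0 mulr_ge0.
apply: le_trans (YB _ _ _) _; rewrite ler_peMl// ler1n.
by case: n u => // -[].
Qed.

Lemma aggregate_le a w i : `|aggregate a (msgs w) i| <= n%:R * B.
Proof. by case: a; [exact: agg_sum_le|exact: agg_mean_le|exact: agg_max_le]. Qed.

Lemma appr_agg_sum i :
  appr (d + 8) (n%:R * eta + D%:R^-1) (fun w => aggregate ASum (msgs w) i).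
Proof.
apply: (appr_ext (fun w => esym (agg_sumE w i))); rewrite -[X in X%:R]card_ord addnC.
apply: (@appr_sum d.+4) => [|w|u]; first by rewrite card_ord.
  by rewrite -agg_sumE; apply: le_trans (agg_sum_le _ _) _.
exact: appr_mask.
Qed.

(** The quotient is not treated as a function of two variables: the exact number [c <= n] of
    messages selects one of the maps [x / c], each of which is 1-Lipschitz (for [c = 0] it is the
    zero map). *)
Lemma appr_agg_mean i :
  appr (d + 13) (n%:R * eta + D%:R^-1 + D%:R^-1) (fun w => aggregate AMean (msgs w) i).
Proof.
apply: (appr_ext (fun w => esym (agg_meanE w i))); rewrite addnC.
apply: (@appr_max (11 + d) _ 'I_n.+1 (fun c w => (\sum_u b u w)%N == c)
  (fun c w => aggregate ASum (msgs w) i / c%:R)).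
- by rewrite card_ord.
- move=> c; apply: (@tc_leq _ _ d.+4); first by lia.
  apply: (@tc_num_eq _ _ d.+2 n) => //; split=> [w|k].
    rewrite -[leqRHS]card_ord -sum1_card; apply: leq_sum => u _; exact: leq_b1.
  by apply: tc_count => //; rewrite card_ord ltnW.
- move=> c.
  have h := @appr_lip (d + 8) (n%:R * eta + D%:R^-1) 1 (fun x => x / c%:R) _ _ _ _ _ (appr_agg_sum i).
  rewrite mul1r addnC in h; apply: h => //.
  + move=> x y; rewrite mul1r -mulrBl normrM; case: (c : nat) => [|c'].
      by rewrite invr0 normr0 mulr0.
    by rewrite ler_piMr// normfV invf_le1 ?normr_gt0// normr_nat ler1n.
  + move=> w; apply: le_trans BC; apply: le_trans (agg_sum_le w i); rewrite normrM.
    case: (c : nat) => [|c']; first by rewrite invr0 normr0 mulr0.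
    by rewrite ler_piMr// normfV invf_le1 ?normr_gt0// normr_nat ler1n.
- move=> w; have cn : (\sum_u b u w < n.+1)%N.
    by rewrite ltnS -[leqRHS]card_ord -sum1_card; apply: leq_sum => u _; exact: leq_b1.
  by exists (Ordinal cn) => /=.
- by move=> w c /eqP ->.
Qed.

Lemma appr_agg_max i : appr (d + 5) eta (fun w => aggregate AMax (msgs w) i).
Proof.
rewrite addnC.
(* The branch [None] stands for the empty multiset, whose maximum is 0 by convention. *)
apply: (@appr_max d.+3 _ (option 'I_n)
  (fun o w => if o is Some u then b u w else ~~ [exists u, b u w])
  (fun o w => if o is Some u then Y u w i else 0)).
- by rewrite card_option card_ord.
- case=> [u|]; first by apply: tc_leq (tb u); lia.
  by apply/tc_not/tc_exists => //; rewrite card_ord ltnW.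
- case=> [u|]; first by apply: appr_leq (aY u i) => //; lia.
  by apply: (@appr_leq d.+3 _ D%:R^-1) => //; apply: appr_cst; rewrite normr0.
- move=> w; have [[-> b0]|[[u bu ->] _]] := agg_maxP w i; last by exists (Some u).
  by exists None => //; apply/existsPn => u; rewrite b0.
- move=> w [u|] bu; have [[E b0]|[[v bv E] h]] := agg_maxP w i.
  + by rewrite b0 in bu.
  + exact: h.
  + by rewrite E.
  + by move/existsPn: bu => /(_ v); rewrite bv.
Qed.

Lemma appr_aggregate a i :
  appr (d + 13) (n%:R * eta + eta + eta) (fun w => aggregate a (msgs w) i).
Proof.
have eta0 : 0 <= eta by apply: le_trans De; rewrite invr_ge0.
have neta0 : 0 <= n%:R * eta by rewrite mulr_ge0.
case: a.
- apply: appr_leq (appr_agg_sum i); first by lia.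
  by apply: ler_wpDr => //; exact: lerD.
- by apply: appr_leq (appr_agg_mean i) => //; rewrite !lerD.
- by apply: appr_leq (appr_agg_max i); [lia|rewrite ler_wpDl// addr_ge0].
Qed.

End Aggregation.

End Approximation.

(** * Approximating networks *)

Section FnnFacts.
Variable R : realType.

Lemma lipnP (f : R -> R) : is_lipschitz R f -> lipschitz_with R (lipn R f)%:R f.
Proof.
move=> [L fL]; rewrite /lipn; case: pselect => [h|[]].
  by case: ex_minnP => k /asboolP.
exists (Num.truncn `|L|).+1; apply/asboolP => x y; apply: le_trans (fL x y) _.
rewrite ler_wpM2r//; apply: le_trans (ler_norm _) _; apply/ltW/truncnS_gt.
Qed.

Variables (m k : nat) (F : fnn R m k).
Implicit Types (x : 'I_m -> R) (v : 'I_(fn_N F)).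

Lemma fn_srcP v : reflect (exists i, fn_in F i = v) (fn_is_src F v).
Proof. by apply: (iffP forallP) => /fn_src. Qed.

Lemma fn_valsE x v : fn_vals F x v =
  match [pick i | fn_in F i == v] with
  | Some i => x i
  | None => fn_act F v (fn_b F v + \sum_(u | fn_E F u v) fn_w F u v * fn_vals F x u)
  end.
Proof.
rewrite {1}/fn_vals (iter_topo_fix (@fn_topo _ _ _ F)) // => f g u fg.
by case: pickP => // _; congr (fn_act _ _ (_ + _)); apply: eq_bigr => z /fg ->.
Qed.

Lemma fn_vals_in x i : fn_vals F x (fn_in F i) = x i.
Proof.
rewrite fn_valsE; case: pickP => [j /eqP /fn_in_inj ->//|/(_ i)].
by rewrite eqxx.
Qed.

Lemma fn_vals_act x v : ~~ fn_is_src F v ->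
  fn_vals F x v = fn_act F v (fn_b F v + \sum_(u | fn_E F u v) fn_w F u v * fn_vals F x u).
Proof.
move=> /fn_srcP h; rewrite fn_valsE; case: pickP => // i /eqP e.
by case: h; exists i.
Qed.

Lemma bigmax_ge0 (I : finType) (P : pred I) (f : I -> R) :
  0 <= \big[Num.max/0]_(i | P i) f i.
Proof. by elim/big_rec: _ => // i x _ x0; rewrite le_max x0 orbT. Qed.

Lemma fn_weight_parts : 
  [/\ (fn_N F)%:R <= fn_weight F,
      forall u v, fn_E F u v -> `|fn_w F u v| <= fn_weight F,
      forall v, ~~ fn_is_src F v -> `|fn_b F v| <= fn_weight F &
      forall v, ~~ fn_is_src F v -> (lipn R (fn_act F v))%:R + `|fn_act F v 0| <= fn_weight F].
Proof.
rewrite /fn_weight.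
set a := (_ + _)%:R; set b := \big[_/_]_(e | _) _; set c := \big[_/_]_(v | _) `|_|.
set d := \big[_/_]_(v | _) (_ + _).
have a0 : 0 <= a by [].
have b0 : 0 <= b by apply: bigmax_ge0.
have c0 : 0 <= c by apply: bigmax_ge0.
have d0 : 0 <= d by apply: bigmax_ge0.
split.
- have : (fn_N F)%:R <= a by rewrite ler_nat leq_addr.
  by lra.
- move=> u v uv; have : `|fn_w F u v| <= b.
    exact: (@le_bigmax_cond _ _ _ _ (u, v) (fun e => fn_E F e.1 e.2) (fun e => `|fn_w F e.1 e.2|)).
  by lra.
- move=> v hv; have : `|fn_b F v| <= c by exact: le_bigmax_cond.
  by lra.
- move=> v hv; have : (lipn R (fn_act F v))%:R + `|fn_act F v 0| <= d.
    exact: (@le_bigmax_cond _ _ _ _ v (fun v => ~~ fn_is_src F v)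
      (fun v => (lipn R (fn_act F v))%:R + `|fn_act F v 0|)).
  by lra.
Qed.

Lemma fn_act_lip v : ~~ fn_is_src F v -> lipschitz_with R (lipn R (fn_act F v))%:R (fn_act F v).
Proof.
move=> hv; apply/lipnP/fn_lip; move: hv; rewrite negb_forall => /existsP[u].
by rewrite negbK; exists u.
Qed.

Lemma fn_weight_ge0 : 0 <= fn_weight F.
Proof. by case: fn_weight_parts => h _ _ _; apply: le_trans h. Qed.

End FnnFacts.

Lemma gnn_weight_ge0 (R : realType) (pi po : nat) (Nn : gnn R pi po) : 0 <= gnn_weight Nn.
Proof.
elim: Nn => //= pi' q' r' L' N' h.
by apply: addr_ge0 => //; apply: addr_ge0; exact: fn_weight_ge0.
Qed.

Section ArithmeticBounds.
Variable R : realFieldType.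
Implicit Types x y z t k : R.

(** These two facts are the origin of the factor 4: a bound with at most four terms, each below the
    last member of a chain. The products of the application are abstracted to variables to keep the
    arithmetic linear. *)
Lemma act_bound x y z k k2 t t1 t2 : 0 <= x -> x <= y + z -> y <= k2 + t2 -> z <= k ->
  k <= t -> t <= t1 -> t1 <= t2 -> k2 <= t1 -> x <= 4 * t2.
Proof. by lra. Qed.

Lemma act_error x x1 x2 y y1 y2 y3 : x <= y -> x2 <= y2 -> x1 <= y1 ->
  y <= y1 -> y1 <= y2 -> y2 <= y3 -> y3 + x2 + x1 + x <= 4 * y3.
Proof. by lra. Qed.

End ArithmeticBounds.

(* With weight, degree and order bounded by K, one step of the evaluation multiplies
   both the magnitude and the error of the values by at most 4K^3. *)
Section NetworkApproximation.
Variables (R : realType) (N s C D K : nat).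
Hypothesis s1 : (1 < s)%N.
Hypothesis D0 : (0 < D)%N.
Hypothesis K0 : (0 < K)%N.
Hypothesis Ks : (K < s)%N.
Hypothesis KMs : (K * (2 * C * D) < s)%N.
Local Notation W := (N.-tuple bool).
Local Notation appr := (@appr R N s C D).
Local Notation g := ((4 * K ^ 3)%N%:R : R).

Let Ms : (2 * C * D < s)%N.
Proof. by apply: leq_ltn_trans KMs; rewrite leq_pmull. Qed.

Let KR : 1 <= K%:R :> R.
Proof. by rewrite ler1n. Qed.

Let gE : g = 4 * (K%:R * K%:R * K%:R).
Proof. by rewrite natrM natrX !exprS expr0 mulr1 !mulrA. Qed.

Let K2 : K%:R <= K%:R * K%:R :> R.
Proof. by rewrite ler_peMr. Qed.

Let K3 : K%:R * K%:R <= K%:R * K%:R * K%:R :> R.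
Proof. by rewrite ler_peMr // mulr_ge0. Qed.

Let gK : K%:R <= g.
Proof.
apply: le_trans K2 (le_trans K3 _); rewrite gE.
by rewrite ler_peMl ?mulr_ge0// ler1n.
Qed.

Let g1 : 1 <= g.
Proof. exact: le_trans gK. Qed.

Let g0 : 0 <= g.
Proof. exact: le_trans g1. Qed.

Let gX0 k : 0 <= g ^+ k.
Proof. exact: exprn_ge0. Qed.

Let gX k l (x : R) : (k <= l)%N -> 0 <= x -> g ^+ k * x <= g ^+ l * x.
Proof. by move=> kl x0; rewrite ler_wpM2r// ler_weXn2l. Qed.

(** Along one edge of the skeleton, [K^3] arises from the weight, the number of summands and the
    Lipschitz constant of the activation. The 10 levels are 3 for the products, 4 for the sum and 3
    for the activation. *)
Lemma appr_fnn (m k : nat) (F : fnn R m k) (X : W -> 'I_m -> R) d delta (eta B : R) :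
  fn_weight F <= K%:R -> (fn_depth F <= delta)%N ->
  D%:R^-1 <= eta -> 1 <= B -> g ^+ delta * B <= C%:R ->
  (forall i, appr d.+1 eta (fun w => X w i)) ->
  (forall w i, `|X w i| <= B) ->
  (forall j, appr (10 * delta + d.+1) (g ^+ delta * eta) (fun w => fn_eval F (X w) j)) /\
  (forall w j, `|fn_eval F (X w) j| <= g ^+ delta * B).
Proof.
move=> FK Fd De B1 BC aX XB.
have [FN Fw Fb Fa] := fn_weight_parts F.
have NK : (fn_N F <= K)%N by rewrite -(ler_nat R); exact: le_trans FK.
have eta0 : 0 <= eta by apply: le_trans De; rewrite invr_ge0.
have B0 : 0 <= B by exact: le_trans B1.
(* An upper bound [e] on the depth, rather than its exact value, gives one common bound for
   predecessors of different depths. *)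
suff H e v : (node_depth (fn_E F) v <= e)%N -> (e <= delta)%N ->
    appr (10 * e + d.+1) (g ^+ e * eta) (fun w => fn_vals F (X w) v) /\
    forall w, `|fn_vals F (X w) v| <= g ^+ e * B.
  have Hv v := H delta v (leq_trans (node_depth_le _ _) Fd) (leqnn _).
  by split=> [j|w j]; have [h1 h2] := Hv (fn_out F j); [exact: h1|exact: h2].
elim: e v => [|e IH] v ve ed.
  have /fn_srcP[i <-] : fn_is_src F v.
    apply/forallP => u; apply/negP => /(node_depth_lt (@fn_topo _ _ _ F)).
    by rewrite ltnNge (leq_trans ve).
  split=> [|w]; last by rewrite fn_vals_in expr0 mul1r.
  by rewrite expr0 mul1r muln0 add0n; apply: appr_ext (aX i) => w; rewrite fn_vals_in.
case: (boolP (fn_is_src F v)) => [/fn_srcP[i <-]|hv].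
  split=> [|w]; last first.
    rewrite fn_vals_in; apply: le_trans (XB w i) _; rewrite -[leLHS]mul1r -(expr0 g).
    exact: gX.
  apply: (@appr_ext _ _ _ _ _ _ _ (fun w => X w i)) => [w|]; first by rewrite fn_vals_in.
  apply: appr_leq (aX i); first exact: leq_addl.
  by rewrite -[leLHS]mul1r -(expr0 g); exact: gX.
have {}IH u : fn_E F u v -> appr (10 * e + d.+1) (g ^+ e * eta) (fun w => fn_vals F (X w) u) /\
    forall w, `|fn_vals F (X w) u| <= g ^+ e * B.
  move=> uv; apply: IH; last exact: ltnW.
  by rewrite -ltnS (leq_trans _ ve)//; exact: node_depth_lt (@fn_topo _ _ _ F) _ _ uv.
set B' := g ^+ e * B in IH *; set eta' := g ^+ e * eta in IH *.
have eta'0 : 0 <= eta' by rewrite mulr_ge0.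
have De' : D%:R^-1 <= eta'.
  by apply: le_trans De _; rewrite -[leLHS]mul1r -(expr0 g); exact: gX.
have B'1 : 1 <= B'.
  by apply: le_trans B1 _; rewrite -[leLHS]mul1r -(expr0 g); exact: gX.
have gB'C : g * B' <= C%:R.
  by apply: le_trans BC; rewrite mulrA -exprS; exact: gX.
have gexp x : g ^+ e.+1 * x = g * (g ^+ e * x) by rewrite exprS mulrA.
have KB : K%:R <= K%:R * B' by rewrite ler_peMr.
have K2B : K%:R * B' <= K%:R * (K%:R * B') by rewrite ler_peMl// mulr_ge0// (le_trans _ B'1).
have K3B : K%:R * (K%:R * B') <= K%:R * (K%:R * (K%:R * B')).
  by rewrite ler_peMl// !mulr_ge0// (le_trans _ B'1).
have gBE : g * B' = 4 * (K%:R * (K%:R * (K%:R * B'))) by rewrite gE; ring.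
have tt0 : 0 <= K%:R * (K%:R * (K%:R * B')) by rewrite !mulr_ge0// (le_trans _ B'1).
have K2BC : K%:R * (K%:R * B') <= C%:R by rewrite gBE in gB'C; lra.
have KBC : K%:R * B' <= C%:R by exact: le_trans K2BC.
have gXE : g * eta' = 4 * (K%:R * (K%:R * (K%:R * eta'))) by rewrite gE; ring.
have wz u w : fn_E F u v -> `|fn_w F u v * fn_vals F (X w) u| <= K%:R * B'.
  move=> uv; rewrite normrM ler_pM//; first by apply: le_trans (Fw _ _ uv) FK.
  by case: (IH u uv).
have sz w : `|\sum_(u | fn_E F u v) fn_w F u v * fn_vals F (X w) u| <= K%:R * (K%:R * B').
  apply: le_trans (ler_norm_sum _ _ _) _.
  apply: le_trans (_ : \sum_(u : 'I_(fn_N F)) K%:R * B' <= _).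
    rewrite big_mkcond; apply: ler_sum => u _; case: ifP => // uv; first exact: wz.
    by rewrite mulr_ge0// (le_trans _ B'1).
  rewrite sumr_const card_ord -[leLHS]mulr_natl ler_wpM2r ?ler_nat//.
  by rewrite mulr_ge0// (le_trans _ B'1).
have lipK : (lipn R (fn_act F v))%:R <= K%:R :> R.
  by apply: le_trans FK; apply: le_trans (Fa v hv); rewrite lerDl.
have act0 : `|fn_act F v 0| <= K%:R.
  by apply: le_trans FK; apply: le_trans (Fa v hv); rewrite lerDr.
have bK : `|fn_b F v| <= K%:R by apply: le_trans FK; exact: Fb.
have lipA := fn_act_lip hv.
have az w : `|fn_vals F (X w) v| <= g * B'.
  rewrite fn_vals_act //; set t := fn_b F v + _.
  have tK : `|t| <= K%:R + K%:R * (K%:R * B').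
    by apply: le_trans (ler_normD _ _) _; rewrite lerD.
  have h1 : `|fn_act F v t - fn_act F v 0| <= K%:R * (K%:R + K%:R * (K%:R * B')).
    apply: le_trans (lipA _ _) _; rewrite subr0 ler_pM//.
  have h2 : `|fn_act F v t| <= `|fn_act F v t - fn_act F v 0| + `|fn_act F v 0|.
    by rewrite -[X in `|X| <= _](subrK (fn_act F v 0)) ler_normD.
  have h3 : K%:R * K%:R <= K%:R * (K%:R * B') by rewrite ler_wpM2l.
  rewrite mulrDr in h1; rewrite gBE.
  exact: act_bound (normr_ge0 _) h2 h1 act0 KB K2B K3B h3.
split; last by move=> w; rewrite gexp.
rewrite gexp -/eta'.
pose T u w : R := if fn_E F u v then fn_w F u v * fn_vals F (X w) u else 0.
have TE w : \sum_u T u w = \sum_(u | fn_E F u v) fn_w F u v * fn_vals F (X w) u.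
  by rewrite [RHS]big_mkcond.
have aT u : appr (10 * e + d.+1).+3 (K%:R * eta' + D%:R^-1) (T u).
  rewrite /T; case E: (fn_E F u v); last first.
    apply: (@appr_leq _ _ _ _ _ (10 * e + d.+1).+3 _ D%:R^-1) => //.
      by rewrite lerDr mulr_ge0.
    by apply: appr_cst => //; rewrite normr0.
  have [IH1 IH2] := IH u E.
  apply: (appr_lip s1 D0 Ms (f := fun x => fn_w F u v * x)) IH1 => //.
    move=> x y; rewrite -mulrBr normrM ler_wpM2r//.
    exact: le_trans (Fw _ _ E) FK.
  by move=> w; exact: le_trans (wz u w E) _.
have aS : appr (10 * e + d.+1).+3.+4 (K%:R * (K%:R * eta' + D%:R^-1) + D%:R^-1)
    (fun w => \sum_u T u w).
  apply: (@appr_leq _ _ _ _ _ (10 * e + d.+1).+3.+4 _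
    ((fn_N F)%:R * (K%:R * eta' + D%:R^-1) + D%:R^-1)) => //.
    by rewrite lerD2r ler_wpM2r ?ler_nat// addr_ge0// ?mulr_ge0// invr_ge0.
  rewrite -[X in X%:R * _]card_ord; apply: appr_sum => //.
    by rewrite card_ord; apply: leq_ltn_trans KMs; rewrite leq_mul2r NK orbT.
  by move=> w; rewrite TE; exact: le_trans (sz w) _.
have h := appr_lip (L := K%:R) (f := fun x => fn_act F v (fn_b F v + x)) s1 D0 Ms _ _ _ aS.
apply: (appr_ext (F := fun w => fn_act F v (fn_b F v + \sum_u T u w))).
  by move=> w; rewrite fn_vals_act// TE.
apply: appr_leq (h _ _ _) => //.
- by clear; lia.
(* The error has four parts: the inherited one and the roundings after the products, the sum and the
   activation. Each is at most [K^3 * eta']. *)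
- have i1 : K%:R * (K%:R * D%:R^-1) <= K%:R * (K%:R * eta') by rewrite !ler_wpM2l.
  have i2 : K%:R * D%:R^-1 <= K%:R * eta' by rewrite !ler_wpM2l.
  have i3 : eta' <= K%:R * eta' by rewrite ler_peMl.
  have i4 : K%:R * eta' <= K%:R * (K%:R * eta') by rewrite ler_peMl// mulr_ge0.
  have i5 : K%:R * (K%:R * eta') <= K%:R * (K%:R * (K%:R * eta')).
    by rewrite ler_peMl// !mulr_ge0.
  rewrite gXE !mulrDr.
  exact: act_error De' i1 i2 i3 i4 i5.
- move=> x y; apply: le_trans (lipA _ _) _; rewrite opprD addrACA subrr add0r.
  by rewrite ler_wpM2r.
- by move=> w; rewrite TE -fn_vals_act//; exact: le_trans (az w) _.
Qed.

Lemma appr_vcat (m k : nat) (x : W -> 'I_m -> R) (y : W -> 'I_k -> R) d (eta B : R) :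
  (forall i, appr d eta (fun w => x w i)) -> (forall w i, `|x w i| <= B) ->
  (forall i, appr d eta (fun w => y w i)) -> (forall w i, `|y w i| <= B) ->
  (forall i, appr d eta (fun w => vcat (x w) (y w) i)) /\
  (forall w i, `|vcat (x w) (y w) i| <= B).
Proof. by move=> ax xB ay yB; split=> [|w] i; rewrite /vcat; case: fintype.split. Qed.

Section Layers.
Variables (n : nat) (adj : W -> rel 'I_n) (d0 : nat).
Hypothesis nK : (n <= K)%N.
Hypothesis tc_adj : forall u v, tc s d0.+1 (fun w => adj w u v).

Let ns : (n < s)%N. Proof. exact: leq_ltn_trans Ks. Qed.
Let nMs : (n * (2 * C * D) < s)%N.
Proof. by apply: leq_ltn_trans KMs; rewrite leq_mul2r nK orbT. Qed.
Let nKR : n%:R <= K%:R :> R. Proof. by rewrite ler_nat. Qed.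

(** The exponent [delta * 2 + 1] collects [delta] for the messages, 1 for the aggregation and
    [delta] for the combination; aggregation accounts for the 13 extra levels. *)
Lemma appr_layer (pi po : nat) (L : layer R pi po) (X : W -> 'I_n -> 'I_pi -> R)
    d delta (eta B : R) : (d0 <= d)%N ->
  fn_weight (l_msg L) <= K%:R -> fn_weight (l_comb L) <= K%:R ->
  (fn_depth (l_msg L) <= delta)%N -> (fn_depth (l_comb L) <= delta)%N ->
  D%:R^-1 <= eta -> 1 <= B -> g ^+ (delta * 2 + 1) * B <= C%:R ->
  (forall v i, appr d.+1 eta (fun w => X w v i)) ->
  (forall w v i, `|X w v i| <= B) ->
  (forall v j, appr (20 * delta + 13 + d.+1) (g ^+ (delta * 2 + 1) * eta)
     (fun w => layer_eval L (adj w) (X w) v j)) /\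
  (forall w v j, `|layer_eval L (adj w) (X w) v j| <= g ^+ (delta * 2 + 1) * B).
Proof.
move=> d0d mK cK md cd De B1 BC aX XB.
have eta0 : 0 <= eta by apply: le_trans De; rewrite invr_ge0.
have B0 : 0 <= B by exact: le_trans B1.
have Dd : D%:R^-1 <= g ^+ delta * eta.
  by apply: le_trans De _; rewrite -[leLHS]mul1r -(expr0 g); exact: gX.
pose Y v u w := fn_eval (l_msg L) (vcat (X w v) (X w u)).
have HY v u : (forall i, appr (10 * delta + d.+1) (g ^+ delta * eta)
      (fun w => Y v u w i)) /\ forall w i, `|Y v u w i| <= g ^+ delta * B.
  have [h1 h2] := appr_vcat (aX v) (fun w => XB w v) (aX u) (fun w => XB w u).
  apply: (appr_fnn mK md De B1) => //.
  by apply: le_trans BC; apply: gX => //; clear; lia.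
have gmul k x : 0 <= x -> n%:R * (g ^+ k * x) <= g ^+ (k + 1) * x.
  move=> x0; rewrite addn1 exprS -mulrA ler_wpM2r ?mulr_ge0//.
  exact: le_trans gK.
have gmul3 k x : 0 <= x ->
    n%:R * (g ^+ k * x) + g ^+ k * x + g ^+ k * x <= g ^+ (k + 1) * x.
  move=> x0; have y0 : 0 <= g ^+ k * x by rewrite mulr_ge0.
  rewrite addn1 exprS -mulrA; set y := g ^+ k * x in y0 *; rewrite gE.
  have -> : n%:R * y + y + y = (n%:R + 2) * y by ring.
  apply: ler_wpM2r => //.
  have := nKR; have := KR; have := K2; have := K3.
  set t := _ * _ * _; set t' := K%:R * K%:R; lra.
have Hagg v : (forall i, appr (10 * delta + d + 13) (g ^+ (delta + 1) * eta)
      (fun w => aggregate R (l_agg L) [seq Y v u w | u <- enum 'I_n & adj w v u] i)) /\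
    forall w i, `|aggregate R (l_agg L) [seq Y v u w | u <- enum 'I_n & adj w v u] i|
      <= g ^+ (delta + 1) * B.
  have nB : n%:R * (g ^+ delta * B) <= C%:R.
    by apply: le_trans (gmul _ _ B0) _; apply: le_trans BC; apply: gX => //; clear; lia.
  split=> [i|w i].
    apply: appr_leq (@appr_aggregate _ _ _ _ _ s1 D0 _ _ _ _ _ (fun u w => adj w v u)
      (Y v) ns Ms nMs Dd _ nB _ _ _ (l_agg L) i) => //.
    - by rewrite gmul3.
    - by rewrite mulr_ge0.
    - by move=> u; apply: tc_leq (tc_adj v u); rewrite ltnS (leq_trans d0d)// leq_addl.
    - by move=> u j; rewrite -addnS; case: (HY v u).
    - by move=> u w j; case: (HY v u).
  apply: le_trans (gmul _ _ B0).
  apply: (@aggregate_le _ _ _ _ _ (fun u w => adj w v u) (Y v)).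
    by rewrite mulr_ge0.
  by move=> u w' j; case: (HY v u).
have gB0 : g ^+ 0 * B = B by rewrite expr0 mul1r.
have ge0 : g ^+ 0 * eta = eta by rewrite expr0 mul1r.
have HX : (forall i, appr (d + 13) (g ^+ (delta + 1) * eta)
      (fun w => aggregate R (l_agg' L) [seq X w u | u <- enum 'I_n] i)) /\
    forall w i, `|aggregate R (l_agg' L) [seq X w u | u <- enum 'I_n] i|
      <= g ^+ (delta + 1) * B.
  have nB : n%:R * B <= C%:R.
    rewrite -[B in X in X <= _]gB0.
    by apply: le_trans (gmul _ _ B0) _; apply: le_trans BC; apply: gX => //; clear; lia.
  have allE w : [seq X w u | u <- enum 'I_n] = [seq X w u | u <- enum 'I_n & true].
    by rewrite filter_predT.
  split=> [i|w i]; last first.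
    rewrite allE; apply: le_trans (_ : n%:R * B <= _).
      by apply: (@aggregate_le _ _ _ _ _ (fun _ _ => true) (fun u w => X w u)).
    rewrite -[B in X in X <= _]gB0; apply: le_trans (gmul _ _ B0) _.
    by apply: gX => //; clear; lia.
  apply: (@appr_ext _ _ _ _ _ _ _ (fun w =>
    aggregate R (l_agg' L) [seq X w u | u <- enum 'I_n & true] i)).
    by move=> w; rewrite allE.
  apply: appr_leq (@appr_aggregate _ _ _ _ _ s1 D0 _ _ _ _ _ (fun _ _ => true)
    (fun u w => X w u) ns Ms nMs De B0 nB _ _ _ (l_agg' L) i) => //.
    rewrite -[in leLHS]ge0; apply: le_trans (gmul3 _ _ eta0) _.
    by apply: gX => //; clear; lia.
  by move=> u; exact: tc_cst.
pose Z w v := vcat (vcat (X w v)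
  (aggregate R (l_agg L) [seq Y v u w | u <- enum 'I_n & adj w v u]))
  (aggregate R (l_agg' L) [seq X w u | u <- enum 'I_n]).
have De1 : D%:R^-1 <= g ^+ (delta + 1) * eta.
  by apply: le_trans Dd _; apply: gX => //; clear; lia.
have B1' : 1 <= g ^+ (delta + 1) * B.
  by apply: le_trans B1 _; rewrite -[leLHS]gB0; exact: gX.
have HZ v : (forall i, appr (10 * delta + 12 + d).+1 (g ^+ (delta + 1) * eta)
      (fun w => Z w v i)) /\ forall w i, `|Z w v i| <= g ^+ (delta + 1) * B.
  have d1 : (d.+1 <= (10 * delta + 12 + d).+1)%N by clear; lia.
  have d2 : (10 * delta + d + 13 <= (10 * delta + 12 + d).+1)%N by clear; lia.
  have d3 : (d + 13 <= (10 * delta + 12 + d).+1)%N by clear; lia.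
  have [a1 a2] := Hagg v; have [x1 x2] := HX.
  have [|||y y2] := @appr_vcat _ _ (fun w => X w v) _ (10 * delta + 12 + d).+1
    (g ^+ (delta + 1) * eta) (g ^+ (delta + 1) * B) _ _ _ a2.
  - move=> i; apply: appr_leq (aX v i) => //.
    by rewrite -[leLHS]ge0; exact: gX.
  - by move=> w i; apply: le_trans (XB w v i) _; rewrite -[leLHS]gB0; exact: gX.
  - by move=> i; apply: appr_leq (a1 i).
  - by apply: appr_vcat => // i; apply: appr_leq (x1 i).
have gexp x : g ^+ (delta * 2 + 1) * x = g ^+ delta * (g ^+ (delta + 1) * x).
  by rewrite mulrA -exprD; congr (_ ^+ _ * _); clear; lia.
have H v := @appr_fnn _ _ (l_comb L) (fun w => Z w v) _ _ _ _ cK cd De1 B1'.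
have BC' : g ^+ delta * (g ^+ (delta + 1) * B) <= C%:R by rewrite -gexp.
split=> [v j|w v j]; have [z1 z2] := HZ v; have [h1 h2] := H _ v BC' z1 z2.
  by rewrite gexp; apply: appr_leq (h1 j) => //; clear; lia.
by rewrite gexp; exact: h2.
Qed.

Lemma appr_gnn (pi po : nat) (Nn : gnn R pi po) (X : W -> 'I_n -> 'I_pi -> R)
    d delta (eta B : R) : (d0 <= d)%N ->
  gnn_weight Nn <= K%:R -> (gnn_maxdepth Nn <= delta)%N ->
  D%:R^-1 <= eta -> 1 <= B ->
  g ^+ (gnn_nlayers Nn * (delta * 2 + 1)) * B <= C%:R ->
  (forall v i, appr d.+1 eta (fun w => X w v i)) ->
  (forall w v i, `|X w v i| <= B) ->
  forall v j, appr (gnn_nlayers Nn * (20 * delta + 13) + d.+1)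
     (g ^+ (gnn_nlayers Nn * (delta * 2 + 1)) * eta)
     (fun w => gnn_eval Nn (adj w) (X w) v j).
Proof.
elim: Nn X d eta B => [{}pi|{}pi q {}po L {}Nn IH] X d eta B d0d /= wK dd De B1 BC aX XB v j.
  by rewrite expr0 mul1r; exact: aX.
have eta0 : 0 <= eta by apply: le_trans De; rewrite invr_ge0.
have B0 : 0 <= B by exact: le_trans B1.
move: dd; rewrite !geq_max => /andP[/andP[md cd] Nd].
have m0 := fn_weight_ge0 (l_msg L); have c0 := fn_weight_ge0 (l_comb L).
have n0 := gnn_weight_ge0 Nn.
set T := (delta * 2 + 1)%N in BC *.
have [|||h1 h2] := @appr_layer _ _ L X d delta eta B d0d _ _ md cd De B1 _ aX XB.
- by lra.
- by lra.
- by apply: le_trans BC; apply: gX => //; rewrite -/T mulSn leq_addr.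
have gexp x : g ^+ (T + gnn_nlayers Nn * T) * x = g ^+ (gnn_nlayers Nn * T) * (g ^+ T * x).
  by rewrite mulrA -exprD addnC.
have := IH _ (20 * delta + 13 + d)%N (g ^+ T * eta) (g ^+ T * B) _ _ Nd _ _ _ _ h2 v j.
rewrite mulSn gexp => h; apply: appr_leq (h _ _ _ _ _ _) => //.
- by clear; lia.
- by rewrite (leq_trans d0d)// leq_addl.
- by lra.
- by apply: le_trans De _; rewrite -[leLHS]mul1r -(expr0 g); exact: gX.
- by apply: le_trans B1 _; rewrite -[leLHS]mul1r -(expr0 g); exact: gX.
- by apply: le_trans BC; rewrite mulSn gexp.
- by move=> u i; rewrite -addnS; exact: h1.
Qed.

End Layers.

End NetworkApproximation.

(** * Derandomisation *)

(* Monotonicity and superadditivity of the integral hold for arbitrary nonnegative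
   functions, since it is a supremum over simple functions below; this spares any
   measurability argument about the iterated integrals [iprob]. *)
Section NonnegativeIntegral.
Local Open Scope classical_set_scope.
Local Open Scope ereal_scope.
Import HBNNSimple.
Context d (T : measurableType d) (R : realType).
Variable mu : {measure set T -> \bar R}.
Variable D : set T.
Implicit Types f g : T -> \bar R.

Lemma nneg_le_integral f g : (forall x, D x -> 0 <= f x) ->
  (forall x, D x -> f x <= g x) -> \int[mu]_(x in D) f x <= \int[mu]_(x in D) g x.
Proof.
move=> f0 fg.
have g0 x : D x -> 0 <= g x by move=> Dx; exact: le_trans (f0 x Dx) (fg x Dx).
rewrite !ge0_integralE//; apply: ereal_sup_le => _ /= [h hf <-].
exists h => // x; apply: le_trans (hf x) _.
by rewrite /patch; case: ifPn => // /set_mem Dx; exact: fg.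
Qed.

(** Simple functions below [f] and [g] add up to one below [f + g]; taking the two suprema one after
    the other gives the inequality. *)
Lemma nneg_integralD_le f g : (forall x, D x -> 0 <= f x) ->
  (forall x, D x -> 0 <= g x) ->
  \int[mu]_(x in D) f x + \int[mu]_(x in D) g x <= \int[mu]_(x in D) (f x + g x).
Proof.
move=> f0 g0.
have fg0 x : D x -> 0 <= f x + g x by move=> Dx; rewrite adde_ge0 ?f0 ?g0.
rewrite !ge0_integralE//; set A := ereal_sup _; set B := ereal_sup _.
set S := ereal_sup _.
have hS (h k : {nnsfun T >-> R}) : (forall x, (h x)%:E <= (f \_ D) x) ->
    (forall x, (k x)%:E <= (g \_ D) x) -> sintegral mu h + sintegral mu k <= S.
  move=> hf kg; rewrite -sintegralD//; apply: ereal_sup_ubound => /=.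
  exists (h \+ k)%R => // x; rewrite /= EFinD.
  have := leeD (hf x) (kg x); rewrite /patch.
  by case: ifPn => //; rewrite adde0.
have S0 : 0 <= S.
  apply: ereal_sup_ubound => /=; exists nnsfun0; last by rewrite sintegral0.
  by move=> x; rewrite /patch /=; case: ifPn => // /set_mem Dx; exact: fg0.
(* Finiteness of [S] is what permits the subtractions that move a summand across the inequality. *)
have [Sy|Sfin] := eqVneq S +oo; first by rewrite Sy leey.
have Sr : S \is a fin_num by rewrite ge0_fin_numE// lt_neqAle Sfin leey.
have S_fin x : 0 <= x -> x <= S -> x \is a fin_num.
  by move=> x0 xS; rewrite ge0_fin_numE// (le_lt_trans xS)// ltey_eq Sr.
have B0 : 0 <= B.
  apply: ereal_sup_ubound => /=; exists nnsfun0; last by rewrite sintegral0.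
  by move=> x; rewrite /patch /=; case: ifPn => // /set_mem Dx; exact: g0.
have n0 : forall x, (@nnsfun0 _ T R x)%:E <= (f \_ D) x.
  by move=> x; rewrite /patch /=; case: ifPn => // /set_mem Dx; exact: f0.
have n0' : forall x, (@nnsfun0 _ T R x)%:E <= (g \_ D) x.
  by move=> x; rewrite /patch /=; case: ifPn => // /set_mem Dx; exact: g0.
have BS : B <= S.
  apply: ge_ereal_sup => _ /= [k kg <-].
  by have := hS _ _ n0 kg; rewrite sintegral0 add0e.
have Bfin := S_fin _ B0 BS.
rewrite -leeBrDr//; apply: ge_ereal_sup => _ /= [h hf <-].
rewrite leeBrDr//.
have h0 : 0 <= sintegral mu h by exact: sintegral_ge0.
have hfin : sintegral mu h \is a fin_num.
  by apply: S_fin => //; have := hS _ _ hf n0'; rewrite sintegral0 adde0.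
rewrite addeC -leeBrDr//; apply: ge_ereal_sup => _ /= [k kg <-].
by rewrite leeBrDr// addeC hS.
Qed.

Lemma nneg_integralZl_le f (c : R) : (0 <= c)%R -> (forall x, D x -> 0 <= f x) ->
  c%:E * \int[mu]_(x in D) f x <= \int[mu]_(x in D) (c%:E * f x).
Proof.
rewrite le_eqVlt => /orP[/eqP <-|c0] f0.
  rewrite mul0e; under eq_integral do rewrite mul0e.
  by rewrite integral0.
have cf0 x : D x -> 0 <= c%:E * f x by move=> Dx; apply: mule_ge0; [rewrite lee_fin ltW|exact: f0].
rewrite !ge0_integralE// -lee_pdivlMl//; apply: ge_ereal_sup => _ /= [h hf <-].
rewrite lee_pdivlMl// -sintegralrM; apply: ereal_sup_ubound => /=.
exists (scale_nnsfun h (ltW c0)) => //= x.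
have := hf x; rewrite /patch; case: ifPn => _ hx; rewrite EFinM.
  by rewrite lee_pmul2l// lte_fin.
have pt0 : @point (\bar R) = 0 by [].
by rewrite pt0 -(mule0 c%:E) lee_pmul2l ?pt0// lte_fin.
Qed.

Lemma nneg_integral_sum_le (I : Type) (r : seq I) (c : I -> R) (f : I -> T -> \bar R) :
  (forall i, 0 <= c i)%R -> (forall i x, D x -> 0 <= f i x) ->
  \sum_(i <- r) (c i)%:E * \int[mu]_(x in D) f i x <=
  \int[mu]_(x in D) (\sum_(i <- r) (c i)%:E * f i x).
Proof.
move=> c0 f0; elim: r => [|i r IH].
  rewrite big_nil; under eq_integral do rewrite big_nil.
  by rewrite integral0.
rewrite big_cons.
have -> : (fun x => \sum_(j <- i :: r) (c j)%:E * f j x) =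
    (fun x => (c i)%:E * f i x + \sum_(j <- r) (c j)%:E * f j x).
  by apply/funext => x; rewrite big_cons.
have cf0 j x : D x -> 0 <= (c j)%:E * f j x by move=> Dx; rewrite mule_ge0 ?lee_fin ?f0.
apply: le_trans (nneg_integralD_le _ _); last 2 first.
- by move=> x; exact: cf0.
- by move=> x Dx; apply: sume_ge0 => j _; exact: cf0.
by apply: leeD => //; apply: nneg_integralZl_le => // x; exact: f0.
Qed.

End NonnegativeIntegral.

(** * Choosing a sample by conditional expectations *)

Section IteratedProbability.
Local Open Scope classical_set_scope.
Local Open Scope ereal_scope.
Variables (R : realType) (T : finType).
Implicit Types (s : seq T) (A : (T -> R) -> Prop).

Definition upd (t : T) (x : R) (h : T -> R) : T -> R := fun u => if u == t then x else h u.

Lemma iprob_cons t s A :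
  @iprob R T (t :: s) A =
  \int[@lebesgue_measure R]_(x in `[0%R, 1%R]) @iprob R T s (fun h => A (upd t x h)).
Proof. by []. Qed.

Lemma iprob_ge0 s A : 0 <= @iprob R T s A.
Proof.
elim: s A => [|t s IH] A; first by rewrite lee_fin; case: ifP.
by rewrite iprob_cons; apply: integral_ge0 => x _; exact: IH.
Qed.

Lemma integral_unit_cst (c : R) :
  \int[@lebesgue_measure R]_(x in `[0%R, 1%R]) c%:E = c%:E.
Proof.
rewrite integral_cst//.
have := lebesgue_measure_itv (Interval (BLeft (0 : R)%R) (BRight 1%R)).
by rewrite /= lte_fin ltr01 sube0 => ->; rewrite mule1.
Qed.

(** The coordinates are fixed one at a time. If no value of the current one kept the weighted sum
    above [c], superadditivity and monotonicity would bound its integral by [c]. *)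
Lemma iprob_average (X : finType) s (A : X -> (T -> R) -> Prop) (wt : X -> R) (c : R) :
  (forall x, 0 <= wt x)%R ->
  c%:E < \sum_x (wt x)%:E * @iprob R T s (A x) ->
  exists rho : T -> R, (forall u, 0 <= rho u <= 1)%R /\
    (c < \sum_x wt x * (`[< A x rho >] : nat)%:R)%R.
Proof.
move=> wt0; elim: s A => [|t s IH] A cA.
  exists (fun=> 0%R); split=> [u|]; first by rewrite lexx ler01.
  rewrite -lte_fin (lt_le_trans cA)// -sumEFin; apply: lee_sum => x _.
  by rewrite EFinM /=; case: ifP.
have [[y [y01 cy]]|H] := pselect (exists y : R, (0 <= y <= 1)%R /\
    c%:E < \sum_x (wt x)%:E * @iprob R T s (fun h => A x (upd t y h))).
  have [rho [rho01 crho]] := IH _ cy.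
  by exists (upd t y rho); split=> // u; rewrite /upd; case: ifP.
suff : \sum_x (wt x)%:E * @iprob R T (t :: s) (A x) <= c%:E by rewrite leNgt cA.
apply: le_trans (_ : \int[@lebesgue_measure R]_(y in `[0%R, 1%R]) (\sum_x (wt x)%:E *
    @iprob R T s (fun h => A x (upd t y h))) <= _).
  by apply: nneg_integral_sum_le => // x z _; exact: iprob_ge0.
rewrite -integral_unit_cst; apply: nneg_le_integral => y y01.
  by apply: sume_ge0 => x _; rewrite mule_ge0 ?lee_fin ?iprob_ge0.
by rewrite leNgt; apply/negP => cy; apply: H; exists y; split=> //.
Qed.


(** The fraction 13/18 is below 3/4, which gives the strict inequality, and satisfies
    [2 - 3/2 * 13/18 = 11/12]. *)
Lemma unif_prob_average (X : finType) (A : X -> (T -> R) -> Prop) (wt : X -> R) :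
  (forall x, 0 <= wt x)%R -> (0 < \sum_x wt x)%R ->
  (forall x, (3 / 4)%:E <= unif_prob (A x)) ->
  exists rho : T -> R, (forall u, 0 <= rho u <= 1)%R /\
    (13 / 18 * \sum_x wt x < \sum_x wt x * (`[< A x rho >] : nat)%:R)%R.
Proof.
move=> wt0 S0 A34; apply: (@iprob_average _ (enum T)) => //.
apply: lt_le_trans (_ : (3 / 4 * \sum_x wt x)%:E <= _).
  by rewrite lte_fin; nra.
rewrite mulr_sumr -sumEFin; apply: lee_sum => x _.
by rewrite mulrC EFinM; apply: lee_wpmul2l; [rewrite lee_fin|exact: A34].
Qed.

(* Greedy amplification: the potential \sum_x 2^(bad - good) decreases by a factor
   11/12 with each suitably chosen sample, so that it eventually drops below 1. *)
Lemma derandomize (X : finType) (A : X -> (T -> R) -> Prop) (k : nat) :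
  (#|X| <= 2 ^ k)%N -> (forall x, (3 / 4)%:E <= unif_prob (A x)) ->
  exists rho : 'I_(8 * k.+1) -> T -> R, (forall t u, 0 <= rho t u <= 1)%R /\
    forall x, (4 * k.+1 < \sum_t `[< A x (rho t) >])%N.
Proof.
move=> Xk A34.
have step m : exists rho : 'I_m -> T -> R, (forall t u, 0 <= rho t u <= 1)%R /\
    (\sum_x 2 ^+ m * (1 / 4) ^+ (\sum_t `[< A x (rho t) >]) <= (11 / 12) ^+ m * #|X|%:R :> R)%R.
  elim: m => [|m [rho [rho01 pot]]].
    exists (fun _ _ => 0%R); split=> [[]//|].
    under eq_bigr do rewrite big_ord0 !expr0 mulr1.
    by rewrite expr0 mul1r sumr_const.
  have [X0|X0] := posnP #|X|.
    exists (fun _ _ => 0%R); split=> [t u|]; first by rewrite lexx ler01.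
    rewrite big_pred0 ?X0 ?mulr0// => x; apply/negP => _.
    by have := fintype0 x X0.
  pose wt x : R := (2 ^+ m * (1 / 4) ^+ (\sum_t `[< A x (rho t) >]))%R.
  have wt0 x : (0 < wt x)%R by rewrite mulr_gt0// exprn_gt0// divr_gt0.
  have [/card_gt0P [x0 _]] := (X0).
  have S0 : (0 < \sum_x wt x)%R.
    rewrite (bigD1 x0)//= ltr_pwDl//; apply: sumr_ge0 => x _; exact: ltW.
  have [y [y01 Hy]] := unif_prob_average (fun x => ltW (wt0 x)) S0 A34.
  exists (fun t => if unlift ord_max t is Some t' then rho t' else y); split=> [t u|].
    by case: unlift.
  (* A bad sample doubles the weight of [x] and a good one halves it: [2 - 3/2 = 1/2]. *)
  apply: le_trans (_ : \sum_x (2 * wt x - 3 / 2 * (wt x * (`[< A x y >] : nat)%:R)) <= _)%R.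
    apply: ler_sum => x _; rewrite big_ord_recr /= unlift_none.
    rewrite (eq_bigr (fun t => `[< A x (rho t) >] : nat)) => [|t _]; last first.
      have -> : widen_ord (leqnSn m) t = lift ord_max t.
        by apply: val_inj; rewrite /= /bump leqNgt ltn_ord.
      by rewrite liftK.
    rewrite /wt exprD exprS; set a := (\sum_(t < m) _)%N.
    set b := (2 ^+ m)%R; set c := ((1 / 4) ^+ a)%R.
    by case: `[< _ >]; rewrite ?expr1 ?expr0 ?mulr1 ?mulr0; lra.
  have b_le : (\sum_x wt x <= (11 / 12) ^+ m * #|X|%:R)%R by [].
  have -> : (\sum_x (2 * wt x - 3 / 2 * (wt x * (`[< A x y >] : nat)%:R)) =
      2 * (\sum_x wt x) - 3 / 2 * \sum_x wt x * (`[< A x y >] : nat)%:R)%R.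
    by rewrite sumrB !mulr_sumr.
  rewrite exprS -[X in (_ <= X)%R]mulrA; move: Hy b_le.
  set a := (\sum_x wt x * _)%R; set b := (\sum_x wt x)%R; set c := (_ * #|X|%:R)%R.
  by lra.
(* Since [(11/12)^8 < 1/2], the potential ends below [(1/2)^(k+1) * 2^k < 1], whereas an [x] with at
   most half of its samples good would contribute at least [2^(8(k+1)) / 4^(4(k+1)) = 1]. *)
have [rho [rho01 pot]] := step (8 * k.+1)%N.
exists rho; split=> // x; rewrite ltnNge; apply/negP => few.
have : (1 <= (11 / 12) ^+ (8 * k.+1) * #|X|%:R :> R)%R.
  apply: le_trans pot; rewrite (bigD1 x) //=; apply: ler_wpDr.
    by apply: sumr_ge0 => i _; rewrite mulr_ge0// exprn_ge0// divr_ge0.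
  apply: le_trans (_ : 2 ^+ (8 * k.+1) * (1 / 4) ^+ (4 * k.+1) <= _)%R; last first.
    by rewrite ler_wpM2l ?exprn_ge0// ler_wiXn2l ?divr_ge0//; lra.
  rewrite !exprM -exprMn; have -> : (2 ^+ 8 * (1 / 4) ^+ 4 = 1 :> R)%R by field.
  by rewrite expr1n.
rewrite leNgt => /negP; apply; apply: le_lt_trans (_ : (1 / 2) ^+ k.+1 * 2 ^+ k < 1)%R.
  rewrite -natrX ler_pM ?exprn_ge0 ?divr_ge0 ?ler_nat//.
  by rewrite exprM ler_pXn2r ?nnegrE ?exprn_ge0 ?divr_ge0//; lra.
rewrite exprSr mulrAC -exprMn; have -> : (1 / 2 * 2 = 1 :> R)%R by field.
by rewrite expr1n; lra.
Qed.

End IteratedProbability.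

(** * Encodings of ordered graphs *)

Lemma size_flatten_pairs (A B : Type) (f g : A -> B) (s : seq A) :
  size (flatten [seq [:: f x; g x] | x <- s]) = (2 * size s)%N.
Proof. by elim: s => //= x s ->; lia. Qed.

Section Encoding.
Variables (p n : nat).
Local Open Scope nat_scope.

Definition vpairs : seq ('I_n * 'I_n) := [seq (a, c) | a <- enum 'I_n, c <- enum 'I_n].
Definition lpairs : seq ('I_n * 'I_p) := [seq (a, j) | a <- enum 'I_n, j <- enum 'I_p].

Lemma mem_vpairs x : x \in vpairs.
Proof. by case: x => a c; apply/allpairsP; exists (a, c); rewrite !mem_enum. Qed.

Lemma mem_lpairs x : x \in lpairs.
Proof. by case: x => a c; apply/allpairsP; exists (a, c); rewrite !mem_enum. Qed.

Lemma size_vpairs : size vpairs = n * n.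
Proof. by rewrite size_allpairs size_enum_ord. Qed.

Lemma size_lpairs : size lpairs = n * p.
Proof. by rewrite size_allpairs !size_enum_ord. Qed.

(* Symbolic bits of the code word, so that both the circuit (which recomputes the
   word from the decoded graph) and the network (which feeds it to a circuit) can
   address the graph data behind a position. *)
Definition code_bit := (bool + ('I_n * 'I_n) + ('I_n * 'I_p))%type.
Definition code_cst (b : bool) : code_bit := inl (inl b).

Definition code_val (G : lgraph p n) (sigma : {perm 'I_n}) (x : code_bit) : bool :=
  match x with
  | inl (inl b) => b
  | inl (inr ac) => gadj G (sigma ac.1) (sigma ac.2)
  | inr aj => glab G (sigma aj.1) aj.2
  end.

Definition graph_code (i : nat) : seq code_bit :=
  flatten [seq [:: code_cst false; inl (inr x)] | x <- vpairs] ++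
  flatten [seq [:: code_cst false; inr x] | x <- lpairs] ++
  map code_cst (enc_hash ++ flatten (map enc_bit (bin i))).

Lemma enc_bitE b : enc_bit b = [:: false; b].
Proof. by case: b. Qed.

Lemma encodeE (G : lgraph p n) sigma (i : 'I_n) :
  encode G sigma i = map (code_val G sigma) (graph_code i).
Proof.
have pairE (A B : Type) (s : seq A) (t : seq B) (f : A -> B -> bool) (g : A * B -> code_bit) :
    (forall a c, code_val G sigma (g (a, c)) = f a c) ->
    flatten [seq enc_bit (f a c) | a <- s, c <- t] =
    map (code_val G sigma) (flatten [seq [:: code_cst false; g x] | x <- [seq (a, c) | a <- s, c <- t]]).
  move=> gf; have -> : [seq enc_bit (f a c) | a <- s, c <- t] =
      [seq enc_bit (f x.1 x.2) | x <- [seq (a, c) | a <- s, c <- t]] by rewrite map_allpairs.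
  by elim: [seq (a, c) | a <- s, c <- t] => //= -[a c] l ->; rewrite enc_bitE gf.
rewrite /encode /graph_code !map_cat; congr (_ ++ (_ ++ _)); try exact: pairE.
by rewrite -!map_comp !map_id_in.
Qed.

Definition code_size (i : nat) : nat :=
  2 * (n * n) + 2 * (n * p) + 2 + 2 * size (bin i).

Lemma size_code i : size (graph_code i) = code_size i.
Proof.
rewrite /graph_code !size_cat size_map size_cat /code_size !size_flatten_pairs size_vpairs size_lpairs.
rewrite (eq_map enc_bitE) size_flatten_pairs /=; lia.
Qed.

Lemma size_encode (G : lgraph p n) sigma (i : 'I_n) : size (encode G sigma i) = code_size i.
Proof. by rewrite encodeE size_map size_code. Qed.

Lemma leq_code_size i : n <= code_size i.
Proof. rewrite /code_size; case: n => // m; nia. Qed.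

(** A data bit [b] is written as [0b], so it stands at the odd position of its block. *)
Definition adj_pos (x : 'I_n * 'I_n) : nat := (2 * index x vpairs).+1.
Definition lab_pos (x : 'I_n * 'I_p) : nat := 2 * (n * n) + (2 * index x lpairs).+1.

(** Symmetry and irreflexivity are forced, so that every word decodes to a graph; on the code of a
    graph this changes nothing. *)
Definition dec_adj (w : seq bool) : rel 'I_n := fun a c =>
  (a != c) && (nth false w (adj_pos (a, c)) && nth false w (adj_pos (c, a))).

Lemma dec_adj_sym w : symmetric (dec_adj w).
Proof. by move=> a c; rewrite /dec_adj eq_sym andbC [_ && nth _ _ _]andbC andbC. Qed.

Lemma dec_adj_irr w : irreflexive (dec_adj w).
Proof. by move=> a; rewrite /dec_adj eqxx. Qed.

Definition decode_graph (w : seq bool) : lgraph p n :=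
  LGraph (dec_adj_sym w) (dec_adj_irr w) (fun a j => nth false w (lab_pos (a, j))).

Lemma nth_pair_flatten (A : Type) (B : eqType) (x0 : A) (z : A) (f : B -> A) s k x r :
  k = (2 * index x s).+1 -> x \in s ->
  nth x0 (flatten [seq [:: z; f x] | x <- s] ++ r) k = f x.
Proof.
move=> -> {k}; elim: s => //= y s IH; rewrite inE eq_sym.
case: eqP => [-> //|_] xs.
rewrite [X in nth _ _ X](_ : _ = (2 * index x s).+2); last by rewrite mulnS.
exact: IH.
Qed.

Lemma nth_code_adj i x : nth (code_cst false) (graph_code i) (adj_pos x) = inl (inr x).
Proof. by apply: nth_pair_flatten => //; exact: mem_vpairs. Qed.

Lemma nth_code_lab i x : nth (code_cst false) (graph_code i) (lab_pos x) = inr x.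
Proof.
rewrite nth_cat size_flatten_pairs size_vpairs ltnNge leq_addr /= addKn.
by apply: nth_pair_flatten => //; exact: mem_lpairs.
Qed.

Lemma nth_encode (G : lgraph p n) sigma (i : 'I_n) j :
  nth false (encode G sigma i) j = code_val G sigma (nth (code_cst false) (graph_code i) j).
Proof.
rewrite encodeE; have [ji|ij] := ltnP j (size (graph_code i)); first by rewrite (nth_map (code_cst false)).
by rewrite !nth_default ?size_map.
Qed.

Lemma decode_adj (G : lgraph p n) sigma (i a c : 'I_n) :
  gadj (decode_graph (encode G sigma i)) a c = gadj G (sigma a) (sigma c).
Proof.
rewrite /= /dec_adj !nth_encode !nth_code_adj /= gadj_sym andbb.
by case: eqP => // ->; rewrite gadj_irr.
Qed.

Lemma decode_lab (G : lgraph p n) sigma (i a : 'I_n) j :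
  glab (decode_graph (encode G sigma i)) a j = glab G (sigma a) j.
Proof. by rewrite /= nth_encode nth_code_lab. Qed.

End Encoding.

(** The decoded graph is [G] relabelled along [sigma], so the invariance of [Q] applies. *)
Lemma query_decode (p n : nat) (Q : query p) (G : lgraph p n) sigma (i v : 'I_n) :
  is_query Q -> Q n (decode_graph p n (encode G sigma i)) v = Q n G (sigma v).
Proof.
move=> HQ; symmetry; apply: HQ; split=> [u c|u]; first by rewrite decode_adj.
by apply/funext => j; rewrite decode_lab.
Qed.

(** Decoding absorbs the order into the graph. The quantifiers over graphs and orders disappear, and
    a circuit has to search only over [n] and [i]. *)
Lemma L_leE (p : nat) (Q : query p) (w : seq bool) : is_query Q ->
  L_le Q w <-> exists n (i : 'I_n), w = encode (decode_graph p n w) 1%g i /\ Q n (decode_graph p n w) i.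
Proof.
move=> HQ; split=> [[n [G [sigma [i [-> Qi]]]]]|[n [i [we Qi]]]]; last first.
  by exists n, (decode_graph p n w), 1%g, i; split=> //; rewrite perm1.
exists n, i; split; last by rewrite query_decode.
rewrite [RHS]encodeE [LHS]encodeE; apply: eq_map => -[[b|ac]|aj] //=.
  by rewrite -[RHS]/(gadj (decode_graph p n (encode G sigma i)) _ _) decode_adj !perm1.
by rewrite -[RHS]/(glab (decode_graph p n (encode G sigma i)) _ _) decode_lab !perm1.
Qed.

Lemma tc_dec_adj (N s d p n : nat) (a c : 'I_n) : (1 < s)%N ->
  @tc N s d.+2 (fun w => gadj (decode_graph p n w) a c).
Proof.
move=> s1 /=; rewrite /dec_adj; case: (a != c) => /=; last exact: tc_cst.
by apply: tc_and => //; exact: tc_nth.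
Qed.

Lemma tc_code_val (N s d p n : nat) (x : code_bit p n) : (1 < s)%N ->
  @tc N s d.+2 (fun w => code_val (decode_graph p n w) 1%g x).
Proof.
move=> s1; case: x => [[b|ac]|aj]; first exact: tc_cst.
  exact: tc_dec_adj.
exact: tc_nth.
Qed.

Lemma tc_encode_eq (N s d p n : nat) (i : 'I_n) : (1 < s)%N -> (N <= s)%N ->
  code_size p n i = N ->
  @tc N s (6 + d) (fun w => tval w == encode (decode_graph p n w) 1%g i).
Proof.
move=> s1 Ns cN.
pose e (w : N.-tuple bool) (j : 'I_N) := code_val (decode_graph p n w) 1%g (nth (code_cst _ _ false) (graph_code p n i) j).
have h := @tc_forall N s (5 + d) 'I_N (fun j w => (tnth w j && e w j) || (~~ tnth w j && ~~ e w j)).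
rewrite card_ord in h; apply: tc_ext (h Ns _) => [w|j]; last first.
  apply: tc_or => //; apply: tc_and => //.
  - exact: tc_in.
  - exact: (@tc_code_val N s d.+1).
  - exact/tc_not/tc_in.
  - by apply: tc_not; exact: tc_code_val.
apply/forallP/eqP => [H|we j].
  apply: (@eq_from_nth _ false); first by rewrite size_tuple size_encode.
  move=> j; rewrite size_tuple => jN; rewrite nth_encode.
  by have := H (Ordinal jN); rewrite /e (tnth_nth false) /=; case: nth; case: code_val.
by rewrite /e -nth_encode (tnth_nth false) {1 3}we; case: nth.
Qed.

(** * From networks to circuits *)

Section DepthZero.
Variable R : realType.

(** Without edges every node is both a source and a sink, so inputs and outputs are both in
    bijection with the nodes. *)
Lemma fn_depth0 (m k : nat) (F : fnn R m k) : fn_depth F = 0%N -> m = k.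
Proof.
move=> F0.
have noE u v : ~~ fn_E F u v.
  apply/negP => /(node_depth_lt (@fn_topo _ _ _ F)).
  by have := node_depth_le (fn_E F) v; rewrite -/(fn_depth F) F0; case: (node_depth _ v).
have bij_card (j : nat) (f : 'I_j -> 'I_(fn_N F)) :
    injective f -> (forall v, exists i, f i = v) -> j = fn_N F.
  move=> fi fs; apply/eqP; rewrite eqn_leq; apply/andP; split.
    by rewrite -[X in (X <= _)%N]card_ord -[X in (_ <= X)%N]card_ord; exact: leq_card fi.
  have gP v := svalP (cid (fs v)).
  rewrite -[X in (X <= _)%N]card_ord -[X in (_ <= X)%N]card_ord.
  apply: (@leq_card _ _ (fun v => sval (cid (fs v)))) => u v uv.
  by rewrite -(gP u) -(gP v) uv.
rewrite (bij_card _ (fn_in F)); last 2 first.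
- exact: fn_in_inj.
- by move=> v; apply/fn_src => u.
symmetry; apply: (bij_card _ (fn_out F)); first exact: fn_out_inj.
by move=> v; apply/fn_snk => u.
Qed.

Lemma gnn_nlayers0 (pi po : nat) (Nn : gnn R pi po) : gnn_nlayers Nn = 0%N -> pi = po.
Proof. by case: Nn. Qed.

(** A layer of depth 0 has message dimension [2 * pi], hence output dimension [pi + 2 * pi + pi]. *)
Lemma gnn_maxdepth0 (pi po : nat) (Nn : gnn R pi po) :
  gnn_maxdepth Nn = 0%N -> (0 < gnn_nlayers Nn)%N -> (4 %| po)%N.
Proof.
elim: Nn => //= {}pi q {}po L {}Nn IH dd _.
have [md cd nd] : [/\ fn_depth (l_msg L) = 0, fn_depth (l_comb L) = 0 & gnn_maxdepth Nn = 0]%N.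
  by split; move: dd; clear; lia.
case: (posnP (gnn_nlayers Nn)) => [/gnn_nlayers0 <-|]; last exact: IH.
by have := fn_depth0 md; have := fn_depth0 cd; clear; lia.
Qed.

(* [gnn_depth] is a product, so it could hide many layers of depth 0; but those
   only copy their inputs and quadruple the dimension, which the output forbids. *)
Lemma gnn_layers_le_depth (pi : nat) (Nn : gnn R pi 1) :
  (gnn_nlayers Nn <= gnn_depth Nn)%N /\
  ((0 < gnn_nlayers Nn)%N -> (gnn_maxdepth Nn <= gnn_depth Nn)%N).
Proof.
rewrite /gnn_depth; case: (posnP (gnn_maxdepth Nn)) => [d0|d0]; last first.
  by split=> [|l0]; [exact: leq_pmulr|exact: leq_pmull].
case: (posnP (gnn_nlayers Nn)) => [-> //|l0].
by have := gnn_maxdepth0 d0 l0.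
Qed.

Lemma gnn_maxdepth_le (pi : nat) (Nn : gnn R pi 1) :
  (gnn_maxdepth Nn <= gnn_depth Nn)%N.
Proof.
have [_ h] := gnn_layers_le_depth Nn; case: (posnP (gnn_nlayers Nn)) => [|//].
by case: Nn {h}.
Qed.

End DepthZero.

(** * Circuit parameters and recognition of the language *)

Section GnnToCircuit.
Variables (R : realType) (p : nat) (Q : query p).
Variables (rd : nat -> nat) (Nn : forall n, gnn R (p + rd n) 1).
Variables (c d : nat).
Hypothesis weight_le : forall n, gnn_weight (Nn n) <= (n.+2 ^ c)%N%:R.
Hypothesis depth_le : forall n, (gnn_depth (Nn n) <= d)%N.
Hypothesis Ncomp : @ri_computes R p rd Nn Q.

(** The exponent [c.+1] makes this dominate not only the weights but also the orders [n <= N], even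
    if [c = 0]. *)
Definition sim_K (N : nat) := (N.+2 ^ c.+1)%N.
Definition sim_T := (d * (d * 2 + 1))%N.
Definition sim_C (N : nat) := ((4 * sim_K N ^ 3) ^ sim_T)%N.
(** The initial error [1/D] is amplified by at most [C] over the whole run, which leaves 1/8. *)
Definition sim_D (N : nat) := (8 * sim_C N)%N.
(** The main summands serve the look-up tables and sums, the majority over the samples, and the
    search over pairs [(n, i)]. *)
Definition sim_s (N : nat) :=
  (sim_K N * (2 * sim_C N * sim_D N) + 8 * (2 * N).+1 + N.+1 * N.+1 + sim_K N + 2)%N.
(** The last 4 levels turn the decoded labels into approximated reals. *)
Definition sim_depth := (d * (20 * d + 13) + 4)%N.

Section FixedLength.
Variable N : nat.
Local Notation W := (N.-tuple bool).
Local Notation s := (sim_s N).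
Local Notation K := (sim_K N).
Local Notation C := (sim_C N).
Local Notation D := (sim_D N).

Let K0 : (0 < K)%N. Proof. by rewrite /sim_K expn_gt0. Qed.
Let C0 : (0 < C)%N. Proof. by rewrite expn_gt0 muln_gt0 expn_gt0 K0. Qed.
Let D0 : (0 < D)%N. Proof. by rewrite muln_gt0. Qed.
Let s1 : (1 < s)%N. Proof. by rewrite /sim_s; lia. Qed.
Let Ks : (K < s)%N. Proof. by rewrite /sim_s; lia. Qed.
Let KMs : (K * (2 * C * D) < s)%N. Proof. by rewrite /sim_s; lia. Qed.

Lemma appr_ri_out (n : nat) (rho : 'I_n * 'I_(rd n) -> R) (v : 'I_n) :
  (n <= N)%N -> (forall u, 0 <= rho u <= 1) ->
  @appr R N s C D sim_depth (1 / 8) (fun w => ri_out (Nn n) (decode_graph p n w) rho v).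
Proof.
move=> nN rho01.
have nK : (n <= K)%N.
  by apply: (leq_trans nN); apply: leq_trans (_ : N.+2 ^ 1 <= _)%N; [lia|rewrite leq_exp2l].
have [lN _] := gnn_layers_le_depth (Nn n).
have ld := leq_trans lN (depth_le n).
have md := leq_trans (gnn_maxdepth_le (Nn n)) (depth_le n).
have wK : gnn_weight (Nn n) <= K%:R.
  apply: le_trans (weight_le n) _; rewrite ler_nat.
  apply: leq_trans (_ : n.+2 ^ c.+1 <= _)%N; first by rewrite leq_exp2l.
  by rewrite leq_exp2r.
have one_C : `|1 : R| <= C%:R by rewrite normr1 ler1n.
have zero_C : `|0 : R| <= C%:R by rewrite normr0.
have gE k : ((4 * K ^ 3)%N%:R : R) ^+ k = ((4 * K ^ 3) ^ k)%N%:R by rewrite natrX.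
have lT : (gnn_nlayers (Nn n) * (d * 2 + 1) <= sim_T)%N by rewrite leq_mul2r ld orbT.
have gT : ((4 * K ^ 3) ^ (gnn_nlayers (Nn n) * (d * 2 + 1)) <= C)%N.
  by rewrite leq_pexp2l// muln_gt0 expn_gt0 K0.
pose X (w : W) u : 'I_(p + rd n) -> R :=
  vcat (fun j => ((glab (decode_graph p n w) u j : nat)%:R : R)) (fun k => rho (u, k)).
have X1 u : (forall i, @appr R N s C D 4 D%:R^-1 (fun w => X w u i)) /\
    (forall w i, `|X w u i| <= 1).
  apply: appr_vcat => //= [j|w j|k|w k].
  - apply: (@appr_ext _ _ _ _ _ _ _ (fun w : W => if glab (decode_graph p n w) u j then 1 else 0)).
      by move=> w /=; case: nth.
    by apply: appr_bit => //; exact: tc_nth.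
  - by case: nth; rewrite ?normr1 ?normr0.
  - have /andP[r0 r1] := rho01 (u, k).
    by apply: appr_cst => //; apply: le_trans one_C; rewrite normr1 ger0_norm.
  - by have /andP[r0 r1] := rho01 (u, k); rewrite ger0_norm.
have := @appr_gnn R N s C D K s1 D0 K0 Ks KMs n (fun w => gadj (decode_graph p n w)) 1 nK _
  _ _ (Nn n) X 3 d D%:R^-1 1 isT wK md (lexx _) (lexx _) _ _ _ v ord0.
rewrite gE mulr1 => h; apply: appr_leq (h _ _ _ _).
- by rewrite /sim_depth leq_add2r leq_mul2r ld orbT.
- have D8 : (D%:R : R) = 8 * C%:R by rewrite natrM.
  rewrite D8 invfM mulrCA -[X in _ <= X]mulr1 mul1r ler_wpM2l ?invr_ge0//.
  by rewrite ler_pdivrMr ?ltr0n// mul1r ler_nat.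
- by move=> u u'; exact: tc_dec_adj.
- by rewrite ler_nat.
- by move=> u i; case: (X1 u).
- by move=> w u i; case: (X1 u).
Qed.

Lemma tc_ri_threshold (n : nat) (rho : 'I_n * 'I_(rd n) -> R) (v : 'I_n) :
  (n <= N)%N -> (forall u, 0 <= rho u <= 1) ->
  exists2 theta : W -> bool, tc s sim_depth theta & forall w : W,
    (3 / 4 <= ri_out (Nn n) (decode_graph p n w) rho v -> theta w) /\
    (ri_out (Nn n) (decode_graph p n w) rho v <= 1 / 4 -> ~~ theta w).
Proof.
move=> nN rho01; have [V [_ HV] VF] := appr_ri_out v nN rho01.
(* The cut is at 1/2: with error 1/8, the approximations of accepting and rejecting outputs stay at
   least 5/8 and at most 3/8. *)
have mid : grid_val R C D (C * D + 4 * C) = 1 / 2.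
  rewrite /grid_val natrD mulrDl natrM mulfK ?pnatr_eq0 -?lt0n//.
  have -> : (4 * C)%N%:R / D%:R = 1 / 2 :> R.
    by rewrite !natrM; field; rewrite pnatr_eq0 -lt0n C0.
  by ring.
exists (fun w => (C * D + 4 * C <= V w)%N); first exact: HV.
move=> w; have := VF w; set y := ri_out _ _ _ _; rewrite ler_norml => /andP[y1 y2].
split=> [y34|y14].
  rewrite leqNgt; apply/negP => /ltnW Vlt.
  by have := grid_val_le R C D Vlt; rewrite mid; lra.
apply/negP => Vge.
by have := grid_val_le R C D Vge; rewrite mid; lra.
Qed.

Lemma tc_query (n : nat) (v : 'I_n) : (n <= N)%N ->
  tc s sim_depth.+1 (fun w : W => Q (decode_graph p n w) v).
Proof.
move=> nN.
(* The event of a correct run is defined for every word, code or not, because decoding is total; the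
   samples then serve all words of length [N]. *)
pose A (w : W) (rho : 'I_n * 'I_(rd n) -> R) : Prop :=
  if Q (decode_graph p n w) v then 3 / 4 <= ri_out (Nn n) (decode_graph p n w) rho v
  else ri_out (Nn n) (decode_graph p n w) rho v <= 1 / 4.
have A34 w : ((3 / 4)%:E <= unif_prob (A w))%E.
  have [h1 h2] := Ncomp (decode_graph p n w) v; rewrite /A.
  by case E: (Q _ v); [exact: h1|apply: h2; rewrite E].
have card : (#|{: W}| <= 2 ^ (2 * N))%N.
  by rewrite card_tuple card_bool leq_exp2l// leq_pmull.
have [rho [rho01 maj]] := derandomize card A34.
have ex t : exists theta : W -> bool, tc s sim_depth theta /\ forall w : W,
    (3 / 4 <= ri_out (Nn n) (decode_graph p n w) (rho t) v -> theta w) /\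
    (ri_out (Nn n) (decode_graph p n w) (rho t) v <= 1 / 4 -> ~~ theta w).
  by have [theta h1 h2] := tc_ri_threshold v nN (rho01 t); exists theta.
have {ex} /boolp.choice[theta Htheta] := ex.
have cs : (#|'I_(8 * (2 * N).+1)| <= s)%N by rewrite card_ord /sim_s; lia.
apply: tc_ext (tc_count (4 * (2 * N).+1).+1 cs (fun t => (Htheta t).1)) => w.
have := maj w; rewrite /A; set k := (4 * _)%N; set a := (\sum_t _)%N => ka.
case E: (Q _ v).
  apply: leq_trans ka _; apply: leq_sum => t _; rewrite E.
  by case: asboolP => // h; rewrite ((Htheta t).2 w).1.
apply/negbTE; rewrite -leqNgt; set b := (\sum_t _)%N.
suff ab : (a + b <= 8 * (2 * N).+1)%N by move: ka ab; rewrite /k; clear; lia.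
rewrite -big_split /= -[leqRHS]card_ord -sum1_card; apply: leq_sum => t _; rewrite E.
case: asboolP => [h|_]; last by case: (theta t w).
by rewrite (negbTE (((Htheta t).2 w).2 h)).
Qed.

Lemma tc_language (HQ : is_query Q) :
  tc s (sim_depth + 9) (fun w : W => `[< L_le Q w >]).
Proof.
(* Orders up to [N] suffice, since a code word is at least as long as the order of its graph. *)
pose ok (x : {n : 'I_N.+1 & 'I_n}) (w : W) : bool :=
  (code_size p (tag x) (tagged x) == N) &&
  ((tval w == encode (decode_graph p (tag x) w) 1%g (tagged x)) && Q (decode_graph p (tag x) w) (tagged x)).
have tok x : tc s (sim_depth + 8) (ok x).
  rewrite /ok; case: eqP => [cN|_] /=; last by rewrite addnS; exact: tc_cst.
  rewrite addnS; apply: tc_and => //.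
    apply: (@tc_leq _ _ (6 + sim_depth)); first by clear; lia.
    by apply: tc_encode_eq => //; rewrite /sim_s; lia.
  apply: (@tc_leq _ _ sim_depth.+1); first by clear; lia.
  by apply: tc_query; rewrite -ltnS.
have cs : (#|{: {n : 'I_N.+1 & 'I_n}}| <= s)%N.
  rewrite card_tagged sumnE big_map big_enum /=.
  apply: leq_trans (_ : \sum_(i : 'I_N.+1) N.+1 <= _)%N.
    by apply: leq_sum => i _; rewrite card_ord ltnW.
  by rewrite sum_nat_const card_ord /sim_s; lia.
rewrite addnS; apply: tc_ext (tc_exists cs tok) => w.
apply/existsP/asboolP => [[[n i] /andP[_ /andP[/eqP we Qi]]]|/(L_leE _ HQ)[n [i [we Qi]]]].
  by apply/L_leE => //; exists n, i.
have cN : code_size p n i = N by rewrite -(size_encode (decode_graph p n w) 1%g) -we size_tuple.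
have nN : (n < N.+1)%N by rewrite ltnS -cN leq_code_size.
exists (Tagged (fun n : 'I_N.+1 => 'I_n) (i : 'I_(Ordinal nN))).
by rewrite /ok /= cN eqxx /= -we eqxx.
Qed.

End FixedLength.

Lemma polyb_sim_s : polyb sim_s.
Proof.
have pK : polyb sim_K.
  apply: polybX; apply: (@polyb_le _ (fun n => n + 2)%N) => [n|]; first by lia.
  by apply: polybD; [exact: polyb_id|exact: polyb_cst].
have pC : polyb sim_C by apply/polybX/polybM; [exact: polyb_cst|exact: polybX].
have pD : polyb sim_D by apply: polybM => //; exact: polyb_cst.
have pN : polyb S.
  by apply: (@polyb_le _ (fun n => n + 1)%N) => [n|]; [lia|apply: polybD; [exact: polyb_id|exact: polyb_cst]].
rewrite /sim_s; apply: polybD; last exact: polyb_cst.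
apply: polybD => //; apply: polybD; last exact: polybM.
apply: polybD.
  by apply: polybM => //; apply: polybM => //; apply: polybM => //; exact: polyb_cst.
apply: polybM; first exact: polyb_cst.
apply: (@polyb_le _ (fun n => 2 * n + 1)%N) => [n|]; first by lia.
by apply: polybD; [apply: polybM; [exact: polyb_cst|exact: polyb_id]|exact: polyb_cst].
Qed.

Lemma gnn_query_in_TC0 : is_query Q -> in_TC0 Q.
Proof.
move=> HQ.
have ex N : exists C : circuit N, [/\ (c_wsize C <= (sim_s N).+1 ^ (sim_depth + 9).+1)%N,
    (c_depth C <= sim_depth + 9)%N &
    forall w : N.-tuple bool, c_eval C w = `[< L_le Q w >]].
  by apply: circuit_of_tc; [rewrite /sim_s addn2|exact: tc_language].
pose C N := sval (cid (ex N)).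
have CP N : [/\ (c_wsize (C N) <= (sim_s N).+1 ^ (sim_depth + 9).+1)%N,
    (c_depth (C N) <= sim_depth + 9)%N &
    forall w : N.-tuple bool, c_eval (C N) w = `[< L_le Q w >]] := svalP (cid (ex N)).
exists C; split; last split.
- have ps : polyb (fun N => (sim_s N).+1 ^ (sim_depth + 9).+1)%N.
    apply: polybX; apply: (@polyb_le _ (fun N => sim_s N + 1)%N) => [n|]; first by rewrite addn1.
    by apply: polybD; [exact: polyb_sim_s|exact: polyb_cst].
  have [P HP] := polyb_intpoly ps; exists P => N; apply: le_trans (HP N).
  by rewrite lez_nat; case: (CP N).
- by exists (sim_depth + 9)%N => N; case: (CP N).
- move=> w; have [_ _ h] := CP (size w); have := h (in_tuple w); rewrite /= => ->.
  by split=> [/asboolP|/asboolP].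
Qed.

End GnnToCircuit.

Lemma gnn_ri_computable_in_TC0 (R : realType) (p : nat) (Q : query p) :
  is_query Q -> gnn_ri_computable R Q -> in_TC0 Q.
Proof.
move=> HQ [rd [Nn [[P HP] [[d Hd] [_ Hc]]]]].
have [f [c fc] Pf] := polyb_horner P.
apply: (@gnn_query_in_TC0 R p Q rd Nn c d) => // n.
by apply: le_trans (HP n) (le_trans (Pf n) _); rewrite ler_nat.
Qed.

(** * Networks with Boolean states *)

Section DenseFnn.
Variables (R : realType) (m k : nat).
Variables (Wt : 'I_k -> 'I_m -> R) (b : 'I_k -> R) (act : 'I_k -> R -> R).
Hypothesis m0 : (0 < m)%N.
Hypothesis k0 : (0 < k)%N.
Hypothesis actL : forall j, lipschitz_with R 1 (act j).

(** All edges are present, possibly with weight 0, because the sources must be exactly the inputs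
    and the sinks exactly the outputs. This also forces both dimensions to be positive. *)
Let E : rel 'I_(m + k) := fun u v => (u < m)%N && (m <= v)%N.
Let w (u v : 'I_(m + k)) : R :=
  match fintype.split v, fintype.split u with inr j, inl i => Wt j i | _, _ => 0 end.
Let bias (v : 'I_(m + k)) : R :=
  match fintype.split v with inr j => b j | inl _ => 0 end.
Let a (v : 'I_(m + k)) : R -> R :=
  match fintype.split v with inr j => act j | inl _ => id end.

Lemma dense_topo u v : E u v -> (u < v)%N.
Proof. by case/andP => um; exact: leq_trans. Qed.

Lemma dense_src v : (forall u, ~~ E u v) <-> (exists i, lshift k i = v).
Proof.
split=> [h|[i <-] u]; last by rewrite /E /= [(m <= i)%N]leqNgt ltn_ord andbF.
have [vm|mv] := ltnP v m; first by exists (Ordinal vm); exact: val_inj.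
by have := h (lshift k (Ordinal m0)); rewrite /E /= m0 mv.
Qed.

Lemma dense_snk v : (forall u, ~~ E v u) <-> (exists j, rshift m j = v).
Proof.
split=> [h|[i <-] u]; last by rewrite /E /= ltnNge leq_addr.
have [vm|mv] := ltnP v m.
  by have := h (rshift m (Ordinal k0)); rewrite /E /= leq_addr vm.
have vk : (v - m < k)%N by rewrite ltn_subLR.
by exists (Ordinal vk); apply: val_inj; rewrite /= subnKC.
Qed.

Lemma dense_lip v : (exists u, E u v) -> is_lipschitz R (a v).
Proof.
by rewrite /a; case: fintype.split => [_ _|j _]; exists 1 => // x y; rewrite mul1r.
Qed.

Definition dense : fnn R m k :=
  @FNN R m k (m + k) E w bias a (@lshift m k) (@rshift m k) dense_topo
    (@lshift_inj m k) (@rshift_inj m k) dense_src dense_snk dense_lip.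

Lemma dense_isrc j : ~~ fn_is_src dense (rshift m j).
Proof.
apply/negP => /fn_srcP[i] /(congr1 val) /= e.
by have := ltn_ord i; rewrite e ltnNge leq_addr.
Qed.

Lemma dense_eval x j : fn_eval dense x j = act j (b j + \sum_i Wt j i * x i).
Proof.
have splitl i : fintype.split (lshift k i) = inl i by exact: (unsplitK (inl i)).
have splitr i : fintype.split (rshift m i) = inr i by exact: (unsplitK (inr i)).
rewrite /fn_eval fn_vals_act ?dense_isrc//= /a /bias splitr; congr (act _ (_ + _)).
rewrite big_split_ord /= [X in _ + X]big_pred0 ?addr0 => [|i]; last first.
  by rewrite /E /= ltnNge leq_addr.
apply: eq_big => [i|i _]; first by rewrite /E /= ltn_ord leq_addr.
by rewrite /w splitr splitl -[lshift k i]/(fn_in dense i) fn_vals_in.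
Qed.

Lemma dense_depth : (fn_depth dense <= 1)%N.
Proof.
apply: (@dag_depth_le _ _ (fun v => (m <= v)%N : nat)) => [u v|v]; last exact: leq_b1.
by case/andP => um ->; rewrite [(m <= u)%N]leqNgt um.
Qed.

Lemma dense_acts f : f \in fn_acts dense -> exists j, f = act j.
Proof.
move=> /mapP[v]; rewrite mem_filter => /andP[hv _] ->.
rewrite /= /a; case: splitP => [i vi|j _]; last by exists j.
by case/fn_srcP: hv; exists i; apply: val_inj.
Qed.

Lemma lipn_le1 (f : R -> R) : lipschitz_with R 1 f -> (lipn R f <= 1)%N.
Proof.
move=> fL; rewrite /lipn; case: pselect => // h.
by case: ex_minnP => l _; apply; apply/asboolP.
Qed.

Lemma bigmax_le_nneg (I : finType) (P : pred I) (F : I -> R) (x : R) : 0 <= x ->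
  (forall i, P i -> F i <= x) -> \big[Num.max/0]_(i | P i) F i <= x.
Proof. by move=> x0 Fx; elim/big_ind: _ => // y z yx zx; rewrite ge_max yx. Qed.

Lemma dense_weight (B : nat) : (forall j i, `|Wt j i| <= B%:R) ->
  (forall j, `|b j| <= B%:R) -> (forall j, act j 0 = 0) ->
  fn_weight dense <= ((m + k) + (m + k) * (m + k) + 2 * B + 1)%N%:R.
Proof.
move=> WB bB a0; rewrite /fn_weight.
have -> : ((m + k) + (m + k) * (m + k) + 2 * B + 1)%N%:R =
    ((m + k) + (m + k) * (m + k))%N%:R + B%:R + B%:R + 1 :> R.
  by rewrite !natrD !natrM; ring.
do 3?apply: lerD.
- rewrite ler_nat leq_add2l; apply: leq_trans (max_card _) _.
  by rewrite card_prod !card_ord.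
- apply: bigmax_le_nneg => // e _ /=; rewrite /w.
  by case: fintype.split => [_|j]; [|case: fintype.split => i]; rewrite ?normr0.
- apply: bigmax_le_nneg => // v _ /=; rewrite /bias.
  by case: fintype.split => [_|j]; rewrite ?normr0.
- apply: bigmax_le_nneg => // v hv /=.
  have [j ->] : exists j, a v = act j.
    rewrite /a; case: splitP => [i vi|j _]; last by exists j.
    by case/fn_srcP: hv; exists i; apply: val_inj.
  by rewrite a0 normr0 addr0 -[X in _ <= X]/(1%:R) ler_nat; exact: lipn_le1.
Qed.

End DenseFnn.

Section DenseLayer.
Variables (R : realType) (pi po : nat).
Variables (W1 W2 W3 : 'I_po -> 'I_pi -> R) (b : 'I_po -> R) (act : 'I_po -> R -> R).
Hypothesis pi0 : (0 < pi)%N.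
Hypothesis po0 : (0 < po)%N.
Hypothesis actL : forall j, lipschitz_with R 1 (act j).

Let pp0 : (0 < pi + pi)%N. Proof. by rewrite addn_gt0 pi0. Qed.
Let ppp0 : (0 < pi + pi + pi)%N. Proof. by rewrite addn_gt0 pp0. Qed.

(** The message is the sender's state, so the aggregate is the sum of the states of the
    neighbours. *)
Let msgW (j : 'I_pi) (i : 'I_(pi + pi)) : R :=
  match fintype.split i with inl _ => 0 | inr i' => (i' == j)%:R end.
Let combW (j : 'I_po) (i : 'I_(pi + pi + pi)) : R :=
  match fintype.split i with
  | inl i' => match fintype.split i' with inl i'' => W1 j i'' | inr i'' => W2 j i'' end
  | inr i' => W3 j i'
  end.

Lemma id_lip : lipschitz_with R 1 id.
Proof. by move=> x y; rewrite mul1r. Qed.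

Definition dlayer : layer R pi po :=
  @Layer R pi po pi (dense msgW (fun=> 0) pp0 pi0 (fun=> id_lip))
    (dense combW b ppp0 po0 actL) ASum ASum.

Lemma dlayer_eval n (adj : rel 'I_n) (x : 'I_n -> 'I_pi -> R) v j :
  layer_eval dlayer adj x v j = act j (b j + (\sum_i W1 j i * x v i +
    \sum_i W2 j i * (\sum_(u | adj v u) x u i) + \sum_i W3 j i * (\sum_u x u i))).
Proof.
have splitl m k i : fintype.split (@lshift m k i) = inl i by exact: (unsplitK (inl i)).
have splitr m k i : fintype.split (@rshift m k i) = inr i by exact: (unsplitK (inr i)).
rewrite /layer_eval /= dense_eval; congr (act _ (_ + _)).
rewrite !big_split_ord /=; congr (_ + _ + _); apply: eq_bigr => i _;
  rewrite /combW /vcat ?(splitl, splitr) //; congr (_ * _).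
- rewrite /aggregate big_map big_filter big_enum_cond /=; apply: eq_bigr => u _.
  rewrite dense_eval add0r big_split_ord /= big1 ?add0r => [|i' _]; last first.
    by rewrite /msgW splitl mul0r.
  rewrite (bigD1 i)//= big1 ?addr0 => [|i' i'i]; last first.
    by rewrite /msgW splitr (negbTE i'i) mul0r.
  by rewrite /msgW !splitr eqxx mul1r.
- by rewrite /aggregate big_map big_enum.
Qed.

Lemma dlayer_depth :
  (maxn (fn_depth (l_msg dlayer)) (fn_depth (l_comb dlayer)) <= 1)%N.
Proof. by rewrite geq_max !dense_depth. Qed.

Lemma dlayer_acts f : f \in fn_acts (l_msg dlayer) ++ fn_acts (l_comb dlayer) ->
  f = id \/ exists j, f = act j.
Proof.
by rewrite mem_cat => /orP[/dense_acts[_ ->]|/dense_acts[j ->]]; [left|right; exists j].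
Qed.

Lemma dlayer_weight (B : nat) : (0 < B)%N ->
  (forall j i, `|W1 j i| <= B%:R) -> (forall j i, `|W2 j i| <= B%:R) ->
  (forall j i, `|W3 j i| <= B%:R) -> (forall j, `|b j| <= B%:R) ->
  (forall j, act j 0 = 0) ->
  fn_weight (l_msg dlayer) + fn_weight (l_comb dlayer) <=
    (100 * ((pi + po + B) * (pi + po + B)))%N%:R.
Proof.
move=> B0 B1 B2 B3 bB a0.
have h1 : fn_weight (l_msg dlayer) <= _ := @dense_weight _ _ _ _ _ _ pp0 pi0 (fun=> id_lip) 1 _ _ _.
have h2 : fn_weight (l_comb dlayer) <= _ := @dense_weight _ _ _ _ _ _ ppp0 po0 actL B _ bB a0.
apply: le_trans (lerD (h1 _ _ _) (h2 _)) _ => [j i|j|j|j i|].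
- rewrite /msgW; case: fintype.split => i'; rewrite ?normr0//.
  by case: eqP; rewrite ?normr1 ?normr0.
- by rewrite normr0.
- by [].
- rewrite /combW; case: fintype.split => i' //.
  by case: fintype.split.
- by rewrite -natrD ler_nat; move: B0 pi0 po0; clear; nia.
Qed.

End DenseLayer.

Section ClampedActivation.
Variable R : realType.

Definition clamp (x : R) : R := Num.max 0 (Num.min 1 x).

Lemma clamp_lip : lipschitz_with R 1 clamp.
Proof.
move=> x y; rewrite mul1r /clamp.
have hx : `|x - y| >= x - y by exact: ler_norm.
have hy : `|x - y| >= y - x by rewrite distrC ler_norm.
rewrite /Num.max /Num.min; rewrite ler_norml.
have [x1|x1] := ltP 1 x; have [y1|y1] := ltP 1 y; rewrite ?ltr01;
  have [x0|x0] := ltP 0 x; have [y0|y0] := ltP 0 y; apply/andP; split; lra.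
Qed.

Lemma clamp_ge1 x : 1 <= x -> clamp x = 1.
Proof. by move=> x1; rewrite /clamp (min_idPl x1); apply/max_idPr. Qed.

Lemma clamp_le0 x : x <= 0 -> clamp x = 0.
Proof. by move=> x0; rewrite /clamp (min_idPr _) ?(max_idPl _)//; lra. Qed.

(** The ramp of [clamp] lies between the consecutive integers [t - 1] and [t], so on integers the
    comparison is exact. *)
Lemma clamp_int (z t : int) : clamp (1 - t + z)%:~R = (t <= z)%R%:R.
Proof.
case: leP => tz; first by rewrite clamp_ge1// -[1]/(1%:~R) ler_int; lia.
by rewrite clamp_le0// -[0]/(0%:~R) ler_int; lia.
Qed.

Definition id_plin : plin := PLin [::] [:: (1, 0%N)] [:: (0, 0%N)].
Definition clamp_plin : plin :=
  PLin [:: (0, 0%N); (1, 0%N)] [:: (0, 0%N); (1, 0%N); (0, 0%N)]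
    [:: (0, 0%N); (0, 0%N); (1, 0%N)].

Lemma plin_wf_id : plin_wf R id_plin. Proof. by []. Qed.

Lemma plin_wf_clamp : plin_wf R clamp_plin.
Proof. by split=> //=; rewrite /dval /= !divr1 ltr01. Qed.

Lemma plin_eval_id (x : R) : plin_eval R id_plin x = x.
Proof. by rewrite /plin_eval /= /dval /= !divr1 mul1r addr0. Qed.

Lemma plin_eval_clamp (x : R) : plin_eval R clamp_plin x = clamp x.
Proof.
have dv (z : int) : dval R (z, 0%N) = z%:~R by rewrite /dval /= expr0 divr1.
rewrite /plin_eval /= !dv /clamp.
have [x0|x0] := leP 0 x; have [x1|x1] := leP 1 x; rewrite /= !dv.
- by rewrite mul0r add0r; apply/esym/max_idPr.
- by rewrite mul1r addr0; apply/esym/max_idPr.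
- lra.
- by rewrite mul0r add0r; apply/esym/max_idPl/ltW.
Qed.

Lemma eps_approx_refl (f : R -> R) (eps : R) : 0 < eps -> eps_approx R eps f f.
Proof.
by move=> e0 x; rewrite subrr normr0 addr_ge0 ?mulr_ge0// ltW.
Qed.

End ClampedActivation.

Section LinearCombination.
Variable S : finType.
Implicit Types (c : S -> int) (x : S -> int).

Definition lcomb c x : int := \sum_a c a * x a.
Definition ind (s : S) : S -> int := fun a => (a == s)%:Z.

Lemma lcomb_ind s x : lcomb (ind s) x = x s.
Proof.
rewrite /lcomb (bigD1 s)//= /ind eqxx mul1r big1 ?addr0// => a /negbTE ->.
by rewrite mul0r.
Qed.

Lemma lcombD c1 c2 x : lcomb (fun a => c1 a + c2 a) x = lcomb c1 x + lcomb c2 x.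
Proof. by rewrite /lcomb -big_split; apply: eq_bigr => a _; rewrite mulrDl. Qed.

Lemma lcombB c1 c2 x : lcomb (fun a => c1 a - c2 a) x = lcomb c1 x - lcomb c2 x.
Proof. by rewrite /lcomb -sumrB; apply: eq_bigr => a _; rewrite mulrBl. Qed.

Lemma lcombZ k c x : lcomb (fun a => k * c a) x = k * lcomb c x.
Proof. by rewrite /lcomb mulr_sumr; apply: eq_bigr => a _; rewrite mulrA. Qed.

Lemma lcomb0 x : lcomb (fun=> 0) x = 0.
Proof. by rewrite /lcomb big1// => a _; rewrite mul0r. Qed.

Lemma lcomb_sum (I : finType) (c : I -> S -> int) x :
  lcomb (fun a => \sum_i c i a) x = \sum_i lcomb (c i) x.
Proof. by rewrite /lcomb exchange_big; apply: eq_bigr => a _; rewrite mulr_suml. Qed.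

Lemma lcomb_count (s : seq S) x : lcomb (fun a => (count_mem a s)%:Z) x = \sum_(a <- s) x a.
Proof.
elim: s => [|b s IH]; first by rewrite big_nil lcomb0.
rewrite big_cons -IH -(lcomb_ind b) -lcombD; congr lcomb; apply/funext => a /=.
by rewrite PoszD /ind eq_sym.
Qed.

End LinearCombination.

(** The coefficients apply to the vertex's own bits, to the counts over its neighbours and to the
    counts over all vertices; [bthr] is the threshold of the resulting integer. *)
Record bspec (S T : finType) := BSpec {
  bs1 : T -> S -> int;
  bs2 : T -> S -> int;
  bs3 : T -> S -> int;
  bthr : T -> int
}.

Definition bspec_le (S T : finType) (L : bspec S T) (B : nat) :=
  forall t, [/\ forall a, `|bs1 L t a| <= B%:Z, forall a, `|bs2 L t a| <= B%:Z,
    forall a, `|bs3 L t a| <= B%:Z & `|1 - bthr L t| <= B%:Z].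

Definition bstep (S T : finType) (L : bspec S T) (n : nat) (adj : rel 'I_n)
    (beta : 'I_n -> S -> bool) (v : 'I_n) (t : T) : bool :=
  bthr L t <= lcomb (bs1 L t) (fun a => (beta v a : nat)%:Z) +
    lcomb (bs2 L t) (fun a => (\sum_(u | adj v u) (beta u a : nat))%N%:Z) +
    lcomb (bs3 L t) (fun a => (\sum_u (beta u a : nat))%N%:Z).

Definition brepr (R : realType) (S : finType) (m n : nat) (dS : 'I_m -> S)
    (x : 'I_n -> 'I_m -> R) (beta : 'I_n -> S -> bool) :=
  forall v i, x v i = (beta v (dS i) : nat)%:R.

Section BooleanLayer.
Variables (R : realType) (S T : finType) (pi po : nat).
Variables (dS : 'I_pi -> S) (dT : 'I_po -> T).
Hypothesis dS_bij : bijective dS.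
Hypothesis pi0 : (0 < pi)%N.
Hypothesis po0 : (0 < po)%N.
Variable L : bspec S T.

Definition blayer : layer R pi po :=
  @dlayer R pi po (fun j i => (bs1 L (dT j) (dS i))%:~R)
    (fun j i => (bs2 L (dT j) (dS i))%:~R) (fun j i => (bs3 L (dT j) (dS i))%:~R)
    (fun j => (1 - bthr L (dT j))%:~R) (fun=> @clamp R) pi0 po0 (fun=> @clamp_lip R).

Lemma blayer_step n (adj : rel 'I_n) (x : 'I_n -> 'I_pi -> R) beta :
  brepr dS x beta -> brepr dT (layer_eval blayer adj x) (bstep L adj beta).
Proof.
move=> xb v j; rewrite dlayer_eval.
have lcE (c : S -> int) (y : S -> int) :
    \sum_i (c (dS i))%:~R * (y (dS i))%:~R = (lcomb c y)%:~R :> R.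
  rewrite /lcomb (reindex dS) /=; last exact: onW_bij.
  by rewrite rmorph_sum /=; apply: eq_bigr => i _; rewrite rmorphM.
rewrite (eq_bigr (fun i => (bs1 L (dT j) (dS i))%:~R * ((beta v (dS i) : nat)%:Z)%:~R)) => [|i _]; last first.
  by rewrite xb.
rewrite (lcE _ (fun a => (beta v a : nat)%:Z)).
rewrite [X in _ + X + _](eq_bigr (fun i => (bs2 L (dT j) (dS i))%:~R *
    ((\sum_(u | adj v u) (beta u (dS i) : nat))%N%:Z)%:~R)) => [|i _]; last first.
  congr (_ * _); rewrite -pmulrn natr_sum; apply: eq_bigr => u _; exact: xb.
rewrite (lcE _ (fun a => (\sum_(u | adj v u) (beta u a : nat))%N%:Z)).
rewrite [X in _ + (_ + X)](eq_bigr (fun i => (bs3 L (dT j) (dS i))%:~R *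
    ((\sum_u (beta u (dS i) : nat))%N%:Z)%:~R)) => [|i _]; last first.
  congr (_ * _); rewrite -pmulrn natr_sum; apply: eq_bigr => u _; exact: xb.
rewrite (lcE _ (fun a => (\sum_u (beta u a : nat))%N%:Z)).
by rewrite -!rmorphD /= clamp_int.
Qed.

Lemma blayer_weight (B : nat) : (0 < B)%N -> bspec_le L B ->
  fn_weight (l_msg blayer) + fn_weight (l_comb blayer) <=
    (100 * ((pi + po + B) * (pi + po + B)))%N%:R.
Proof.
move=> B0 LB.
have toR (z : int) : `|z| <= B%:Z -> `|z%:~R| <= B%:R :> R.
  by move=> zB; rewrite -intr_norm pmulrn ler_int.
by apply: dlayer_weight => // [j i|j i|j i|j|_]; try (apply: toR; case: (LB (dT j))); rewrite ?clamp_le0.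
Qed.

Lemma blayer_acts f : f \in fn_acts (l_msg blayer) ++ fn_acts (l_comb blayer) ->
  f = id \/ f = @clamp R.
Proof. by move/dlayer_acts => [->|[j ->]]; [left|right]. Qed.

End BooleanLayer.

(** * Random buckets *)

Lemma bernoulli_ineq (R : realDomainType) (x : R) (k : nat) : 0 <= x <= 1 ->
  1 - x *+ k <= (1 - x) ^+ k.
Proof.
move=> /andP[x0 x1]; elim: k => [|k IH]; first by rewrite subr0.
have x1' : 0 <= 1 - x by lra.
rewrite exprS; apply: le_trans (ler_wpM2l x1' IH).
have : 0 <= x * (x *+ k) by rewrite mulr_ge0// mulrn_wge0.
by rewrite mulrS; set y := x *+ k; lra.
Qed.

Section Buckets.
Variables (R : realType) (T : finType).
Local Notation n := #|T|.
Local Notation M := (16 * n * n)%N.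
Hypothesis n0 : (0 < n)%N.

(* The j-th of the M equal subintervals of [0,1], shrunk a little on the left so that
   a piecewise linear function of slope 16nM separates consecutive cores. *)
Definition core (j : nat) (x : R) : bool :=
  (16 * n * j + 1)%N%:R <= (16 * n * M)%N%:R * x <= (16 * n * j.+1)%N%:R.

Let m : R := (16 * n * M)%N%:R.
Let m0 : 0 < m. Proof. by rewrite ltr0n !muln_gt0 n0. Qed.

Lemma core_itv j x : core j x =
  ((16 * n * j + 1)%N%:R / m <= x <= (16 * n * j.+1)%N%:R / m).
Proof. by rewrite /core ler_pdivrMr// ler_pdivlMr// mulrC. Qed.

Lemma core_inj j k x : core j x -> core k x -> j = k.
Proof.
move=> /andP[j1 j2] /andP[k1 k2].
have := le_trans j1 k2; have := le_trans k1 j2; rewrite !ler_nat => kj jk.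
have nn : (0 < 16 * n)%N by rewrite muln_gt0.
have {}kj : (16 * n * k < 16 * n * j.+1)%N by rewrite -addn1.
have {}jk : (16 * n * j < 16 * n * k.+1)%N by rewrite -addn1.
by rewrite !ltn_pmul2l// in kj jk; lia.
Qed.

Let len : R := (16 * n - 1)%N%:R / m.

Lemma core_unit (j : nat) x : (j < M)%N -> core j x -> 0 <= x <= 1.
Proof.
move=> jM; rewrite core_itv => /andP[x1 x2]; apply/andP; split.
  by apply: le_trans x1; rewrite divr_ge0// ltW.
apply: (le_trans x2); rewrite ler_pdivrMr// mul1r ler_nat.
by rewrite leq_mul2l jM orbT.
Qed.

Lemma lebesgue_core (j : nat) : (j < M)%N ->
  (\int[@lebesgue_measure R]_(x in `[0%R, 1%R]%classic) (core j x : nat)%:R%:E = len%:E)%E.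
Proof.
move=> jM; set I := Interval (BLeft ((16 * n * j + 1)%N%:R / m)) (BRight ((16 * n * j.+1)%N%:R / m)).
have coreE x : (core j x : nat)%:R = \1_([set` I]%classic) x :> R.
  rewrite indicE mem_setE /I /=; congr (_ : nat)%:R; rewrite core_itv.
  by rewrite in_itv.
under eq_integral do rewrite coreE.
rewrite integral_indic//=.
rewrite (_ : (_ `&` _)%classic = [set` I]%classic); last first.
  apply/seteqP; split => x /=; first by case.
  move=> xI; split=> //; rewrite in_itv /=; apply: (@core_unit j) => //.
  by rewrite core_itv; move: xI; rewrite /I in_itv.
have lohi : (16 * n * j + 1 < 16 * n * j.+1)%N.
  by rewrite mulnS addnC ltn_add2r; move: n0; clear; lia.
rewrite lebesgue_measure_itv /= lte_fin ltr_pM2r ?invr_gt0// ltr_nat lohi.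
rewrite -EFinB -mulrBl -natrB; last exact: ltnW.
by congr ((_ %:R / m)%:E); rewrite mulnS addnC subnDl.
Qed.

Let q : R := 1 - (8 * n)%N%:R^-1.

Let n1 : 1 <= n%:R :> R. Proof. by rewrite ler1n. Qed.

Let nV : 0 < n%:R^-1 :> R. Proof. by rewrite invr_gt0 ltr0n. Qed.

Let q_ge0 : 0 <= q.
Proof.
rewrite /q natrM invfM subr_ge0; have : n%:R^-1 <= 1 :> R by rewrite invf_le1 ?ltr0n.
by move: nV; lra.
Qed.

(** Avoiding at most [n] of [16 n^2] buckets costs a fraction [1/(16n)], the shrinking of the
    buckets another one, and [(1 - 1/(16n))^2 >= 1 - 1/(8n)]. *)
Lemma q_le (k : nat) : (k <= n)%N -> q <= (M - k)%N%:R * len.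
Proof.
move=> kn; apply: le_trans (_ : (M - n)%N%:R * len <= _); last first.
  rewrite ler_wpM2r ?ler_nat ?leq_sub2l//.
  by rewrite /len divr_ge0// ltW.
rewrite /q /len /m !natrB ?natrM; last 2 first.
- by move: n0; lia.
- by rewrite leq_pmull// muln_gt0.
set y := n%:R; have y0 : y != 0 :> R by rewrite pnatr_eq0 -lt0n.
have -> : (16 * y * y - y) * ((16 * y - 1) / (16 * y * (16 * y * y))) =
    1 - (8 * y)^-1 + (16 * y)^-1 ^+ 2 by field.
by rewrite lerDl exprn_ge0// invr_ge0 mulr_ge0.
Qed.

(** The numbers are drawn one after the other; whatever buckets are in [used], the next number falls
    into the core of a fresh one with probability at least [q]. *)
Lemma iprob_distinct (s : seq T) (used : {set 'I_M}) (A : (T -> R) -> Prop) :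
  uniq s -> (#|used| + size s <= n)%N ->
  (forall (h : T -> R) (b : T -> 'I_M), {in s &, injective b} ->
     (forall t, t \in s -> b t \notin used /\ core (b t) (h t)) -> A h) ->
  ((q ^+ size s)%:E <= @iprob R T s A)%E.
Proof.
elim: s used A => [|t s IH] used A us cn HA.
  rewrite expr0 /=; case: asboolP => // -[].
  have [t _] : exists t : T, true by case/card_gt0P: n0 => t _; exists t.
  have M0 : (0 < M)%N by rewrite !muln_gt0 n0.
  by apply: (HA _ (fun=> Ordinal M0)).
case/andP: us => ts us; rewrite /= addnS in cn.
have c0 : 0 <= q ^+ size s by rewrite exprn_ge0.
(* The integrand is bounded below by a sum of multiples of core indicators; the cores are disjoint,
   so at most one term is nonzero. *)
rewrite iprob_cons; apply: (@le_trans _ _ (\int[@lebesgue_measure R]_(x in `[0%R, 1%R]%classic)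
    (\sum_(j <- enum [pred j | j \notin used]) (q ^+ size s)%:E * (core j x : nat)%:R%:E))%E); last first.
  apply: nneg_le_integral => x _.
    by apply: sume_ge0 => j _; rewrite mule_ge0 ?lee_fin.
  rewrite big_enum /=.
  have [[j ju cj]|nocore] := pselect (exists2 j : 'I_M, j \notin used & core j x); last first.
    rewrite big1 ?iprob_ge0// => j ju; case E : (core j x); last by rewrite mule0.
    by case: nocore; exists j.
  rewrite (bigD1 j)//= big1 => [|k /andP[ku kj]]; last first.
    case E : (core k x); last by rewrite mule0.
    by case/eqP: kj; apply/val_inj/(core_inj E cj).
  rewrite cj mule1 adde0; apply: (IH (j |: used)) => //.
    by rewrite cardsU1 ju add1n addSn.
  move=> h b bi bs; apply: (HA _ (fun u => if u == t then j else b u)).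
    move=> u v; rewrite !inE.
    case: (eqVneq u t) => [->|ut] /=; case: (eqVneq v t) => [->|vt] //=.
    - by move=> _ /bs[]; rewrite in_setU1 negb_or eq_sym => /andP[/eqP jb _] _ /jb.
    - by move=> /bs[]; rewrite in_setU1 negb_or => /andP[/eqP jb _] _ _ /jb.
    - exact: bi.
  move=> u; rewrite inE /upd; case: (eqVneq u t) => [->|ut] //= /bs[].
  by rewrite in_setU1 negb_or => /andP[_ ->].
apply: le_trans (nneg_integral_sum_le _ _ _ _) => [|//|j x _]; last by rewrite lee_fin.
rewrite big_enum /= (eq_bigr (fun=> (q ^+ size s * len)%:E)) => [|j _]; last first.
  by rewrite lebesgue_core.
rewrite sumEFin lee_fin sumr_const exprSr -mulrnAr ler_wpM2l// -mulr_natl.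
have -> : #|[pred j : 'I_M | j \notin used]| = (M - #|used|)%N.
  have := cardsC used; rewrite card_ord => h.
  have -> : (M - #|used| = #|~: used|)%N by move: h; clear; lia.
  by apply: eq_card => j; rewrite !inE.
apply: q_le; apply: leq_trans cn; exact: leq_trans (leq_addr _ _) (leqnSn _).
Qed.

Lemma unif_prob_buckets (A : (T -> R) -> Prop) :
  (forall (h : T -> R) (b : T -> 'I_M), injective b ->
     (forall t, core (b t) (h t)) -> A h) ->
  ((3 / 4)%:E <= unif_prob A)%E.
Proof.
move=> HA; apply: le_trans (_ : (q ^+ size (enum T))%:E <= _)%E; last first.
  rewrite /unif_prob; apply: (@iprob_distinct (enum T) finset.set0); first exact: enum_uniq.
    by rewrite cards0 -cardE.
  move=> h b bi bc; apply: (HA h b) => [u v|t].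
    by apply: bi; rewrite mem_enum.
  by case: (bc t); rewrite ?mem_enum.
(* By Bernoulli, [(1 - 1/(8n))^n >= 1 - 1/8]. *)
rewrite lee_fin -cardE; apply: le_trans (bernoulli_ineq _ _).
  have -> : (8 * n)%N%:R^-1 *+ n = 8^-1 :> R.
    by rewrite -mulr_natr natrM; field; rewrite pnatr_eq0 -lt0n.
  by lra.
rewrite invr_ge0 ler0n /= invf_le1 ?ler1n ?ltr0n ?muln_gt0//.
Qed.

End Buckets.

(** * Computing the order and simulating circuits *)

Section BinaryCodes.
Local Open Scope nat_scope.

Definition bin_val (s : seq bool) : nat := foldl (fun a (b : bool) => 2 * a + b) 0 s.

Lemma bin_val_rcons s b : bin_val (rcons s b) = 2 * bin_val s + b.
Proof. by rewrite /bin_val foldl_rcons. Qed.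

Lemma bin_aux_val fuel i : i <= fuel -> bin_val (bin_aux fuel i) = i.
Proof.
elim: fuel i => [|fuel IH] i; first by rewrite leqn0 => /eqP ->.
move=> ifuel /=; case: eqP => [->//|/eqP i0].
by rewrite bin_val_rcons IH; have := odd_double_half i; lia.
Qed.

Lemma binK : cancel bin bin_val.
Proof. by move=> i; rewrite /bin; case: eqP => [->//|_]; exact: bin_aux_val. Qed.

Lemma size_bin_aux fuel i : size (bin_aux fuel i) <= fuel.
Proof. by elim: fuel i => //= fuel IH i; case: eqP => // _; rewrite size_rcons ltnS. Qed.

Lemma size_bin n i : i < n -> 0 < size (bin i) <= n.
Proof.
move=> ni; rewrite /bin; case: eqP => [i0|/eqP i0]; first by rewrite /=; lia.
rewrite (leq_trans (size_bin_aux i i) (ltnW ni)) andbT.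
by case: i i0 ni => // i _ _ /=; rewrite size_rcons.
Qed.

(** Increasing [n] by one adds at least [4n + 2] to the quadratic part, more than the part
    [2 * size (bin i) <= 2n] can compensate. *)
Lemma code_size_inj p n n' i i' : i < n -> i' < n' ->
  code_size p n i = code_size p n' i' -> n = n'.
Proof.
move=> /size_bin/andP[s0 sn] /size_bin/andP[s0' sn']; rewrite /code_size => e.
by apply/eqP; rewrite eqn_leq; apply/andP; split; rewrite leqNgt; apply/negP => lt; nia.
Qed.

End BinaryCodes.

Lemma encode_inj_vertex (p n : nat) (G H : lgraph p n) sigma tau (i k : 'I_n) :
  encode G sigma i = encode H tau k -> i = k.
Proof.
move=> e; apply/val_inj/(can_inj binK).
have dropE (K : lgraph p n) rho (j : 'I_n) :
    drop (2 * (n * p)) (drop (2 * (n * n)) (encode K rho j)) =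
    enc_hash ++ flatten (map enc_bit (bin j)).
  rewrite encodeE -!map_drop /graph_code.
  rewrite drop_size_cat ?size_flatten_pairs ?size_vpairs// drop_size_cat ?size_flatten_pairs ?size_lpairs//.
  by rewrite -map_comp map_id_in.
have := congr1 (fun s => drop (2 * (n * p)) (drop (2 * (n * n)) s)) e.
rewrite !dropE => -[]; elim: (bin i) (bin k) => [|x s IH] [|y t] //=.
- by case: y.
- by case: x.
- by rewrite !enc_bitE /= => -[-> /IH ->].
Qed.

Section CircuitIteration.
Variables (N : nat) (C : circuit N) (w : seq bool).

Definition cstep (f : 'I_(c_size C) -> bool) (g : 'I_(c_size C)) : bool :=
  gate_val (c_kind C g) w [seq f h | h <- c_ch C g].

(** Rounds beyond the depth change nothing, so circuits of different depths can run in parallel for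
    the same number of rounds. *)
Lemma c_eval_iter k : (c_depth C < k)%N ->
  iter k cstep (fun=> false) (c_out C) = c_eval C w.
Proof.
move=> Ck; pose E : rel 'I_(c_size C) := fun h g => h \in c_ch C g.
have Etopo u v : E u v -> (u < v)%N by exact: (allP (c_topo C v) u).
have Eloc f g v : (forall u, E u v -> f u = g u) -> cstep f v = cstep g v.
  by move=> fg; congr gate_val; apply/eq_in_map.
have -> : c_eval C w = iter (c_size C) cstep (fun=> false) (c_out C) by [].
apply: (@iter_topo_rank _ _ E _ Eloc _ _ (node_depth E)) => [u v|u|].
- exact: node_depth_lt.
- exact: (iter_topo_fix Etopo).
- by apply: leq_ltn_trans (node_depth_le E _) Ck.
Qed.

End CircuitIteration.

(* Boolean states of a vertex v after the successive layers of the network, for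
   vertices hashed to buckets b v by their random numbers:
   - st1: i <= b v, and the labels of v;
   - st2: b v = i and at least k vertices lie in buckets above i;
   - st3: v has rank k in the order of decreasing buckets;
   - st5: additionally the entries of row k of the adjacency and label matrices if v
     has rank k (spec_row), and then these matrices themselves (spec_matrix);
   - st6: additionally the gates of the circuits for all candidate ranks i of v. *)
Section Specs.
Variables (p n M : nat) (Cf : 'I_n -> {N : nat & circuit N}).

Definition gate_t := {i : 'I_n & 'I_(c_size (tagged (Cf i)))}.
Definition st1 := ('I_M.+1 + 'I_p)%type.
Definition st2 := ('I_M * 'I_n.+1 + 'I_p)%type.
Definition st3 := ('I_n + 'I_p)%type.
Definition st5 := ('I_n + ('I_n * 'I_n + 'I_n * 'I_p))%type.
Definition st6 := (st5 + gate_t)%type.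

Local Notation zero := (fun=> 0 : int).

(** The difference of the two indicators is 1 exactly if [b v = i]. Its factor [n + 1] exceeds every
    global count, so the threshold [n + 1 + k] expresses a conjunction. *)
Definition spec_rank_ge : bspec st1 st2 := {|
  bs1 := fun t => match t with
    | inl (i, k) => fun a => n.+1%:Z *
        (ind (inl (widen_ord (leqnSn M) i)) a - ind (inl (lift ord0 i)) a)
    | inr j => ind (inr j) end;
  bs2 := fun _ => zero;
  bs3 := fun t => match t with inl (i, k) => ind (inl (lift ord0 i)) | inr _ => zero end;
  bthr := fun t => match t with inl (i, k) => (n.+1 + nat_of_ord k)%N%:Z | inr _ => 1 end |}.

(** Subtracting the bit for [k + 1] from that for [k] turns [at least] into [exactly]; only the
    vertex's own bucket contributes to the sum. *)
Definition spec_rank : bspec st2 st3 := {|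
  bs1 := fun t => match t with
    | inl k => fun a => \sum_(i < M)
        (ind (inl (i, widen_ord (leqnSn n) k)) a - ind (inl (i, lift ord0 k)) a)
    | inr j => ind (inr j) end;
  bs2 := fun _ => zero;
  bs3 := fun _ => zero;
  bthr := fun _ => 1 |}.

Definition spec_row : bspec st3 st5 := {|
  bs1 := fun t => match t with
    | inl k => ind (inl k)
    | inr (inl (k, l)) => fun a => n.+1%:Z * ind (inl k) a
    | inr (inr (k, j)) => fun a => ind (inl k) a + ind (inr j) a end;
  bs2 := fun t => match t with inr (inl (k, l)) => ind (inl l) | _ => zero end;
  bs3 := fun _ => zero;
  bthr := fun t => match t with
    | inl _ => 1 | inr (inl _) => n.+2%:Z | inr (inr _) => 2 end |}.

(** Only the owner of row [k] can hold a nonzero entry there, so the global sum broadcasts that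
    entry. *)
Definition spec_matrix : bspec st5 st5 := {|
  bs1 := fun t => match t with inl k => ind (inl k) | inr _ => zero end;
  bs2 := fun _ => zero;
  bs3 := fun t => match t with inl _ => zero | inr x => ind (inr x) end;
  bthr := fun _ => 1 |}.

Definition spec_init : bspec st5 st6 := {|
  bs1 := fun t => match t with inl x => ind x | inr _ => zero end;
  bs2 := fun _ => zero;
  bs3 := fun _ => zero;
  bthr := fun _ => 1 |}.

Definition gate_children (i : 'I_n) (g : 'I_(c_size (tagged (Cf i)))) : seq st6 :=
  [seq inr (Tagged (fun i => 'I_(c_size (tagged (Cf i)))) h) | h <- c_ch (tagged (Cf i)) g].

(** [count_mem] respects children listed several times. The threshold of [GThr k] is capped just
    above the fan-in, which keeps the gate unsatisfiable for large [k] while bounding the bias. *)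
Definition spec_gates : bspec st6 st6 := {|
  bs1 := fun t => match t with
    | inl x => ind (inl x)
    | inr (existT i g) =>
        match c_kind (tagged (Cf i)) g with
        | GIn j =>
            match nth (code_cst p n false) (graph_code p n i) j with
            | inl (inl _) => zero
            | inl (inr ac) => ind (inl (inr (inl ac)))
            | inr aj => ind (inl (inr (inr aj)))
            end
        | GNot => fun a => 0 - (count_mem a (gate_children g))%:Z
        | _ => fun a => (count_mem a (gate_children g))%:Z
        end
    end;
  bs2 := fun _ => zero;
  bs3 := fun _ => zero;
  bthr := fun t => match t with
    | inl _ => 1
    | inr (existT i g) =>
        match c_kind (tagged (Cf i)) g with
        | GIn j =>
            match nth (code_cst p n false) (graph_code p n i) j with
            | inl (inl b) => (~~ b : nat)%:Z
            | _ => 1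
            end
        | GNot => 0
        | GAnd => (size (gate_children g))%:Z
        | GOr => 1
        | GThr k => (minn k (size (gate_children g)).+1)%:Z
        end
    end |}.

Definition spec_select : bspec st6 'I_n := {|
  bs1 := fun i a => ind (inl (inl i)) a + ind (inr (Tagged (fun i => 'I_(c_size (tagged (Cf i))))
    (c_out (tagged (Cf i))))) a;
  bs2 := fun _ => zero;
  bs3 := fun _ => zero;
  bthr := fun _ => 2 |}.

Definition spec_out : bspec 'I_n 'I_1 := {|
  bs1 := fun _ => fun=> 1;
  bs2 := fun _ => zero;
  bs3 := fun _ => zero;
  bthr := fun _ => 1 |}.

Section Semantics.
Variable G : lgraph p n.
Local Notation adj := (gadj G).
Variable b : 'I_n -> 'I_M.
Hypothesis b_inj : injective b.

Definition num_above (i : nat) : nat := \sum_u (i < b u : nat)%N.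
Definition vrank (v : 'I_n) : nat := num_above (b v).

Lemma num_above_le i : (num_above i <= n)%N.
Proof.
rewrite -[X in (_ <= X)%N]card_ord -sum1_card; apply: leq_sum => u _; exact: leq_b1.
Qed.

Lemma vrank_lt v : (vrank v < n)%N.
Proof.
rewrite /vrank /num_above -[X in (_ < X)%N]card_ord -sum1_card.
rewrite (bigD1 v)//= [X in (_ < X)%N](bigD1 v)//= ltnn add0n add1n ltnS.
by apply: leq_sum => u _; exact: leq_b1.
Qed.

Lemma vrank_mono u v : (b u < b v)%N -> (vrank v < vrank u)%N.
Proof.
move=> uv; rewrite /vrank /num_above (bigD1 v)//= [X in (_ < X)%N](bigD1 v)//=.
rewrite uv ltnn add0n add1n ltnS; apply: leq_sum => x _.
by case: ltnP => // vx; rewrite (ltn_trans uv vx).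
Qed.

Lemma vrank_inj : injective vrank.
Proof.
move=> u v e; apply/b_inj/val_inj; apply/eqP; rewrite eqn_leq; apply/andP; split;
  by rewrite leqNgt; apply/negP => /vrank_mono; rewrite e ltnn.
Qed.

Definition vrank_ord (v : 'I_n) : 'I_n := Ordinal (vrank_lt v).

Lemma vrank_ord_inj : injective vrank_ord.
Proof. by move=> u v /(congr1 val) /= /vrank_inj. Qed.

(** The inverse is taken because [encode] asks for the vertex at a given position. *)
Definition vorder : {perm 'I_n} := (perm vrank_ord_inj)^-1%g.

Lemma vrankE v (k : 'I_n) : (vrank v == k :> nat) = (vorder k == v).
Proof.
apply/eqP/eqP => [e|<-].
  have -> : k = perm vrank_ord_inj v by rewrite permE; apply: val_inj.
  by rewrite /vorder permK.
by rewrite -[vrank _]/(val (vrank_ord _)) -(permE vrank_ord_inj) /vorder permKV.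
Qed.

Lemma bstep_copy (S T : finType) (L : bspec S T) (beta : 'I_n -> S -> bool) v t s :
  bs1 L t = ind s -> bs2 L t = zero -> bs3 L t = zero -> bthr L t = 1 ->
  bstep L adj beta v t = beta v s.
Proof.
move=> e1 e2 e3 e4; rewrite /bstep e1 e2 e3 e4 lcomb_ind !lcomb0 !addr0.
by case: (beta v s).
Qed.

Lemma bstep_rank_ge (beta : 'I_n -> st1 -> bool) :
  (forall v i, beta v (inl i) = (i <= b v)%N) ->
  (forall v j, beta v (inr j) = glab G v j) ->
  (forall v i k, bstep spec_rank_ge adj beta v (inl (i, k)) =
     (b v == i) && (k <= num_above i)%N) /\
  (forall v j, bstep spec_rank_ge adj beta v (inr j) = glab G v j).
Proof.
move=> bt bl; split=> [v i k|v j]; last by rewrite (@bstep_copy _ _ _ _ _ _ (inr j)).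
rewrite /bstep /= lcomb0 addr0 lcombZ lcombB !lcomb_ind !bt /=.
have -> : (\sum_u (beta u (inl (lift ord0 i)) : nat))%N = num_above i.
  by apply: eq_bigr => u _; rewrite bt.
have := num_above_le i; set c := num_above i; rewrite /bump /= add1n -val_eqE /=.
by case: (ltngtP (b v) i) => /= vi cn; [rewrite mulr0|rewrite mulr0|rewrite mulr1]; lia.
Qed.

Lemma bstep_rank (beta : 'I_n -> st2 -> bool) :
  (forall v i k, beta v (inl (i, k)) = (b v == i) && (k <= num_above i)%N) ->
  (forall v j, beta v (inr j) = glab G v j) ->
  (forall v k, bstep spec_rank adj beta v (inl k) = (vorder k == v)) /\
  (forall v j, bstep spec_rank adj beta v (inr j) = glab G v j).
Proof.
move=> bt bl; split=> [v k|v j]; last by rewrite (@bstep_copy _ _ _ _ _ _ (inr j)).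
rewrite /bstep /= !lcomb0 !addr0 lcomb_sum.
rewrite (eq_bigr (fun i => (if i == b v then (vrank v == k :> nat) : nat else 0)%N%:Z)) => [|i _].
  by rewrite -vrankE (bigD1 (b v))//= eqxx big1 ?addr0 => [|i /negbTE ->//]; case: eqP.
rewrite lcombB !lcomb_ind !bt; case: (eqVneq i (b v)) => [->|_] //=.
by rewrite -/(vrank v) /bump /= add1n; case: ltngtP.
Qed.

Lemma bstep_row (beta : 'I_n -> st3 -> bool) :
  (forall v k, beta v (inl k) = (vorder k == v)) ->
  (forall v j, beta v (inr j) = glab G v j) ->
  [/\ forall v k, bstep spec_row adj beta v (inl k) = (vorder k == v),
      forall v k l, bstep spec_row adj beta v (inr (inl (k, l))) =
        (vorder k == v) && adj v (vorder l) &
      forall v k j, bstep spec_row adj beta v (inr (inr (k, j))) =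
        (vorder k == v) && glab G v j].
Proof.
move=> bt bl; split=> [v k|v k l|v k j].
- by rewrite (@bstep_copy _ _ _ _ _ _ (inl k)).
- rewrite /bstep /= lcomb0 addr0 lcombZ !lcomb_ind bt.
  have -> : (\sum_(u | adj v u) (beta u (inl l) : nat) = adj v (vorder l))%N.
    rewrite big_mkcond (bigD1 (vorder l))//= bt eqxx big1 ?addn0; first by case: adj.
    by move=> u ul; rewrite bt eq_sym (negbTE ul) if_same.
  by case: eqP => _ /=; case: adj; lia.
- rewrite /bstep /= !lcomb0 !addr0 lcombD !lcomb_ind bt bl.
  by case: eqP; case: glab.
Qed.

Lemma bstep_matrix (beta : 'I_n -> st5 -> bool) :
  (forall v k, beta v (inl k) = (vorder k == v)) ->
  (forall v k l, beta v (inr (inl (k, l))) = (vorder k == v) && adj v (vorder l)) ->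
  (forall v k j, beta v (inr (inr (k, j))) = (vorder k == v) && glab G v j) ->
  [/\ forall v k, bstep spec_matrix adj beta v (inl k) = (vorder k == v),
      forall v k l, bstep spec_matrix adj beta v (inr (inl (k, l))) =
        adj (vorder k) (vorder l) &
      forall v k j, bstep spec_matrix adj beta v (inr (inr (k, j))) =
        glab G (vorder k) j].
Proof.
move=> bt ba bl; split=> [v k|v k l|v k j].
- by rewrite (@bstep_copy _ _ _ _ _ _ (inl k)).
- rewrite /bstep /= !lcomb0 !add0r lcomb_ind (bigD1 (vorder k))//= ba eqxx.
  rewrite big1 ?addn0 => [|u uk]; first by case: gadj.
  by rewrite ba eq_sym (negbTE uk).
- rewrite /bstep /= !lcomb0 !add0r lcomb_ind (bigD1 (vorder k))//= bl eqxx.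
  rewrite big1 ?addn0 => [|u uk]; first by case: glab.
  by rewrite bl eq_sym (negbTE uk).
Qed.

Definition env_ok (beta : 'I_n -> st5 -> bool) :=
  [/\ forall v k, beta v (inl k) = (vorder k == v),
      forall v k l, beta v (inr (inl (k, l))) = adj (vorder k) (vorder l) &
      forall v k j, beta v (inr (inr (k, j))) = glab G (vorder k) j].

Lemma bstep_init (beta : 'I_n -> st5 -> bool) v :
  (forall x, bstep spec_init adj beta v (inl x) = beta v x) /\
  (forall g, bstep spec_init adj beta v (inr g) = false).
Proof.
split=> [x|g]; first by rewrite (@bstep_copy _ _ _ _ _ _ x).
by rewrite /bstep /= !lcomb0.
Qed.

Lemma bstep_gates_env (beta : 'I_n -> st6 -> bool) v x :
  bstep spec_gates adj beta v (inl x) = beta v (inl x).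
Proof. by rewrite (@bstep_copy _ _ _ _ _ _ (inl x)). Qed.

Lemma bstep_gates (beta : 'I_n -> st6 -> bool) v i g :
  env_ok (fun v x => beta v (inl x)) ->
  bstep spec_gates adj beta v (inr (existT _ i g)) =
  cstep (encode G vorder i) (fun h => beta v (inr (existT _ i h))) g.
Proof.
move=> [_ ba bl]; rewrite /bstep /= !lcomb0 !addr0 /cstep.
have cnt : \sum_(a <- gate_children g) (beta v a : nat)%:Z =
    (count id [seq beta v (inr (existT _ i h)) | h <- c_ch (tagged (Cf i)) g])%:Z.
  rewrite /gate_children big_map.
  by elim: (c_ch _ g) => [|h s IH]; rewrite ?big_nil// big_cons IH.
have sz : size (gate_children g) = size [seq beta v (inr (existT _ i h)) | h <- c_ch (tagged (Cf i)) g].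
  by rewrite !size_map.
case E: (c_kind (tagged (Cf i)) g) => [j||||k] /=.
- rewrite nth_encode; case: nth => [[c|[a c]]|[a j']] /=.
  + by rewrite lcomb0; case: c.
  + by rewrite lcomb_ind ba; case: gadj.
  + by rewrite lcomb_ind bl; case: glab.
- rewrite lcombB lcomb0 lcomb_count cnt; have := c_not _ _ E.
  by case: (c_ch _ g) => [|h []]//= _; case: (beta _ _).
- rewrite lcomb_count cnt sz lez_nat all_count eqn_leq count_size /=.
  by [].
- by rewrite lcomb_count cnt lez_nat has_count.
- rewrite lcomb_count cnt lez_nat sz geq_min; case: (leqP k) => //= _.
  by apply/negbTE; rewrite -ltnNge ltnS count_size.
Qed.

Lemma iter_gates (beta : 'I_n -> st6 -> bool) k :
  env_ok (fun v x => beta v (inl x)) ->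
  (forall v x, iter k (bstep spec_gates adj) beta v (inl x) = beta v (inl x)) /\
  (forall v i g, iter k (bstep spec_gates adj) beta v (inr (existT _ i g)) =
    iter k (cstep (encode G vorder i)) (fun h => beta v (inr (existT _ i h))) g).
Proof.
move=> ok; elim: k => // k [IH1 IH2]; split=> [v x|v i g] /=.
  by rewrite bstep_gates_env.
rewrite bstep_gates; first by congr cstep; apply/funext => h; rewrite IH2.
by case: ok => h1 h2 h3; split=> *; rewrite IH1 ?h1 ?h2 ?h3.
Qed.

Lemma bstep_select (beta : 'I_n -> st6 -> bool) v i :
  bstep spec_select adj beta v i =
  beta v (inl (inl i)) && beta v (inr (existT _ i (c_out (tagged (Cf i))))).
Proof.
rewrite /bstep /= !lcomb0 !addr0 lcombD !lcomb_ind /Tagged.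
by case: (beta v (inl _)); case: (beta v (inr _)).
Qed.

Lemma bstep_out (beta : 'I_n -> 'I_n -> bool) v t :
  bstep spec_out adj beta v t = [exists i, beta v i].
Proof.
rewrite /bstep /= !lcomb0 !addr0 /lcomb.
under eq_bigr do rewrite mul1r.
apply/idP/existsP => [|[i bi]].
  apply: contraTP => /forallNP h; rewrite big1// => i _.
  by case E: (beta v i) => //; case: (h i).
by rewrite (bigD1 i)//= bi ler_wpDr ?sumr_ge0.
Qed.

End Semantics.
End Specs.

(** * From circuits to networks *)

(** A code word determines [n] and [i], and all graphs encoded by it are relabellings of its
    decoding; hence membership does not depend on the chosen representation. *)
Lemma L_le_encode (p n : nat) (Q : query p) (G : lgraph p n) sigma (i : 'I_n) :
  is_query Q -> L_le Q (encode G sigma i) <-> Q n G (sigma i).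
Proof.
move=> HQ; split=> [[n' [G' [tau [k [e Qk]]]]]|Qi]; last by exists n, G, sigma, i.
have nn : n = n'.
  have := congr1 size e; rewrite !size_encode.
  exact: code_size_inj (ltn_ord i) (ltn_ord k).
subst n'; have ik := encode_inj_vertex e; subst k.
by rewrite -(query_decode G sigma i i HQ) e query_decode.
Qed.

Section Repetition.
Variables (R : realType) (q po : nat) (L : layer R q q).

Fixpoint gnn_rep (k : nat) (N : gnn R q po) : gnn R q po :=
  if k is k'.+1 then GCons L (gnn_rep k' N) else N.

Lemma gnn_rep_eval k N n (adj : rel 'I_n) x :
  gnn_eval (gnn_rep k N) adj x = gnn_eval N adj (iter k (layer_eval L adj) x).
Proof. by elim: k x => // k IH x; rewrite iterSr -IH. Qed.

Lemma gnn_rep_nlayers k N : gnn_nlayers (gnn_rep k N) = (k + gnn_nlayers N)%N.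
Proof. by elim: k => //= k ->. Qed.

Lemma gnn_rep_maxdepth k N d :
  (maxn (fn_depth (l_msg L)) (fn_depth (l_comb L)) <= d)%N ->
  (gnn_maxdepth N <= d)%N -> (gnn_maxdepth (gnn_rep k N) <= d)%N.
Proof. by move=> Ld Nd; elim: k => //= k IH; rewrite geq_max Ld. Qed.

Lemma gnn_rep_weight k N : gnn_weight (gnn_rep k N) =
  (fn_weight (l_msg L) + fn_weight (l_comb L)) *+ k + gnn_weight N.
Proof. by elim: k => [|k IH]; rewrite ?add0r//= IH mulrS addrA. Qed.

Lemma gnn_rep_acts k N f : f \in gnn_acts (gnn_rep k N) ->
  f \in fn_acts (l_msg L) ++ fn_acts (l_comb L) \/ f \in gnn_acts N.
Proof.
elim: k => [|k IH] /=; first by right.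
by rewrite catA mem_cat => /orP[|/IH//]; left.
Qed.

End Repetition.

(** * Coefficient bounds for the layers *)

Section Bounds.
Variables (p n M : nat) (Cf : 'I_n -> {N : nat & circuit N}) (F Z : nat).
Hypothesis M1 : (2 * M <= Z)%N.
Hypothesis nZ : (2 * n + 3 <= Z)%N.
Hypothesis FZ : (F + 3 <= Z)%N.
Hypothesis chF : forall i g, (size (c_ch (tagged (Cf i)) g) <= F)%N.

Lemma normr_ind (S : finType) (s a : S) : `|ind s a| <= 1.
Proof. by rewrite /ind; case: eqP. Qed.

Lemma ind_le (S : finType) (s a : S) : `|ind s a| <= Z%:Z.
Proof. by apply: le_trans (normr_ind s a) _; move: nZ; clear; lia. Qed.

Lemma ind_scale_le (S : finType) (k : nat) (s a : S) : (k <= Z)%N -> `|k%:Z * ind s a| <= Z%:Z.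
Proof. by move=> kZ; have := normr_ind s a; rewrite normrM; move: kZ; clear; nia. Qed.

Lemma spec_rank_ge_le : bspec_le (spec_rank_ge p n M) Z.
Proof.
move=> [[i k]|j]; split=> [a|a|a|] /=; rewrite ?normr0 ?subrr ?ind_le//.
  have : `|ind (inl (widen_ord (leqnSn M) i)) a - ind (inl (lift ord0 i)) a : int| <= 1.
    by rewrite /ind; case: eqP => [->|]; case: eqP.
  move=> h; rewrite normrM; apply: le_trans (ler_wpM2l (normr_ge0 _) h) _.
  by rewrite mulr1; move: nZ; clear; lia.
by have := ltn_ord k; move: nZ; clear; lia.
Qed.

Lemma spec_rank_le : bspec_le (spec_rank p n M) Z.
Proof.
move=> [k|j]; split=> [a|a|a|] /=; rewrite ?normr0 ?subrr ?ind_le//.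
apply: le_trans (ler_norm_sum _ _ _) _; apply: le_trans (_ : \sum_(i < M) 2 <= _).
  apply: ler_sum => i _; apply: le_trans (ler_normB _ _) _.
  exact: lerD (normr_ind _ _) (normr_ind _ _).
by rewrite sumr_const card_ord -mulr_natl natz; move: M1; clear; lia.
Qed.

Lemma spec_row_le : bspec_le (spec_row p n) Z.
Proof.
move=> [k|[[k l]|[k j]]]; split=> [a|a|a|] /=; rewrite ?normr0 ?subrr ?ind_le//.
- by apply: (@ind_scale_le _ n.+1); move: nZ; clear; lia.
- by move: nZ; clear; lia.
- apply: le_trans (ler_normD _ _) _.
  apply: le_trans (lerD (normr_ind _ _) (normr_ind _ _)) _.
  by move: nZ; clear; lia.
- by move: nZ; clear; lia.
Qed.

Lemma spec_matrix_le : bspec_le (spec_matrix p n) Z.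
Proof. by move=> [k|x]; split=> [a|a|a|] /=; rewrite ?normr0 ?subrr ?ind_le. Qed.

Lemma spec_init_le : bspec_le (spec_init p Cf) Z.
Proof. by move=> [k|x]; split=> [a|a|a|] /=; rewrite ?normr0 ?subrr ?ind_le. Qed.

Lemma spec_gates_le : bspec_le (spec_gates p Cf) Z.
Proof.
have sF (i : 'I_n) (g : 'I_(c_size (tagged (Cf i)))) : (size (gate_children p g) <= F)%N.
  by rewrite /gate_children size_map.
have cF (i : 'I_n) (g : 'I_(c_size (tagged (Cf i)))) a : (count_mem a (gate_children p g) <= F)%N.
  by apply: leq_trans (count_size _ _) _; exact: (sF i g).
move=> [k|[i g]]; split=> [a|a|a|] /=; rewrite ?normr0 ?subrr ?ind_le//.
  have c1 (x : nat) : (x <= F)%N -> `|0 - x%:Z| <= Z%:Z by move: FZ; clear; lia.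
  have c2 (x : nat) : (x <= F)%N -> `|x%:Z| <= Z%:Z by move: FZ; clear; lia.
  case: (c_kind _ g) => [j||||k]; [|exact: c1 (cF i g a)|exact: c2 (cF i g a)..].
  by case: nth => [[c|ac]|aj]; rewrite ?normr0 ?ind_le.
have s1 (x : nat) : (x <= F)%N -> `|1 - x%:Z| <= Z%:Z by move: FZ; clear; lia.
have s2 k (x : nat) : (x <= F)%N -> `|1 - (minn k x.+1)%:Z| <= Z%:Z by move: FZ; clear; lia.
case: (c_kind _ g) => [j||||k].
- by case: nth => [[[]|ac]|aj] /=; move: FZ; clear; lia.
- by move: FZ; clear; lia.
- exact: s1 (sF i g).
- by move: FZ; clear; lia.
- exact: s2 (sF i g).
Qed.

Lemma spec_select_le : bspec_le (spec_select p Cf) Z.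
Proof.
move=> i; split=> [a|a|a|] /=; rewrite ?normr0 ?subrr ?ind_le//; last by move: nZ; clear; lia.
apply: le_trans (ler_normD _ _) _.
apply: le_trans (lerD (normr_ind _ _) (normr_ind _ _)) _.
by move: nZ; clear; lia.
Qed.

Lemma spec_out_le : bspec_le (spec_out n) Z.
Proof. by move=> i; split=> [a|a|a|] /=; rewrite ?normr0 ?subrr//; move: nZ; clear; lia. Qed.

End Bounds.

Section BucketLayer.
Variables (R : realType) (p n : nat).
Hypothesis n0 : (0 < n)%N.
Local Notation T := ('I_n * 'I_1)%type.
Local Notation N := #|{: T}|.
Local Notation M := (16 * N * N)%N.
Local Notation S1 := (st1 p M).

(** With the bias below, the argument of the clamp is [16 * N * M * x - 16 * N * i]: at least 1 on
    the cores from [i] on, and at most 0 on the earlier ones. *)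
Definition bucket_w (j : 'I_#|{: S1}|) (i : 'I_(p + 1)) : R :=
  match fintype.split i, enum_val j with
  | inl a, inr a' => (a' == a)%:R
  | inr _, inl _ => (16 * N * M)%N%:R
  | _, _ => 0
  end.

Definition bucket_b (j : 'I_#|{: S1}|) : R :=
  match enum_val j with inl i => - (16 * N * i)%N%:R | inr _ => 0 end.

Lemma st1_gt0 : (0 < #|{: S1}|)%N.
Proof. by apply/card_gt0P; exists (inl ord0). Qed.

Lemma p1_gt0 : (0 < p + 1)%N. Proof. by rewrite addn1. Qed.

Definition bucket_layer : layer R (p + 1) #|{: S1}| :=
  @dlayer R (p + 1) #|{: S1}| bucket_w (fun _ _ => 0) (fun _ _ => 0) bucket_b
    (fun=> @clamp R) p1_gt0 st1_gt0 (fun=> @clamp_lip R).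

Lemma bucket_layer_step (G : lgraph p n) (rho : T -> R) (bk : T -> 'I_M) :
  (forall t, @core R T (bk t) (rho t)) ->
  brepr (@enum_val S1 predT) (layer_eval bucket_layer (gadj G)
    (fun w => vcat (fun j => ((glab G w j : nat)%:R : R)) (fun k => rho (w, k))))
    (fun v a => match a with
       | inl i => (i <= bk (v, ord0))%N
       | inr j => glab G v j end).
Proof.
move=> Hc v j; rewrite /bucket_layer dlayer_eval.
rewrite [X in _ + X + _]big1 ?addr0 => [|i _]; last by rewrite mul0r.
rewrite [X in _ + (_ + X)]big1 ?addr0 => [|i _]; last by rewrite mul0r.
have splitl i : fintype.split (@lshift p 1 i) = inl i by exact: (unsplitK (inl i)).
have splitr i : fintype.split (@rshift p 1 i) = inr i by exact: (unsplitK (inr i)).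
rewrite big_split_ord big_ord1 /= /bucket_w /bucket_b /vcat splitr.
under eq_bigr do rewrite splitl.
case: (enum_val j) => [i|a]; last first.
  rewrite (bigD1 a)//= eqxx mul1r big1 => [|k /negbTE ka]; last by rewrite eq_sym ka mul0r.
  rewrite mul0r !addr0 add0r; case: glab; [exact: clamp_ge1|exact: clamp_le0].
rewrite big1 => [|k _]; last by rewrite mul0r.
rewrite add0r addrC; have /andP[c1 c2] := Hc (v, ord0).
case: leqP => ib.
  apply: clamp_ge1; rewrite lerBrDr; apply: le_trans c1.
  by rewrite natrD addrC lerD2r ler_nat leq_mul2l ib orbT.
apply: clamp_le0; rewrite subr_le0; apply: (le_trans c2).
by rewrite ler_nat leq_mul2l ib orbT.
Qed.

Lemma bucket_layer_weight (Z : nat) : (0 < Z)%N -> (16 * N * M <= Z)%N ->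
  fn_weight (l_msg bucket_layer) + fn_weight (l_comb bucket_layer) <=
    (100 * ((p + 1 + #|{: S1}| + Z) * (p + 1 + #|{: S1}| + Z)))%N%:R.
Proof.
move=> Z0 NZ; have Z1 : 1 <= Z%:R :> R by rewrite ler1n.
apply: dlayer_weight => // [j i|j i|j i|j|_]; rewrite ?normr0// ?clamp_le0//.
  rewrite /bucket_w; case: fintype.split => a; case: enum_val => b; rewrite ?normr0//.
    by case: eqP; rewrite ?normr1 ?normr0.
  by rewrite normr_nat ler_nat.
rewrite /bucket_b; case: enum_val => [i|_]; last by rewrite normr0.
rewrite normrN normr_nat ler_nat; apply: leq_trans NZ.
by rewrite leq_mul2l -ltnS ltn_ord orbT.
Qed.

End BucketLayer.

(** * Assembling the network *)

Section Construction.
Variables (R : realType) (p : nat) (Q : query p) (C : forall N, circuit N).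
Variables (d e : nat).
Hypothesis HQ : is_query Q.
Hypothesis size_le : forall N, (c_wsize (C N) <= N.+2 ^ e)%N.
Hypothesis depth_le : forall N, (c_depth (C N) <= d)%N.
Hypothesis C_correct : forall w : seq bool, c_eval (C (size w)) w <-> L_le Q w.

Definition circ_bound (n : nat) := ((2 * (n * n) + 2 * (n * p) + 2 + 2 * n).+2 ^ e)%N.

Definition net_bound (n : nat) : nat :=
  (let M := 16 * n * n in
   p + 5 + 16 * n * M + 3 * M + M * n.+1 + 3 * n + n * n + n * p +
   n * circ_bound n + circ_bound n)%N.

Section FixedOrder.
Variable n : nat.
Hypothesis n0 : (0 < n)%N.

Definition circ_family (i : 'I_n) : {N : nat & circuit N} :=
  Tagged circuit (C (code_size p n i)).

Local Notation Cf := circ_family.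
Local Notation N := #|{: 'I_n * 'I_1}|.
Local Notation M := (16 * N * N)%N.
Local Notation Z := (net_bound n).
Local Notation S1 := (st1 p M).
Local Notation S2 := (st2 p n M).
Local Notation S3 := (st3 p n).
Local Notation S5 := (st5 p n).
Local Notation S6 := (st6 p Cf).

Lemma card_samples : N = n.
Proof. by rewrite card_prod !card_ord muln1. Qed.

Let v0 : 'I_n := Ordinal n0.

Let M0 : (0 < M)%N.
Proof. by rewrite !muln_gt0 card_samples n0. Qed.

Lemma st2_gt0 : (0 < #|{: S2}|)%N.
Proof. by apply/card_gt0P; exists (inl (Ordinal M0, ord0)). Qed.
Lemma st3_gt0 : (0 < #|{: S3}|)%N.
Proof. by apply/card_gt0P; exists (inl v0). Qed.
Lemma st5_gt0 : (0 < #|{: S5}|)%N.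
Proof. by apply/card_gt0P; exists (inl v0). Qed.
Lemma st6_gt0 : (0 < #|{: S6}|)%N.
Proof. by apply/card_gt0P; exists (inl (inl v0)). Qed.
Lemma vtx_gt0 : (0 < #|'I_n|)%N.
Proof. by rewrite card_ord. Qed.

Local Notation bl S T S0 T0 L :=
  (@blayer R S T #|{: S}| #|{: T}| (@enum_val S predT) (@enum_val T predT) S0 T0 L).

Lemma enum_layer_step (S T : finType) S0 T0 (L : bspec S T) (adj : rel 'I_n) x beta :
  brepr (@enum_val S predT) x beta ->
  brepr (@enum_val T predT) (layer_eval (bl S T S0 T0 L) adj x) (bstep L adj beta).
Proof. exact/blayer_step/enum_val_bij. Qed.

Definition out_layer : layer R #|'I_n| 1 :=
  @blayer R 'I_n 'I_1 #|'I_n| 1 (@enum_val 'I_n predT) id vtx_gt0 isT (spec_out n).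

Definition net : gnn R (p + 1) 1 :=
  GCons (bucket_layer R p n)
  (GCons (bl S1 S2 (st1_gt0 p n) st2_gt0 (spec_rank_ge p n M))
  (GCons (bl S2 S3 st2_gt0 st3_gt0 (spec_rank p n M))
  (GCons (bl S3 S5 st3_gt0 st5_gt0 (spec_row p n))
  (GCons (bl S5 S5 st5_gt0 st5_gt0 (spec_matrix p n))
  (GCons (bl S5 S6 st5_gt0 st6_gt0 (spec_init p Cf))
  (gnn_rep (bl S6 S6 st6_gt0 st6_gt0 (spec_gates p Cf)) d.+1
  (GCons (bl S6 'I_n st6_gt0 vtx_gt0 (spec_select p Cf))
  (GCons out_layer (GNil R 1))))))))).

(** Once the buckets are distinct and hit in their cores, the run is a Boolean computation and its
    output is exact. *)
Lemma net_eval (G : lgraph p n) (rho : 'I_n * 'I_1 -> R) (bk : 'I_n * 'I_1 -> 'I_M) v :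
  injective bk -> (forall t, @core R {: 'I_n * 'I_1}%type (bk t) (rho t)) ->
  ri_out net G rho v = (Q G v : nat)%:R.
Proof.
move=> bki Hc; pose b (v : 'I_n) := bk (v, ord0).
have b_inj : injective b by move=> x y /bki[].
pose beta1 (u : 'I_n) (a : S1) : bool :=
  match a with inl i => (i <= b u)%N | inr j => glab G u j end.
have r1 : brepr _ _ beta1 := bucket_layer_step G Hc.
have [s1a s1b] := @bstep_rank_ge p n M G b beta1 (fun _ _ => erefl) (fun _ _ => erefl).
have r2 := enum_layer_step (st1_gt0 p n) st2_gt0 (spec_rank_ge p n M) (gadj G) r1.
have [s2a s2b] := bstep_rank b_inj s1a s1b.
have r3 := enum_layer_step st2_gt0 st3_gt0 (spec_rank p n M) (gadj G) r2.
have [s3a s3b s3c] := bstep_row s2a s2b.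
have r4 := enum_layer_step st3_gt0 st5_gt0 (spec_row p n) (gadj G) r3.
have [s4a s4b s4c] := bstep_matrix s3a s3b s3c.
have r5 := enum_layer_step st5_gt0 st5_gt0 (spec_matrix p n) (gadj G) r4.
have r6 := enum_layer_step st5_gt0 st6_gt0 (spec_init p Cf) (gadj G) r5.
set beta5 := bstep (spec_matrix p n) _ _ in r5 r6 s4a s4b s4c.
set beta6 := bstep (spec_init p Cf) _ _ in r6.
have beta6E v' x : beta6 v' (inl x) = beta5 v' x by case: (bstep_init Cf G beta5 v').
have beta60 v' g : beta6 v' (inr g) = false by case: (bstep_init Cf G beta5 v').
have ok : env_ok G b_inj (fun v x => beta6 v (inl x)).
  by split=> *; rewrite beta6E ?s4a ?s4b ?s4c.
set x6 := layer_eval _ _ _ in r6.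
have r7 k : brepr (@enum_val S6 predT)
    (iter k (layer_eval (bl S6 S6 st6_gt0 st6_gt0 (spec_gates p Cf)) (gadj G)) x6)
    (iter k (bstep (spec_gates p Cf) (gadj G)) beta6).
  by elim: k => //= k IH; exact: enum_layer_step IH.
have [it1 it2] := iter_gates d.+1 ok.
have r8 := enum_layer_step st6_gt0 vtx_gt0 (spec_select p Cf) (gadj G) (r7 d.+1).
have r9 := @blayer_step R 'I_n 'I_1 _ _ _ (id : 'I_1 -> 'I_1) (enum_val_bij _) vtx_gt0 isT
  (spec_out n) n (gadj G) _ _ r8.
have -> : ri_out net G rho v = layer_eval out_layer (gadj G) (layer_eval
    (bl S6 'I_n st6_gt0 vtx_gt0 (spec_select p Cf)) (gadj G)
    (iter d.+1 (layer_eval (bl S6 S6 st6_gt0 st6_gt0 (spec_gates p Cf)) (gadj G)) x6)) v ord0.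
  rewrite -[ri_out _ _ _ _]/(gnn_eval (gnn_rep (bl S6 S6 st6_gt0 st6_gt0 (spec_gates p Cf)) d.+1
    (GCons (bl S6 'I_n st6_gt0 vtx_gt0 (spec_select p Cf)) (GCons out_layer (GNil R 1))))
    (gadj G) x6 v ord0).
  by rewrite gnn_rep_eval.
rewrite r9 bstep_out; congr ((nat_of_bool _)%:R).
set sg := vorder b_inj.
have selE i : bstep (spec_select p Cf) (gadj G)
    (iter d.+1 (bstep (spec_gates p Cf) (gadj G)) beta6) v i =
    (sg i == v) && Q G (sg i).
  rewrite bstep_select it1 it2; case: ok => -> _ _; congr (_ && _).
  rewrite (_ : (fun h => _) = (fun=> false)); last by apply/funext => h; rewrite beta60.
  rewrite c_eval_iter; last by rewrite ltnS; exact: depth_le.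
  have -> : c_eval (tagged (Cf i)) (encode G sg i) =
      c_eval (C (size (encode G sg i))) (encode G sg i) by rewrite size_encode.
  by apply/idP/idP => [/C_correct/(L_le_encode _ _ _ HQ)|Qi]; last exact/C_correct/(L_le_encode _ _ _ HQ).
apply/existsP/idP => [[i]|Qv]; first by rewrite selE => /andP[/eqP ->].
by exists (sg^-1%g v); rewrite selE permKV eqxx.
Qed.

Lemma net_computes (G : lgraph p n) v :
  (Q G v -> ((3 / 4)%:E <= unif_prob (fun rho => (3 / 4 <= ri_out net G rho v)%R))%E) /\
  (~~ Q G v -> ((3 / 4)%:E <= unif_prob (fun rho => (ri_out net G rho v <= 1 / 4)%R))%E).
Proof.
have N0 : (0 < N)%N by rewrite card_samples.
split=> Qv; apply: unif_prob_buckets => // rho bk bki Hc; rewrite (net_eval G v bki Hc).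
  by rewrite Qv /=; lra.
by rewrite (negbTE Qv) /=; lra.
Qed.


Lemma net_nlayers : gnn_nlayers net = (d + 9)%N.
Proof. by rewrite /net /= gnn_rep_nlayers /=; clear; lia. Qed.

Lemma net_maxdepth : (gnn_maxdepth net <= 1)%N.
Proof.
do 6 (rewrite geq_max dlayer_depth /=).
rewrite -[X in (X <= 1)%N]/(gnn_maxdepth (gnn_rep (bl S6 S6 st6_gt0 st6_gt0 (spec_gates p Cf)) d.+1
    (GCons (bl S6 'I_n st6_gt0 vtx_gt0 (spec_select p Cf)) (GCons out_layer (GNil R 1))))).
apply: gnn_rep_maxdepth; first exact: dlayer_depth.
by do 2 (rewrite geq_max dlayer_depth /=).
Qed.

Lemma net_acts f : f \in gnn_acts net -> f = id \/ f = @clamp R.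
Proof.
have bucketA g : g \in fn_acts (l_msg (bucket_layer R p n)) ++ fn_acts (l_comb (bucket_layer R p n)) ->
    g = id \/ g = @clamp R by move/dlayer_acts => [->|[j ->]]; [left|right].
have stepA (q r : nat) (L : layer R q r) (Nn : gnn R r 1) g :
    (forall h, h \in fn_acts (l_msg L) ++ fn_acts (l_comb L) -> h = id \/ h = @clamp R) ->
    (forall h, h \in gnn_acts Nn -> h = id \/ h = @clamp R) ->
    g \in gnn_acts (GCons L Nn) -> g = id \/ g = @clamp R.
  by move=> HL HN; rewrite /= catA mem_cat => /orP[/HL|/HN].
have blA q r (S T : finType) (dS : 'I_q -> S) (dT : 'I_r -> T) q0 r0 (L : bspec S T) :=
  @blayer_acts R S T q r dS dT q0 r0 L.
rewrite /net; apply: (stepA _ _ _ _ _ bucketA) => g1.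
do 5 (apply: (@stepA _ _); [exact: blA|move=> ?]).
case/gnn_rep_acts; first exact: blA.
apply: (@stepA _ _); first exact: blA.
by move=> g2; apply: (@stepA _ _); first exact: blA.
Qed.

Lemma circ_family_size (i : 'I_n) : (c_wsize (tagged (Cf i)) <= circ_bound n)%N.
Proof.
apply: (leq_trans (size_le _)); rewrite /circ_bound.
case: (posnP e) => [->//|e0]; rewrite leq_exp2r// !ltnS /code_size leq_add2l leq_mul2l /=.
by case/andP: (size_bin (ltn_ord i)).
Qed.

Lemma net_dims :
  [/\ [/\ (p + 1 <= Z)%N, (#|{: S1}| <= Z)%N, (#|{: S2}| <= Z)%N & (#|{: S3}| <= Z)%N],
      [/\ (#|{: S5}| <= Z)%N, (#|{: S6}| <= Z)%N & (#|'I_n| <= Z)%N] &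
      [/\ (16 * N * M <= Z)%N, (2 * M <= Z)%N, (2 * n + 3 <= Z)%N & (circ_bound n + 3 <= Z)%N]].
Proof.
have gates : (#|{: gate_t Cf}| <= n * circ_bound n)%N.
  rewrite card_tagged sumnE big_map big_enum /=.
  apply: leq_trans (_ : \sum_(i : 'I_n) circ_bound n <= _)%N.
    apply: leq_sum => i _; rewrite card_ord; apply: leq_trans (circ_family_size i).
    exact: leq_addr.
  by rewrite sum_nat_const card_ord.
have cM : (M = 16 * n * n)%N by rewrite card_samples.
rewrite !card_sum !card_prod !card_ord /net_bound /=.
move: gates; rewrite muln1; move: (16 * n * n)%N (circ_bound n) #|{: gate_t Cf}| => M' cb gt.
by move=> h; split; split; nia.
Qed.

Lemma net_weight : gnn_weight net <= ((d + 9) * (900 * (Z * Z)))%N%:R.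
Proof.
have [[z1 z2 z3 z4] [z5 z6 z7] [b1 b2 b3 b4]] := net_dims.
have Z0 : (0 < Z)%N by move: b3; clear; lia.
have chF (i : 'I_n) (g : 'I_(c_size (tagged (Cf i)))) :
    (size (c_ch (tagged (Cf i)) g) <= circ_bound n)%N.
  apply: leq_trans (circ_family_size i); apply: leq_trans (leq_addl _ _).
  by rewrite (bigD1 g)//= leq_addr.
(* Both dimensions and the coefficients are at most [Z], and [100 * (3Z)^2 = 900 * Z^2]. *)
have wE (q r : nat) : (q <= Z)%N -> (r <= Z)%N ->
    ((100 * ((q + r + Z) * (q + r + Z)))%N%:R : R) <= (900 * (Z * Z))%N%:R.
  by move=> qZ rZ; rewrite ler_nat; nia.
have blW q r (S T : finType) (dS : 'I_q -> S) (dT : 'I_r -> T) q0 r0 (L : bspec S T) :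
    (q <= Z)%N -> (r <= Z)%N -> bspec_le L Z ->
    fn_weight (l_msg (blayer R dS dT q0 r0 L)) + fn_weight (l_comb (blayer R dS dT q0 r0 L)) <=
      (900 * (Z * Z))%N%:R.
  by move=> qZ rZ LZ; apply: le_trans (wE _ _ qZ rZ); exact: blayer_weight.
have stepW (q r : nat) (L : layer R q r) (Nn : gnn R r 1) k :
    fn_weight (l_msg L) + fn_weight (l_comb L) <= (900 * (Z * Z))%N%:R ->
    gnn_weight Nn <= (k * (900 * (Z * Z)))%N%:R ->
    gnn_weight (GCons L Nn) <= (k.+1 * (900 * (Z * Z)))%N%:R.
  by move=> LW NW; rewrite /= mulSn natrD lerD.
(* Six preparatory layers, [d + 1] rounds of gates and two layers for the output. *)
have -> : (d + 9 = (d.+1 + 2).+2.+4)%N by clear; lia.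
apply: (@stepW _ _); first by apply: le_trans (wE _ _ z1 z2); exact: bucket_layer_weight.
apply: (@stepW _ _); first by apply: blW => //; apply: spec_rank_ge_le b3.
apply: (@stepW _ _); first by apply: blW => //; apply: spec_rank_le b2 b3.
apply: (@stepW _ _); first by apply: blW => //; apply: spec_row_le b3.
apply: (@stepW _ _); first by apply: blW => //; apply: spec_matrix_le b3.
apply: (@stepW _ _); first by apply: blW => //; apply: spec_init_le b3.
rewrite gnn_rep_weight mulnDl natrD; apply: lerD.
  rewrite natrM mulr_natl lerMn2r; apply/orP; right.
  by apply: blW => //; apply: spec_gates_le b3 b4 chF.
apply: (@stepW _ _); first by apply: blW => //; apply: spec_select_le b3.
apply: (@stepW _ _); first by apply: blW => //; apply: spec_out_le b3.
by rewrite mul0n.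
Qed.

End FixedOrder.

Lemma network_exists (n : nat) : exists Nn : gnn R (p + 1) 1,
  [/\ gnn_weight Nn <= ((d + 9) * (900 * (net_bound n * net_bound n)))%N%:R,
      (gnn_depth Nn <= d + 9)%N,
      (forall f, f \in gnn_acts Nn -> f = id \/ f = @clamp R) &
      forall (G : lgraph p n) v,
        (Q G v -> ((3 / 4)%:E <= unif_prob (fun rho => (3 / 4 <= ri_out Nn G rho v)%R))%E) /\
        (~~ Q G v -> ((3 / 4)%:E <= unif_prob (fun rho => (ri_out Nn G rho v <= 1 / 4)%R))%E)].
Proof.
have [n0|n0] := posnP n; last first.
  exists (net n0); split; [exact: net_weight| |exact: net_acts|exact: net_computes].
  rewrite /gnn_depth net_nlayers -[X in (_ <= X)%N]muln1 leq_mul2l orbC.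
  by rewrite net_maxdepth.
(* For [n = 0] there is no vertex to answer for; a zero layer of the right dimensions will do. *)
have p0 : (0 < p + 1)%N by rewrite addn1.
exists (GCons (@dlayer R (p + 1) 1 (fun _ _ => 0) (fun _ _ => 0) (fun _ _ => 0) (fun=> 0)
  (fun=> @clamp R) p0 isT (fun=> @clamp_lip R)) (GNil R 1)); split.
- rewrite /= addr0; apply: le_trans (@dlayer_weight _ _ _ _ _ _ _ _ _ _ _ 1 _ _ _ _ _ _) _ => // *;
    rewrite ?normr0 ?clamp_le0//.
  by rewrite ler_nat /net_bound; nia.
- by rewrite /gnn_depth /= maxn0 mul1n (leq_trans (dlayer_depth _ _ _ _ _ _ _))// addnS.
- move=> f; rewrite /= cats0 => /dlayer_acts[->|[j ->]]; [by left|by right].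
- by subst n => G [].
Qed.

End Construction.

Lemma polyb_net_bound (p e : nat) : polyb (net_bound p e).
Proof.
have pc k : polyb (fun=> k) by exact: polyb_cst.
have pid : polyb (fun n => n) by exact: polyb_id.
have pM : polyb (fun n => 16 * n * n)%N by do !apply: polybM.
have pS : polyb S by apply: (@polyb_le _ (fun n => n + 1)%N) => [n|]; [lia|exact: polybD].
have pcb : polyb (circ_bound p e).
  apply: polybX; apply: (@polyb_le _ (fun n => (2 * (n * n) + 2 * (n * p) + 2 + 2 * n) + 2)%N) => [n|].
    by lia.
  by do ![apply: polybD => // | apply: polybM => //].
rewrite /net_bound; do ![apply: polybD => // | apply: polybM => //].
Qed.

Lemma TC0_gnn_ri_computable (R : realType) (p : nat) (Q : query p) :
  is_query Q -> in_TC0 Q -> gnn_ri_computable R Q.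
Proof.
move=> HQ [C [[P HP] [[d Hd] HC]]].
have [f [e fe] Pf] := intpoly_polyb P.
have sz N : (c_wsize (C N) <= N.+2 ^ e)%N.
  by apply: leq_trans (fe N); rewrite -lez_nat; apply: le_trans (HP N) (Pf N).
have ex := network_exists R HQ sz Hd HC.
pose Nn n := sval (cid (ex n)).
have NP n := svalP (cid (ex n)).
exists (fun=> 1%N), Nn; split; [|split; [|split]].
- have pb : polyb (fun n => (d + 9) * (900 * (net_bound p e n * net_bound p e n)))%N.
    have := polyb_net_bound p e => pn.
    by do 2 (apply: polybM; first exact: polyb_cst); exact: polybM.
  have [W HW] := polyb_natpoly R pb; exists W => n.
  by apply: le_trans (HW n); case: (NP n).
- by exists (d + 9)%N => n; case: (NP n).
(* Both activations are themselves piecewise linear with small dyadic parameters, so one constant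
   bounds the bitsize for every [eps]. *)
- exists (100%:R)%:P%:P => n eps eps0 f' Hf'; rewrite /peval2 !hornerC.
  have [_ _ /(_ f' Hf') + _] := NP n; case=> ->.
    exists id_plin; split; first exact: plin_wf_id.
    rewrite (_ : plin_eval R id_plin = id); last by apply/funext => x; exact: plin_eval_id.
    by split; [exact: eps_approx_refl|rewrite ler_nat].
  exists clamp_plin; split; first exact: plin_wf_clamp.
  rewrite (_ : plin_eval R clamp_plin = @clamp R); last by apply/funext => x; exact: plin_eval_clamp.
  by split; [exact: eps_approx_refl|rewrite ler_nat].
- by move=> n G v; case: (NP n) => _ _ _ /(_ G v).
Qed.

Theorem theorem1p3 (R : realType) (p : nat) (Q : query p) (HQ : is_query Q) :
  gnn_ri_computable R Q <-> in_TC0 Q.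
Proof.
by split; [exact: gnn_ri_computable_in_TC0|exact: TC0_gnn_ri_computable].
Qed.
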